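(* Let $G=SL_n$ and let $\mathcal{O}\subset\mathfrak{sl}_n$ be a nilpotent orbit with component group $A(\mathcal{O})$. Suppose that $P_1$ and $P_2$ are Richardson parabolics for $\mathcal{O}$, and that both $P_1$ and $P_2$ contain $L_1$ as a Levi subgroup. Let $e^\nu$ be a character of $L_1$ and $\chi$ a character of $A(\mathcal{O})$. If the extension of $e^\nu$ to $P_1$ lifts $\chi$, then the extension of $e^\nu$ to $P_2$ lifts $\chi$.
   Context: Everything is over $\mathbb{C}$. A parabolic subgroup $P_1=L_1U_1$ of $G$ (with Levi factor $L_1$, unipotent radical $U_1$, $\mathfrak{u}_1=\operatorname{Lie}U_1$) is a Richardson parabolic for $\mathcal{O}$ if $\mathcal{O}\cap\mathfrak{u}_1$ is dense in $\mathfrak{u}_1$. For $e\in\mathcal{O}$, $G^e$ is the stabilizer with identity component $G^e_0$, and $A(\mathcal{O})=G^e/G^e_0$; this group is abelian and is canonically identified for different $e$ via conjugation. If $P_1$ is a Richardson parabolic for $\mathcal{O}$ and $e_1\in\mathcal{O}\cap\mathfrak{u}_1$, then $G^{e_1}=P_1^{e_1}$, so $P_1^{e_1}/(P_1^{e_1})_0\cong A(\mathcal{O})$. A character $e^\nu$ of $L_1$ is extended to $P_1$ by making it trivial on $U_1$. A character $e^\nu$ of $P_1$ lifts the character $\chi$ of $A(\mathcal{O})$ if for some $e_1\in\mathcal{O}\cap\mathfrak{u}_1$ the character $e^\nu$ is trivial on $(P_1^{e_1})_0$ and the restriction of $e^\nu$ to $P_1^{e_1}$ defines the character $\chi$ of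 $P_1^{e_1}/(P_1^{e_1})_0\cong A(\mathcal{O})$ (this is independent of the choice of $e_1$). *)

(* Defs.v *)
From HB Require Import structures.
From mathcomp Require Import all_boot all_order all_algebra.
From mathcomp Require Import boolp classical_sets topology_structure connected.
From mathcomp Require Import mpoly.

Set Implicit Arguments.
Unset Strict Implicit.
Unset Printing Implicit Defensive.

Import GRing.Theory.
Local Open Scope classical_set_scope.
Local Open Scope ring_scope.

Section Zariski.
Context (K : fieldType) (n : nat).
Implicit Types (p q : {mpoly K[n * n]}) (S : set {mpoly K[n * n]}).

Definition mxeval p (x : 'M[K]_n) : K := p.@[fun k => mxvec x 0 k].

Definition zero_locus S : set 'M[K]_n :=
  [set x | forall p, S p -> mxeval p x = 0].

Definition vanishing_ideal (A : set 'M[K]_n) : set {mpoly K[n * n]} :=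
  [set p | forall x, A x -> mxeval p x = 0].

Definition zariski_open (A : set 'M[K]_n) : Prop :=
  exists S, ~` A = zero_locus S.

Lemma zariski_openT : zariski_open setT.
Proof.
exists [set 1]; rewrite setCT; apply/esym/seteqP; split=> x //= /(_ 1 erefl).
by rewrite /mxeval meval1 => /eqP; rewrite oner_eq0.
Qed.

Lemma zariski_openI : setI_closed zariski_open.
Proof.
move=> A B [S AS] [T BT].
exists [set r | exists p q, [/\ S p, T q & r = p * q]].
rewrite setCI AS BT; apply/seteqP; split=> x /=.
  move=> xST r [p [q [Sp Tq ->]]]; rewrite /mxeval mevalM.
  case: xST => [/(_ _ Sp)|/(_ _ Tq)]; rewrite /mxeval => ->.
    by rewrite mul0r.
  by rewrite mulr0.
move=> xST; have [xS|/existsNP[p /not_implyP[Sp px]]] :=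
  pselect (zero_locus S x); [by left|right=> q Tq].
have /eqP := xST (p * q) (ex_intro _ p (ex_intro _ q (And3 Sp Tq erefl))).
by rewrite /mxeval mevalM mulf_eq0 => /orP[/eqP //|/eqP].
Qed.

Lemma zariski_open_bigU (I : Type) (f : I -> set 'M[K]_n) :
  (forall i, zariski_open (f i)) -> zariski_open (\bigcup_i f i).
Proof.
move=> fo; exists (\bigcup_i vanishing_ideal (~` f i)).
rewrite setC_bigcup; apply/seteqP; split=> x /= xf.
  by move=> p [i _]; apply; exact: xf.
move=> i _; have [S fS] := fo i; rewrite fS => p Sp; apply: xf.
by exists i => // y; rewrite fS; apply.
Qed.

(* An alias of 'M[K]_n, so that the Zariski topology does not compete with
   the entrywise (product) topology that matrices inherit from K. *)
Definition zariski : Type := 'M[K]_n.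

HB.instance Definition _ := Choice.on zariski.
HB.instance Definition _ := isOpenTopological.Build zariski
  zariski_openT zariski_openI zariski_open_bigU.

Definition zclosed (A : set 'M[K]_n) : Prop := closed (A : set zariski).

Definition zconnected (A : set 'M[K]_n) : Prop := connected (A : set zariski).

Definition zclosure (A : set 'M[K]_n) : set 'M[K]_n :=
  closure (A : set zariski).

Definition id_component (H : set 'M[K]_n) : set 'M[K]_n :=
  connected_component (H : set zariski) 1%:M.

End Zariski.

Section AlgebraicGroups.
Context (K : fieldType) (n : nat).
Implicit Types (x g u e X : 'M[K]_n) (H P U L B O A : set 'M[K]_n).

Definition SL : set 'M[K]_n := [set g | \det g = 1].

Definition subgroup H : Prop :=
  [/\ H `<=` SL, H 1%:M, (forall x y, H x -> H y -> H (x *m y))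
    & forall x, H x -> H (invmx x)].

Definition closed_subgroup H : Prop := subgroup H /\ zclosed H.

Definition mxconj g x : 'M[K]_n := g *m x *m invmx g.

Definition normal_in U P : Prop :=
  forall g u, P g -> U u -> U (mxconj g u).

Definition derived_subgroup H : set 'M[K]_n :=
  smallest subgroup [set mxconj x y *m invmx y | x in H & y in H].

Definition solvable_group H : Prop :=
  exists k, iter k derived_subgroup H = [set 1%:M].

Definition borel B : Prop :=
  [/\ closed_subgroup B, zconnected B, solvable_group B
    & forall H, closed_subgroup H -> zconnected H -> solvable_group H ->
        B `<=` H -> H = B].

Definition parabolic P : Prop :=
  closed_subgroup P /\ exists2 B, borel B & B `<=` P.

Definition nilpotent_mx x : Prop := exists k, x ^+ k = 0.

Definition unipotent_mx x : Prop := nilpotent_mx (x - 1%:M).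

Definition normal_unipotent P U : Prop :=
  [/\ closed_subgroup U, zconnected U, U `<=` P, normal_in U P
    & U `<=` unipotent_mx].

Definition unipotent_radical P U : Prop :=
  normal_unipotent P U /\ forall V, normal_unipotent P V -> V `<=` U.

(* P = L U is a semidirect product of algebraic groups; in characteristic 0
   a closed complement of the unipotent radical is a Levi subgroup. *)
Definition levi_factor P U L : Prop :=
  [/\ closed_subgroup L, [set l *m u | l in L & u in U] = P
    & L `&` U = [set 1%:M]].

(* The Zariski tangent space at the identity. *)
Definition lie_algebra H : set 'M[K]_n :=
  [set X | forall p : {mpoly K[n * n]}, vanishing_ideal H p ->
    \sum_k mxeval p^`M(k) 1%:M * mxvec X 0 k = 0].

Definition nilpotent_orbit O : Prop :=
  exists e, [/\ \tr e = 0, nilpotent_mx e & O = [set mxconj g e | g in SL]].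

Definition stab H e : set 'M[K]_n := [set g | H g /\ mxconj g e = e].

Definition richardson O P U : Prop :=
  [/\ parabolic P, unipotent_radical P U
    & lie_algebra U `<=` zclosure (O `&` lie_algebra U)].

Definition lcoset x H : set 'M[K]_n := [set x *m h | h in H].

(* The elements of A(e) = G^e / G^e_0, as left cosets; the group law is the
   product of subsets. *)
Definition component_group e : set (set 'M[K]_n) :=
  [set lcoset x (id_component (stab SL e)) | x in stab SL e].

Definition set_mul A B : set 'M[K]_n := [set a *m b | a in A & b in B].

(* The groups A(e), for e in O, are identified by conjugation, so a character
   of A(O) is a family of characters chi e of A(e) compatible with these
   identifications. *)
Definition component_character O (chi : 'M[K]_n -> set 'M[K]_n -> K) : Prop :=
  [/\ forall e a b, O e -> component_group e a -> component_group e b ->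
        chi e (set_mul a b) = chi e a * chi e b,
      forall e a, O e -> component_group e a -> chi e a != 0
    & forall g e a, SL g -> O e -> component_group e a ->
        chi (mxconj g e) (mxconj g @` a) = chi e a].

(* Polynomials restrict onto the regular functions on L, because L is closed
   in 'M[K]_n. *)
Definition algebraic_character L (nu : 'M[K]_n -> K) : Prop :=
  [/\ exists p : {mpoly K[n * n]}, forall x, L x -> nu x = mxeval p x,
      forall x y, L x -> L y -> nu (x *m y) = nu x * nu y
    & forall x, L x -> nu x != 0].

Definition levi_part U L x : 'M[K]_n :=
  xget 1%:M [set l | L l /\ exists2 u, U u & x = l *m u].

Definition extend_character U L (nu : 'M[K]_n -> K) : 'M[K]_n -> K :=
  nu \o levi_part U L.

(* Here mu is a character of P; stab P e1 maps to A(e1) via the inclusion in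
   stab SL e1. *)
Definition lifts O P U (mu : 'M[K]_n -> K)
    (chi : 'M[K]_n -> set 'M[K]_n -> K) : Prop :=
  exists e1, [/\ (O `&` lie_algebra U) e1,
    forall x, id_component (stab P e1) x -> mu x = 1
  & forall x, stab P e1 x ->
      mu x = chi e1 (lcoset x (id_component (stab SL e1)))].

End AlgebraicGroups.

(* Main.v *)
(** Both parabolic subgroups contain the centre of [L1], and a suitable central
    element [z] satisfies [L1 = C(z)] in [SL]. For [e] in the Lie algebra of the
    unipotent radical [U] and [t <> 0], the matrix [t z + e] is conjugate to [t z]
    under [U], so its centralizer is a conjugate of [L1], on which the extension
    of [nu] is the transported [nu]; this does not depend on the parabolic. By
    density, the Richardson elements [e1] and [e2 = k e1 k^-1] have the largest
    possible orbits, so the centralizer algebras of [t z + e1] and the spaces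
    of intertwiners from [t z + e1] to [t z + e2] have constant dimension in [t].
    Hence [k], and every [g] commuting with [e1], extend to polynomial families
    in [t], and letting [t] tend to [0] shows that [g] lies in the parabolic and
    that the two extensions of [nu] take the same value at [g] and [k g k^-1].

    The structure of the parabolic subgroups comes from the Lie-Kolchin theorem,
    which turns a Borel subgroup into the triangular one, and from Kolchin's
    theorem, which identifies the unipotent radicals. *)

Require Import Defs.
From mathcomp Require Import all_boot all_order all_algebra.
From mathcomp Require Import boolp classical_sets topology_structure connected.
From mathcomp Require Import mpoly separable zify ring.
From mathcomp Require Import reals complex.

Set Implicit Arguments.
Unset Strict Implicit.
Unset Printing Implicit Defensive.

Import Order.TTheory GRing.Theory Num.Theory.
Local Open Scope classical_set_scope.
Local Open Scope ring_scope.

(** * Regular functions and the Zariski topology *)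

(** For [t <> 0], the elements of the two centralizers that correspond under the lifted [k] have
    Levi parts conjugate in [L1], and a character does not distinguish conjugate elements; at
    [t = 0] no such relation is visible. One [z] serves both parabolics because the condition that
    [L1] is the centralizer of [z] in [SL] mentions neither of them.

    Two obstacles shape the limit. Dimensions must not jump at [t = 0]: it is enough to exhibit one
    matrix in the nilradical whose centralizer is no larger than that of [z], since the rank is
    lower semicontinuous and the orbit is dense there. Moreover, the lift of [g] commutes with
    [t z + e1] but leaves [SL], where [nu] is given; the correction by an [n]-th root of its
    determinant is not polynomial in [t], so the comparison takes place on the curve [c ^+ n =
    d.[t]].

    Borel subgroups and unipotent radicals are defined by maximality among connected groups. To use
    it, the explicit candidates are shown to be connected by joining their elements to 1 along
    rational curves. *)

Section Regular.
Context (K : fieldType).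

(** [Q] is abstract so that one induction covers both regular functions and, below, fractions with a
    fixed denominator. *)
Lemma mxeval_closed (X : Type) (Q : (X -> K) -> Prop) (n : nat)
    (h : X -> 'M[K]_n) (p : {mpoly K[n * n]}) :
  (forall c, Q (fun=> c)) ->
  (forall f g, Q f -> Q g -> Q (fun x => f x + g x)) ->
  (forall f g, Q f -> Q g -> Q (fun x => f x * g x)) ->
  (forall i j, Q (fun x => h x i j)) ->
  Q (fun x => mxeval p (h x)).
Proof.
move=> Qc QD QM Qh.
have -> : (fun x => mxeval p (h x)) = (fun x => \sum_(m <- msupp p)
    p@_m * \prod_i (mxvec (h x) 0 i) ^+ m i).
  by apply/funext => x; rewrite /mxeval mevalE.
have Qe k : Q (fun x => mxvec (h x) 0 k).
  by case/mxvec_indexP: k => i j; under eq_fun do rewrite mxvecE.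
elim: (msupp p) => [|m s IH]; first by under eq_fun do rewrite big_nil.
under eq_fun do rewrite big_cons.
apply: (QD _ _ _ IH); apply: (QM _ _) => //.
elim: (index_enum _) => [|k t IHt]; first by under eq_fun do rewrite big_nil.
under eq_fun do rewrite big_cons.
apply: (QM _ _ _ IHt); elim: (m k) => [|e IHe]; first by under eq_fun do rewrite expr0.
by under eq_fun do rewrite exprS; exact: QM.
Qed.

Definition regular n (f : 'M[K]_n -> K) : Prop :=
  exists p, forall x, f x = mxeval p x.

Definition regmx n m k (F : 'M[K]_n -> 'M[K]_(m, k)) : Prop :=
  forall i j, regular (fun x => F x i j).

Lemma regular_cst n c : regular (fun _ : 'M[K]_n => c).
Proof. by exists c%:MP => x; rewrite /mxeval mevalC. Qed.

Lemma regularD n (f g : 'M[K]_n -> K) :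
  regular f -> regular g -> regular (fun x => f x + g x).
Proof.
by move=> [p pf] [q qg]; exists (p + q) => x; rewrite pf qg /mxeval mevalD.
Qed.

Lemma regularM n (f g : 'M[K]_n -> K) :
  regular f -> regular g -> regular (fun x => f x * g x).
Proof.
by move=> [p pf] [q qg]; exists (p * q) => x; rewrite pf qg /mxeval mevalM.
Qed.

Lemma regularN n (f : 'M[K]_n -> K) : regular f -> regular (fun x => - f x).
Proof. by move=> [p pf]; exists (- p) => x; rewrite pf /mxeval mevalN. Qed.

Lemma regularB n (f g : 'M[K]_n -> K) :
  regular f -> regular g -> regular (fun x => f x - g x).
Proof. by move=> rf rg; apply: regularD => //; apply: regularN. Qed.

Lemma regular_sum n (I : Type) (r : seq I) (P : pred I)
    (F : I -> 'M[K]_n -> K) :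
  (forall i, regular (F i)) -> regular (fun x => \sum_(i <- r | P i) F i x).
Proof.
move=> rF; elim: r => [|i r IH].
  by under eq_fun do rewrite big_nil; exact: regular_cst.
under eq_fun do rewrite big_cons; case: (P i) => //; exact: regularD.
Qed.

Lemma regular_prod n (I : Type) (r : seq I) (P : pred I)
    (F : I -> 'M[K]_n -> K) :
  (forall i, regular (F i)) -> regular (fun x => \prod_(i <- r | P i) F i x).
Proof.
move=> rF; elim: r => [|i r IH].
  by under eq_fun do rewrite big_nil; exact: regular_cst.
under eq_fun do rewrite big_cons; case: (P i) => //; exact: regularM.
Qed.

Lemma regmx_id n : regmx (fun x : 'M[K]_n => x).
Proof.
move=> i j; exists 'X_(mxvec_index i j) => x.
by rewrite /mxeval mevalXU mxvecE.
Qed.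

Lemma regmx_cst n m k (a : 'M[K]_(m, k)) : regmx (fun _ : 'M[K]_n => a).
Proof. by move=> i j; exact: regular_cst. Qed.

Lemma regmxM n m k l (F : 'M[K]_n -> 'M[K]_(m, k)) (G : 'M[K]_n -> 'M[K]_(k, l)) :
  regmx F -> regmx G -> regmx (fun x => F x *m G x).
Proof.
move=> rF rG i j; under eq_fun do rewrite mxE.
by apply: regular_sum => h; apply: regularM.
Qed.

Lemma regmxD n m k (F G : 'M[K]_n -> 'M[K]_(m, k)) :
  regmx F -> regmx G -> regmx (fun x => F x + G x).
Proof.
by move=> rF rG i j; under eq_fun do rewrite mxE; apply: regularD.
Qed.

Lemma regmxN n m k (F : 'M[K]_n -> 'M[K]_(m, k)) :
  regmx F -> regmx (fun x => - F x).
Proof.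
by move=> rF i j; under eq_fun do rewrite mxE; apply: regularN.
Qed.

Lemma regular_det n m (F : 'M[K]_n -> 'M[K]_m) :
  regmx F -> regular (fun x => \det (F x)).
Proof.
move=> rF; apply: regular_sum => s; apply: regularM; first exact: regular_cst.
by apply: regular_prod.
Qed.

Lemma regmx_adj n m (F : 'M[K]_n -> 'M[K]_m) :
  regmx F -> regmx (fun x => \adj (F x)).
Proof.
move=> rF i j; under eq_fun do rewrite mxE; apply: regularM; first exact: regular_cst.
by apply: regular_det => a b; under eq_fun do rewrite !mxE.
Qed.

Lemma regmx_lin n m k l (F : 'M[K]_n -> 'M[K]_(m, k)) (A : 'M[K]_(m * k, l)) :
  regmx F -> regmx (fun x => mxvec (F x) *m A).
Proof.
move=> rF; apply: regmxM; last exact: regmx_cst.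
by move=> i j; rewrite ord1; case/mxvec_indexP: j => a b; under eq_fun do rewrite mxvecE.
Qed.

Lemma regular_comp n m (f : 'M[K]_m -> K) (F : 'M[K]_n -> 'M[K]_m) :
  regular f -> regmx F -> regular (fun x => f (F x)).
Proof.
move=> [p pf] rF; under eq_fun do rewrite pf.
by apply: mxeval_closed => //; [exact: regular_cst|exact: regularD|exact: regularM].
Qed.

Lemma regmx_comp n m k l (F : 'M[K]_n -> 'M[K]_m) (G : 'M[K]_m -> 'M[K]_(k, l)) :
  regmx F -> regmx G -> regmx (fun x => G (F x)).
Proof. by move=> rF rG i j; apply: (regular_comp (rG i j)). Qed.


Lemma zopenP n (A : set 'M[K]_n) :
  open (A : set (zariski K n)) <->
  exists S : set {mpoly K[n * n]}, ~` A = zero_locus S.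
Proof. by []. Qed.

Lemma zclosedP n (A : set 'M[K]_n) :
  zclosed A <-> exists S : set {mpoly K[n * n]}, A = zero_locus S.
Proof. by rewrite /zclosed -openC zopenP setCK. Qed.

Lemma zclosed_zero n (f : 'M[K]_n -> K) :
  regular f -> zclosed [set x | f x = 0].
Proof.
move=> [p pf]; apply/zclosedP; exists [set p].
by apply/seteqP; split=> x /=; rewrite pf; [move=> fx _ ->|move/(_ p erefl)].
Qed.

Lemma zclosed_bigcap n (I : Type) (A : I -> set 'M[K]_n) :
  (forall i, zclosed (A i)) -> zclosed [set x | forall i, A i x].
Proof.
move=> cA; suff -> : [set x | forall i, A i x] = \bigcap_i A i.
  by apply: (@closed_bigI (zariski K n)) => i _; exact: cA.
by apply/seteqP; split=> x Ax i //; exact: Ax.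
Qed.

Lemma zclosedI n (A B : set 'M[K]_n) :
  zclosed A -> zclosed B -> zclosed (A `&` B).
Proof. exact: (@closedI (zariski K n)). Qed.

Lemma zclosed_preimage n m (F : 'M[K]_n -> 'M[K]_m) (A : set 'M[K]_m) :
  regmx F -> zclosed A -> zclosed (F @^-1` A).
Proof.
move=> rF /zclosedP[S ->].
suff -> : F @^-1` zero_locus S =
    [set x | forall q : {p | S p}, mxeval (projT1 q) (F x) = 0].
  by apply: zclosed_bigcap => q; apply/zclosed_zero/regular_comp => //; exists (projT1 q).
apply/seteqP; split=> x /= Sx; first by case=> q Sq; exact: Sx.
by move=> q Sq; exact: (Sx (exist _ q Sq)).
Qed.

Lemma zclosure_zero n (A : set 'M[K]_n) (f : 'M[K]_n -> K) x :
  regular f -> (forall y, A y -> f y = 0) -> zclosure A x -> f x = 0.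
Proof.
move=> rf Af; rewrite /zclosure closureE => /(_ [set y | f y = 0]); apply.
by split=> //; exact: zclosed_zero.
Qed.

Lemma zclosed_SL n : zclosed (@SL K n).
Proof.
suff -> : @SL K n = [set x | \det x - 1 = 0].
  apply/zclosed_zero/regularB; last exact: regular_cst.
  by apply: regular_det; exact: regmx_id.
by apply/seteqP; split=> x /=; [move->; rewrite subrr|move/eqP; rewrite subr_eq0 => /eqP].
Qed.

Lemma zopen_preimage n m (F : 'M[K]_n -> 'M[K]_m) (A : set 'M[K]_m) :
  regmx F -> open (A : set (zariski K m)) ->
  open (F @^-1` A : set (zariski K n)).
Proof.
move=> rF oA; rewrite -[F @^-1` A]setCK openC.
by apply: (zclosed_preimage rF (A := ~` A)); apply: open_closedC.
Qed.

Lemma zconnected_image n m (F : 'M[K]_n -> 'M[K]_m) (A : set 'M[K]_n) :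
  regmx F -> zconnected A -> zconnected (F @` A).
Proof.
move=> rF cA B [y By] [C oC BC] [D cD BD].
have AB C' : B = F @` A `&` C' -> A `&` F @^-1` B = A `&` F @^-1` C'.
  move=> BC'; apply/seteqP; split=> x /= [Ax].
    by rewrite BC' => -[].
  by move=> C'x; split=> //; rewrite BC'; split=> //; exists x.
have AE : A `&` F @^-1` B = A.
  apply: cA; last 2 first.
  - by exists (F @^-1` C); [exact: zopen_preimage|exact: AB].
  - by exists (F @^-1` D); [exact: zclosed_preimage|exact: AB].
  have [[x Ax xy] _] : (F @` A `&` C) y by rewrite -BC.
  by exists x; split; rewrite // /preimage /= xy.
apply/seteqP; split=> [z|_ [x Ax <-]]; first by rewrite BC => -[].
by move: Ax; rewrite -AE => -[].
Qed.

(** Each fibre of [f] on [A] is closed, and also open: its complement is the zero set of the product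
    [g] over the other values in [s]. *)
Lemma zconnected_finite_cst n (A : set 'M[K]_n) (f : 'M[K]_n -> K) (s : seq K) :
  zconnected A -> regular f -> (forall x, A x -> f x \in s) ->
  forall x y, A x -> A y -> f x = f y.
Proof.
move=> cA rf fs x y Ax Ay.
pose B := A `&` [set z | f z - f x = 0].
suff BA : B = A by move: Ay; rewrite -BA => -[_ /= /eqP]; rewrite subr_eq0 => /eqP.
pose g z := \prod_(c <- s | c != f x) (f z - c).
have rg : regular g.
  by apply: regular_prod => c; apply: regularB => //; exact: regular_cst.
apply: cA.
- by exists x; split=> //=; rewrite subrr.
- exists (~` [set z | g z = 0]); first by apply: closed_openC; exact: zclosed_zero.
  apply/seteqP; split=> z [Az] /=.
    move/eqP; rewrite subr_eq0 => /eqP fz; split=> //.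
    apply/eqP; rewrite prodf_seq_neq0; apply/allP => c cs; apply/implyP.
    by rewrite fz subr_eq0 eq_sym.
  move=> gz; split=> //=; apply/eqP; rewrite subr_eq0.
  apply: contra_notT gz => fz; apply/eqP; rewrite prodf_seq_eq0.
  by apply/hasP; exists (f z); [exact: fs|rewrite fz subrr eqxx].
- exists [set z | f z - f x = 0] => //; apply: zclosed_zero.
  by apply: regularB => //; exact: regular_cst.
Qed.

Lemma zcomponent_mul n (G : set 'M[K]_n) x y : subgroup G ->
  id_component G x -> id_component G y -> id_component G (x *m y).
Proof.
move=> [_ G1 GM _] Cx Cy.
have Gx : G x by exact: (connected_component_sub Cx).
have xC : zconnected (mulmx x @` id_component G).
  apply: zconnected_image; last exact: component_connected.
  by apply: regmxM; [exact: regmx_cst|exact: regmx_id].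
apply: connected_component_trans Cx _.
apply: (connected_component_max _ _ xC).
- by exists 1%:M; rewrite ?mulmx1 //; exact: connected_component_refl.
- by move=> _ [z /connected_component_sub Gz <-]; exact: GM.
- by exists y.
Qed.

Lemma SL_unit n (x : 'M[K]_n) : SL x -> x \in unitmx.
Proof. by rewrite unitmxE => ->; rewrite unitr1. Qed.

(** This makes inversion polynomial, hence usable with [regmx]. *)
Lemma SL_inv n (x : 'M[K]_n) : SL x -> invmx x = \adj x.
Proof.
by move=> dx; rewrite /invmx SL_unit // dx invr1 scale1r.
Qed.

Lemma zcomponent_inv n (G : set 'M[K]_n) x : subgroup G ->
  id_component G x -> id_component G (invmx x).
Proof.
move=> [GS G1 GM GV] Cx; have Gx : G x by exact: (connected_component_sub Cx).
have cC : zconnected ((fun z => \adj z) @` id_component G).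
  apply: zconnected_image; last exact: component_connected.
  by apply: regmx_adj; exact: regmx_id.
apply: (connected_component_max _ _ cC).
- by exists 1%:M; rewrite ?adj1 //; exact: connected_component_refl.
- move=> _ [z /connected_component_sub Gz <-].
  by rewrite -SL_inv; [exact: GV|exact: GS].
- by exists x; rewrite // SL_inv //; exact: GS.
Qed.

Lemma zcomponent_subgroup n (G : set 'M[K]_n) :
  subgroup G -> subgroup (id_component G).
Proof.
move=> sG; have [GS G1 GM GV] := sG; split.
- by move=> x /connected_component_sub; exact: GS.
- exact: connected_component_refl.
- by move=> x y; exact: zcomponent_mul.
- by move=> x; exact: zcomponent_inv.
Qed.

Lemma derived_sub n (G : set 'M[K]_n) :
  subgroup G -> derived_subgroup G `<=` G.
Proof.
move=> sG; have [GS G1 GM GV] := sG.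
apply: smallest_sub => // _ [x Gx [y Gy <-]].
by apply: (GM); [apply: (GM); [exact: GM|exact: GV]|exact: GV].
Qed.

Lemma derived_subgroupP n (G : set 'M[K]_n) :
  subgroup G -> subgroup (derived_subgroup G).
Proof.
move=> sG; have [GS G1 GM GV] := sG; split.
- by move=> x /(derived_sub sG); exact: GS.
- by move=> H [[_ H1 _ _] _].
- by move=> x y Dx Dy H HP; have [[_ _ HM _] _] := HP; apply: HM; [exact: Dx|exact: Dy].
- by move=> x Dx H HP; have [[_ _ _ HV] _] := HP; apply: HV; exact: Dx.
Qed.

(** For fixed [x], the commutators of [x] with [G] form the image of a connected set and include 1.
    So the identity component of the derived subgroup contains all generators, and it is a
    subgroup. *)
Lemma derived_connected n (G : set 'M[K]_n) :
  subgroup G -> zconnected G -> zconnected (derived_subgroup G).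
Proof.
move=> sG cG; have [GS G1 GM GV] := sG; have sD := derived_subgroupP sG.
suff <- : id_component (derived_subgroup G) = derived_subgroup G.
  exact: component_connected.
apply/seteqP; split=> [x|]; first by move=> /connected_component_sub.
apply: (smallest_sub (C := @subgroup K n)); first exact: (zcomponent_subgroup sD).
move=> _ [x Gx [y Gy <-]].
pose F z := mxconj x z *m \adj z.
have FE z : G z -> F z = mxconj x z *m invmx z by move=> /GS/SL_inv ->.
have cF : zconnected (F @` G).
  apply: zconnected_image => //; rewrite /F /mxconj; apply: regmxM; last first.
    by apply: regmx_adj; exact: regmx_id.
  by apply: regmxM; [apply: regmxM; [exact: regmx_cst|exact: regmx_id]|exact: regmx_cst].
apply: (connected_component_max _ _ cF).
- exists 1%:M => //; rewrite FE // /mxconj mulmx1 mulmxV ?mul1mx ?invmx1 //.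
  by apply: SL_unit; exact: GS.
- move=> _ [z Gz <-]; rewrite FE //.
  by apply: sub_gen_smallest; exists x => //; exists z.
- by exists y => //; rewrite FE.
Qed.

End Regular.

(** * Rational curves *)

Lemma poly_nonroot (K : numDomainType) (p : {poly K}) :
  p != 0 -> exists t, p.[t] != 0.
Proof.
move=> p0; apply: contrapT => /forallNP pt.
have : (size [seq i%:R : K | i <- iota 0 (size p)] < size p)%N.
  apply: max_poly_roots => //.
    apply/allP => _ /mapP[i _ ->]; apply/rootP/eqP/negPn/negP; exact: pt.
  by rewrite map_inj_uniq ?iota_uniq //; apply: mulrIn; rewrite oner_eq0.
by rewrite size_map size_iota ltnn.
Qed.

Lemma poly_generic_eq0 (K : numDomainType) (p d : {poly K}) :
  d != 0 -> (forall t, d.[t] != 0 -> p.[t] = 0) -> p = 0.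
Proof.
move=> d0 pd; apply/eqP; apply: contraT => p0.
have [t] : exists t, (p * d).[t] != 0 by apply: poly_nonroot; rewrite mulf_neq0.
by rewrite hornerM mulf_eq0 negb_or => /andP[pt /pd /eqP]; rewrite (negPf pt).
Qed.

Section Curves.
Context (K : numFieldType).

(** Evaluating a polynomial at entries with denominator [D] only raises the power of [D]. The class
    [Q] of numerators is abstract to allow polynomials in one parameter as well as in two. *)
Lemma mxeval_fraction (X : Type) (Q : (X -> K) -> Prop) (D : X -> K) (n : nat)
    (h : X -> 'M[K]_n) (p : {mpoly K[n * n]}) :
  (forall c, Q (fun=> c)) ->
  (forall f g, Q f -> Q g -> Q (fun x => f x + g x)) ->
  (forall f g, Q f -> Q g -> Q (fun x => f x * g x)) ->
  Q D ->
  (forall i j, exists2 f, Q f & forall x, D x != 0 -> h x i j = f x / D x) ->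
  exists2 f, Q f &
    exists k, forall x, D x != 0 -> mxeval p (h x) = f x / D x ^+ k.
Proof.
move=> Qc QD QM QDD Qh.
have QX k : Q (fun x => D x ^+ k).
  elim: k => [|k IH]; first by under eq_fun do rewrite expr0.
  by under eq_fun do rewrite exprS; exact: QM.
apply: (@mxeval_closed _ _ (fun g => exists2 f, Q f &
    exists k, forall x, D x != 0 -> g x = f x / D x ^+ k)).
- by move=> c; exists (fun=> c) => //; exists 0%N => x _; rewrite expr0 divr1.
- move=> f g [f' Qf [k fE]] [g' Qg [l gE]].
  exists (fun x => f' x * D x ^+ l + g' x * D x ^+ k).
    by apply: QD; apply: QM.
  exists (k + l)%N => x Dx; rewrite fE // gE // addf_div ?expf_neq0 //.
  by rewrite exprD.
- move=> f g [f' Qf [k fE]] [g' Qg [l gE]].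
  exists (fun x => f' x * g' x); first exact: QM.
  by exists (k + l)%N => x Dx; rewrite fE // gE // mulf_div exprD.
- by move=> i j; have [f Qf fE] := Qh i j; exists f => //; exists 1%N.
Qed.

Definition polyfun (f : K -> K) : Prop := exists p : {poly K}, forall t, f t = p.[t].

Lemma polyfun_cst c : polyfun (fun=> c).
Proof. by exists c%:P => t; rewrite hornerC. Qed.

Lemma polyfunD f g : polyfun f -> polyfun g -> polyfun (fun t => f t + g t).
Proof. by move=> [p pf] [q qg]; exists (p + q) => t; rewrite hornerD pf qg. Qed.

Lemma polyfunM f g : polyfun f -> polyfun g -> polyfun (fun t => f t * g t).
Proof. by move=> [p pf] [q qg]; exists (p * q) => t; rewrite hornerM pf qg. Qed.

Definition evalmx m n (N : 'M[{poly K}]_(m, n)) t := map_mx (fun p => p.[t]) N.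

(** The parameter line without the roots of [d] is irreducible: a point of [C] and a point outside
    [F] are detected by nonzero polynomials [g] and [f], and some [t] avoids the roots of [d], [f]
    and [g] together. *)
Lemma rational_curve_connected n (N : 'M[{poly K}]_n) (d : {poly K}) :
  zconnected [set (d.[t])^-1 *: evalmx N t | t in [set t | d.[t] != 0]].
Proof.
pose h t := d.[t]^-1 *: evalmx N t.
set X := [set _ | _ in _].
move=> B [b Bb] [C oC BC] [F cF BF].
have hp p : exists f : {poly K},
    forall t, d.[t] != 0 -> (mxeval p (h t) == 0) = (f.[t] == 0).
  have [||||i j|f [q qf] [k fE]] :=
    @mxeval_fraction K polyfun (fun t => d.[t]) n h p.
  - exact: polyfun_cst.
  - exact: polyfunD.
  - exact: polyfunM.
  - by exists d.
  - exists (fun t => (N i j).[t]); first by exists (N i j).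
    by move=> t _; rewrite !mxE mulrC.
  exists q => t dt; rewrite fE // mulf_eq0 -qf invr_eq0 expf_eq0 (negPf dt).
  by rewrite andbF orbF.
have d0 : d != 0.
  have [[t dt _] _] : (X `&` C) b by rewrite -BC.
  by apply: contraNneq dt => ->; rewrite horner0.
apply: contrapT => BX.
have [s ds sF] : exists2 s, d.[s] != 0 & ~ F (h s).
  apply: contrapT => H; apply: BX; rewrite BF.
  apply/seteqP; split=> [x []//|_ [t dt <-]]; split; first by exists t.
  by apply: contrapT => tF; apply: H; exists t.
have [s' ds' s'C] : exists2 s', d.[s'] != 0 & C (h s').
  have [[t dt tb] Cb] : (X `&` C) b by rewrite -BC.
  by exists t; rewrite // /h tb.
have /zclosedP[S SF] := cF.
have [T TC] := (zopenP C).1 oC.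
have [p Sp ps] : exists2 p, S p & mxeval p (h s) != 0.
  apply: contrapT => H; apply: sF; rewrite SF => p Sp.
  by apply/eqP; apply: contrapT => /negP ps; apply: H; exists p.
have [q Tq qs'] : exists2 q, T q & mxeval q (h s') != 0.
  apply: contrapT => H; have : (~` C) (h s'); last exact.
  rewrite TC => q Tq.
  by apply/eqP; apply: contrapT => /negP qs; apply: H; exists q.
have [f fp] := hp p; have [g gq] := hp q.
have [t] : exists t, (d * (f * g)).[t] != 0.
  apply: poly_nonroot; rewrite !mulf_neq0 //.
    by apply: contraNneq ps => f0; rewrite fp // f0 horner0.
  by apply: contraNneq qs' => g0; rewrite gq // g0 horner0.
rewrite !hornerM !mulf_eq0 !negb_or => /and3P[dt ft gt].
have Ct : C (h t).
  rewrite -[C]setCK => Ct; have := Ct; rewrite TC => /(_ _ Tq)/eqP.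
  by rewrite gq // (negPf gt).
have : B (h t) by rewrite BC; split=> //; exists t.
by rewrite BF => -[_]; rewrite SF => /(_ _ Sp)/eqP; rewrite fp // (negPf ft).
Qed.

Lemma rational_curve_component n (G : set 'M[K]_n) (N : 'M[{poly K}]_n)
    (d : {poly K}) s t :
  (forall r, d.[r] != 0 -> G (d.[r]^-1 *: evalmx N r)) ->
  d.[s] != 0 -> d.[t] != 0 -> d.[s]^-1 *: evalmx N s = 1%:M ->
  id_component G (d.[t]^-1 *: evalmx N t).
Proof.
move=> NG ds dt Ns.
apply: (connected_component_max _ _ (@rational_curve_connected n N d)).
- by exists s.
- by move=> _ [r dr <-]; exact: NG.
- by exists t.
Qed.

(** The denominator [d] leaves room for curves that must be divided by a determinant to stay in
    [SL]. *)
Lemma zconnected_curves n (G : set 'M[K]_n) : G 1%:M ->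
  (forall g, G g -> exists (N : 'M[{poly K}]_n) (d : {poly K}) s t,
     [/\ forall r, d.[r] != 0 -> G (d.[r]^-1 *: evalmx N r),
         d.[s] != 0, d.[t] != 0, d.[s]^-1 *: evalmx N s = 1%:M
       & d.[t]^-1 *: evalmx N t = g]) ->
  zconnected G.
Proof.
move=> G1 GN; suff <- : id_component G = G by exact: component_connected.
apply/seteqP; split=> [x|x /GN]; first by move=> /connected_component_sub.
by move=> [N [d [s [t [NG ds dt Ns <-]]]]]; apply: (rational_curve_component (s := s)).
Qed.

End Curves.

(** * Solvable connected groups *)

Section StableSubspaces.
Context (K : fieldType).

Definition linear_set m (S : set 'rV[K]_m) : Prop :=
  S 0 /\ forall a u v, S u -> S v -> S (a *: u + v).

(** Gives access to the rank calculus for subspaces known only as predicates: a row space of maximal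
    rank inside [S] exhausts it. *)
Lemma linear_setP m (S : set 'rV[K]_m) : linear_set S ->
  exists W : 'M[K]_m, forall v, S v <-> (v <= W)%MS.
Proof.
move=> [S0 SD].
pose P r := `[< exists W : 'M[K]_m, (forall v : 'rV_m, (v <= W)%MS -> S v) /\ \rank W =
  r >].
have exP : exists r, P r.
  by exists 0%N; apply/asboolP; exists 0; rewrite mxrank0; split=> // v;
    rewrite submx0 => /eqP ->.
have bP r : P r -> (r <= m)%N by move=> /asboolP[W [_ <-]]; exact: rank_leq_col.
case: (ex_maxnP exP bP) => r /asboolP[W [WS Wr]] rmax.
exists W => v; split; last exact: WS.
move=> Sv; apply: contraT => vW; have /rmax : P (\rank (W + <<v>>)%MS).
  apply/asboolP; eexists; split=> // u /sub_addsmxP[[x y] /= ->].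
  rewrite addrC; set z := y *m _; have : (z <= v)%MS.
    by rewrite /z (submx_trans (submxMl _ _)) // genmxE.
  by move=> /sub_rVP[a ->]; apply: SD => //; apply: WS; exact: submxMl.
rewrite leqNgt -Wr => /negP[]; rewrite ltn_neqAle mxrankS ?addsmxSl // andbT.
apply: contra vW => /eqP/esym rE.
have /eqmxP : (W == (W + <<v>>))%MS by rewrite -(geq_leqif (mxrank_leqif_eq (addsmxSl _
  _))) rE.
by move=> ->; rewrite (submx_trans _ (addsmxSr _ _)) // genmxE.
Qed.

(** With [X = 0] this yields an irreducible submodule, as needed for Lie-Kolchin; a general [X]
    yields an irreducible layer, as needed for Kolchin's theorem. *)
Lemma minimal_stable m (G : set 'M[K]_m) (X Y : 'M[K]_m) :
  (forall g, G g -> stablemx Y g) -> (X <= Y)%MS -> ~~ (Y <= X)%MS ->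
  exists W : 'M[K]_m, [/\ (X <= W)%MS, ~~ (W <= X)%MS, (W <= Y)%MS,
    forall g, G g -> stablemx W g
    & forall W' : 'M[K]_m, (forall g, G g -> stablemx W' g) -> (X <= W')%MS ->
        ~~ (W' <= X)%MS -> (W' <= W)%MS -> (W <= W')%MS].
Proof.
move=> GY XY YX.
pose P r := `[< exists W : 'M[K]_m, [/\ (X <= W)%MS, ~~ (W <= X)%MS, (W <= Y)%MS,
  forall g, G g -> stablemx W g & \rank W = r] >].
have exP : exists r, P r by exists (\rank Y); apply/asboolP; exists Y.
case: (ex_minnP exP) => r /asboolP[W [XW WX WY GW Wr]] rmin.
exists W; split=> // W' GW' XW' W'X W'W.
have /rmin : P (\rank W').
  by apply/asboolP; exists W'; split=> //; exact: submx_trans WY.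
by rewrite -Wr (geq_leqif (mxrank_leqif_sup W'W)).
Qed.

End StableSubspaces.

(** * The Lie-Kolchin theorem *)

Section LieKolchin.
Context (K : numClosedFieldType) (n : nat).

Lemma stable_eigenvector m (W h : 'M[K]_m) : W != 0 -> stablemx W h ->
  exists2 w : 'rV[K]_m, (w <= W)%MS /\ w != 0 & exists a, w *m h = a *: w.
Proof.
move=> W0 Wh; pose B := row_base W.
have Bh : (B *m h <= B)%MS by rewrite stablemx_row_base.
pose C := B *m h *m pinvmx B.
have BC : B *m h = C *m B by rewrite /C mulmxKpV.
have [|a /eigenvalueP[v vC v0]] := @eigenvalue_closed K _ C.
  by rewrite lt0n mxrank_eq0.
exists (v *m B).
  split; first by rewrite -(eq_row_base W) submxMl.
  by rewrite mulmx_free_eq0 ?row_base_free.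
by exists a; rewrite -mulmxA BC mulmxA vC scalemxAl.
Qed.

(** General representations are needed, not just the inclusion of [G], because the induction for
    triangular form passes to quotients. *)
Definition regular_rep (G : set 'M[K]_n) m (rho : 'M[K]_n -> 'M[K]_m) : Prop :=
  [/\ regmx rho, rho 1%:M = 1%:M
    & forall x y, G x -> G y -> rho (x *m y) = rho x *m rho y].

Lemma regular_rep_inv G m (rho : 'M[K]_n -> 'M[K]_m) x :
  subgroup G -> regular_rep G rho -> G x -> rho x *m rho (invmx x) = 1%:M.
Proof.
move=> [GS G1 GM GV] [_ r1 rM] Gx; rewrite -rM //; last exact: GV.
by rewrite mulmxV // SL_unit //; exact: GS.
Qed.

Lemma regular_rep_inj G m (rho : 'M[K]_n -> 'M[K]_m) x (w : 'rV_m) :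
  subgroup G -> regular_rep G rho -> G x -> w != 0 -> w *m rho x != 0.
Proof.
move=> sG rG Gx; apply: contraNneq => wx.
by rewrite -[w]mulmx1 -(regular_rep_inv sG rG Gx) mulmxA wx mul0mx.
Qed.

(* The eigenvalue of [h] at [w *m rho y] depends algebraically on [y] and takes
   finitely many values, so it is constant on the connected group [G]. *)
Lemma connected_eigenvalue_cst G m (rho : 'M[K]_n -> 'M[K]_m)
    (w : 'rV[K]_m) (h : 'M[K]_m) :
  subgroup G -> zconnected G -> regular_rep G rho -> w != 0 ->
  (forall y, G y -> exists c, w *m rho y *m h = c *: (w *m rho y)) ->
  exists a, forall y, G y -> w *m rho y *m h = a *: (w *m rho y).
Proof.
move=> sG cG rG w0 hw; have [GS G1 GM GV] := sG; have [rr r1 rM] := rG.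
have [j wj] : exists j, w 0 j != 0 by apply/rV0Pn.
(* Acting by the inverse of [y] brings [c *: (w *m rho y)] back to [c *: w], so [f y] is the
   eigenvalue [c]; the adjugate keeps [f] polynomial. *)
pose f y := (w *m rho y *m h *m rho (\adj y)) 0 j * (w 0 j)^-1.
have fE y c : G y -> w *m rho y *m h = c *: (w *m rho y) -> f y = c.
  move=> Gy yc; rewrite /f yc -SL_inv; last exact: GS.
  rewrite -scalemxAl -mulmxA (regular_rep_inv sG rG Gy) mulmx1.
  by rewrite mxE mulfK.
have rf : regular f.
  apply: regularM; last exact: regular_cst.
  suff : regmx (fun y => w *m rho y *m h *m rho (\adj y)) by apply.
  apply: regmxM; last first.
    by apply: (regmx_comp (F := fun y => \adj y)) => //; apply: regmx_adj;
      exact: regmx_id.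
  apply: regmxM; last exact: regmx_cst.
  by apply: regmxM => //; exact: regmx_cst.
have [s sE] := closed_field_poly_normal (char_poly h).
have fs y : G y -> f y \in s.
  move=> Gy; have [c yc] := hw y Gy; rewrite (fE y c) //.
  have : root (char_poly h) c.
    rewrite -eigenvalue_root_char; apply/eigenvalueP; exists (w *m rho y) => //.
    exact: (regular_rep_inj sG rG).
  by rewrite sE (monicP (char_poly_monic h)) scale1r root_prod_XsubC.
exists (f 1%:M) => y Gy.
have [c yc] := hw y Gy; rewrite yc; congr (_ *: _); rewrite -(fE y c) //.
by apply: (zconnected_finite_cst cG rf fs).
Qed.

Lemma derived_commutator (G : set 'M[K]_n) x y : G x -> G y ->
  derived_subgroup G (x *m y *m invmx x *m invmx y).
Proof. by move=> Gx Gy; apply: sub_gen_smallest; exists x => //; exists y. Qed.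


Lemma derived_regular_rep (G : set 'M[K]_n) m (rho : 'M[K]_n -> 'M[K]_m) :
  subgroup G -> regular_rep G rho -> regular_rep (derived_subgroup G) rho.
Proof.
move=> sG [rr r1 rM]; split=> // x y /(derived_sub sG) Gx /(derived_sub sG) Gy.
exact: rM.
Qed.

Lemma derived_normal (G : set 'M[K]_n) h y : subgroup G ->
  derived_subgroup G h -> G y -> derived_subgroup G (y *m h *m invmx y).
Proof.
move=> sG Dh Gy; have Gh := derived_sub sG Dh.
have [GS G1 GM GV] := sG; have [_ _ DM _] := derived_subgroupP sG.
suff -> : y *m h *m invmx y = (y *m h *m invmx y *m invmx h) *m h.
  by apply: DM => //; apply: derived_commutator => //; exact: GV.
by rewrite mulmxKV // SL_unit //; exact: GS.
Qed.

(* On a minimal stable subspace [W] of a weight space of the derived subgroup, an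
   eigenvector of [rho x] stays one under [G], with the same eigenvalue; so the
   commutators act trivially and [rho x] is scalar on [W]. *)
Lemma solvable_eigenvector k (G : set 'M[K]_n) m (rho : 'M[K]_n -> 'M[K]_m) :
  (0 < m)%N -> subgroup G -> zconnected G ->
  iter k (@derived_subgroup K n) G = [set 1%:M] -> regular_rep G rho ->
  exists2 w : 'rV[K]_m, w != 0 & forall g, G g -> exists a, w *m rho g = a *: w.
Proof.
move=> m0; elim: k G => [|k IH] G sG cG Gk rG; have [rr r1 rM] := rG.
  exists (const_mx 1).
    by apply/rV0Pn; exists (Ordinal m0); rewrite mxE oner_eq0.
  by move=> g; rewrite /= in Gk; rewrite Gk => ->; exists 1; rewrite r1 mulmx1 scale1r.
have [GS G1 GM GV] := sG.
rewrite iterSr in Gk; pose D := derived_subgroup G.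
have DG h : D h -> G h by exact: derived_sub.
have [w w0 wD] := IH D (derived_subgroupP sG) (derived_connected sG cG) Gk
  (derived_regular_rep sG rG).
have rconj y z : G y -> G z ->
    rho (y *m z *m invmx y) *m rho y = rho y *m rho z.
  move=> Gy Gz; have yu := SL_unit (GS _ Gy).
  have Gyz : G (y *m z *m invmx y) by apply: (GM _ _ _ (GV _ Gy)); exact: GM.
  by rewrite -!rM ?mulmxKV.
(* [w *m rho y] is an eigenvector of [rho h], its eigenvalue being the weight at [w] of the
   conjugate of [h] by [y]; connectedness makes this weight independent of [y]. *)
have wDG h y : D h -> G y -> exists2 a, w *m rho h = a *: w &
    w *m rho (y *m h *m invmx y) = a *: w.
  move=> Dh Gy; have [a wa] : exists a, forall y, G y ->
      w *m rho y *m rho h = a *: (w *m rho y).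
    apply: (connected_eigenvalue_cst sG cG rG w0) => z Gz.
    have [c wc] := wD _ (derived_normal sG Dh Gz); exists c.
    by rewrite -mulmxA -rconj //; [rewrite mulmxA wc scalemxAl|exact: DG].
  exists a; first by have := wa _ G1; rewrite r1 mulmx1.
  have [c wc] := wD _ (derived_normal sG Dh Gy); rewrite wc.
  have := wa _ Gy; rewrite -mulmxA -rconj //; last exact: DG.
  rewrite mulmxA wc -scalemxAl => /eqP; rewrite -subr_eq0 -scalerBl scaler_eq0.
  by rewrite (negPf (regular_rep_inj sG rG Gy w0)) orbF subr_eq0 => /eqP ->.
pose S (v : 'rV[K]_m) := forall h c, D h -> w *m rho h = c *: w -> v *m rho h = c *: v.
have [X SX] : exists X : 'M[K]_m, forall v, S v <-> (v <= X)%MS.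
  apply: linear_setP; split=> [h c _ _|a u v Su Sv h c Dh wc].
    by rewrite mul0mx scaler0.
  rewrite mulmxDl -scalemxAl (Su h c) // (Sv h c) //.
  by rewrite scalerDr !scalerA mulrC.
have GX y : G y -> stablemx X (rho y).
  move=> Gy; apply/row_subP => i; rewrite row_mul; apply/SX => h c Dh wc.
  rewrite -mulmxA -rconj //; last exact: DG.
  have [a wa wa'] := wDG h y Dh Gy.
  have /SX Si : (row i X <= X)%MS by exact: row_sub.
  rewrite mulmxA (Si _ a) //; last exact: derived_normal.
  have -> : a = c; last by rewrite scalemxAl.
  apply/eqP; rewrite -subr_eq0; apply: contraT => ac.
  have : (a - c) *: w = 0 by rewrite scalerBl -wa -wc subrr.
  by move=> /eqP; rewrite scaler_eq0 (negPf ac) (negPf w0).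
have wX : (w <= X)%MS by apply/SX => h c.
have [|||W [_ W0 WX GW Wmin]] := @minimal_stable K m (rho @` G) 0 X.
- by move=> _ [y Gy <-]; exact: GX.
- exact: sub0mx.
- by apply: contra w0; rewrite !submx0 => /eqP X0; rewrite -submx0 -X0.
rewrite submx0 in W0.
suff Wsc x : G x -> exists a, forall v : 'rV_m, (v <= W)%MS -> v *m rho x = a *: v.
  have /rowV0Pn[v vW v0] := W0.
  by exists v => // g /Wsc[a Wa]; exists a; exact: Wa.
move=> Gx; have [|v [vW v0] [a va]] := @stable_eigenvector _ W (rho x) W0.
  by apply: GW; exists x.
have vD h : D h -> exists c, forall u : 'rV_m, (u <= W)%MS -> u *m rho h = c *: u.
  move=> Dh; have [c wc] := wD _ Dh; exists c => u uW.
  by have /SX Su := submx_trans uW WX; exact: Su.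
pose cm y := y *m x *m invmx y *m invmx x.
have Gcm y : G y -> D (cm y) by move=> Gy; exact: derived_commutator.
have rcm y : G y -> rho y *m rho x = rho (cm y) *m rho x *m rho y.
  move=> Gy; have Gc := DG _ (Gcm y Gy).
  have -> : rho (cm y) *m rho x *m rho y = rho (cm y *m x *m y).
    by rewrite (rM _ _ (GM _ _ Gc Gx) Gy) (rM _ _ Gc Gx).
  by rewrite -rM // /cm mulmxKV ?mulmxKV // SL_unit //; exact: GS.
have [a' va'] : exists a, forall y, G y -> v *m rho y *m rho x = a *: (v *m rho y).
  apply: (connected_eigenvalue_cst sG cG rG v0) => y Gy.
  have [c vc] := vD _ (Gcm y Gy); exists (c * a).
  rewrite -mulmxA rcm // mulmxA mulmxA vc // -scalemxAl va scalerA.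
  by rewrite scalemxAl.
have aa' : a = a'.
  have := va' _ G1; rewrite r1 mulmx1 va => /eqP; rewrite -subr_eq0 -scalerBl.
  by rewrite scaler_eq0 (negPf v0) orbF subr_eq0 => /eqP.
have a0 : a != 0.
  by have := regular_rep_inj sG rG Gx v0; rewrite va; apply: contraNneq => ->;
    rewrite scale0r.
(* The part of the eigenspace of [rho x] inside [W] is stable under [G] and contains [v], so
   minimality makes it all of [W]. *)
exists a => u uW; suff /eigenspaceP : (u <= eigenspace (rho x) a)%MS by [].
apply: (submx_trans uW); apply: submx_trans (capmxSr W _).
apply: Wmin; [|exact: sub0mx| |exact: capmxSl].
- move=> _ [y Gy <-]; apply/rV_subP => _ /submxP[z ->].
  rewrite mulmxA; have zW := submxMl z (W :&: eigenspace (rho x) a)%MS.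
  rewrite sub_capmx in zW *; have /andP[zW' /eigenspaceP za] := zW.
  rewrite sub_capmx; apply/andP; split.
    by apply: submx_trans (GW _ _); [exact: submxMr|exists y].
  apply/eigenspaceP; rewrite -mulmxA rcm // mulmxA mulmxA.
  have [c vc] := vD _ (Gcm y Gy).
  rewrite vc // -scalemxAl za scalerA -scalemxAl; congr (_ *: _).
  have := va' _ Gy; rewrite -aa' -mulmxA rcm // mulmxA mulmxA vc //.
  rewrite -scalemxAl va scalerA -scalemxAl => /eqP.
  rewrite -subr_eq0 -scalerBl scaler_eq0.
  by rewrite (negPf (regular_rep_inj sG rG Gy v0)) orbF subr_eq0 => /eqP.
- rewrite submx0; apply/rowV0Pn; exists v => //; rewrite sub_capmx vW.
  exact/eigenspaceP.
Qed.

End LieKolchin.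

Lemma solvable_triangular (K : numClosedFieldType) (n k m : nat) (G : set 'M[K]_n)
    (rho : 'M[K]_n -> 'M[K]_m) :
  subgroup G -> zconnected G ->
  iter k (@derived_subgroup K n) G = [set 1%:M] -> regular_rep G rho ->
  exists2 T : 'M[K]_m, T \in unitmx &
    forall g, G g -> is_trig_mx (T *m rho g *m invmx T).
Proof.
move=> sG cG Gk; elim: m rho => [|m IH] rho rG.
  exists 1%:M; first exact: unitmx1.
  by move=> g _; apply/is_trig_mxP => -[].
have [rr r1 rM] := rG.
have [w w0 wG] := solvable_eigenvector (ltn0Sn m) sG cG Gk rG.
(* [row_ebase w] completes the line of [w] to a basis: its first row is [w] up to the scalar [c].
   Since matrices act on rows from the right, a stable first line means a lower triangular shape. *)
pose S : 'M[K]_(1 + m) := row_ebase w; pose c := col_ebase w 0 0.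
have Su : S \in unitmx by exact: row_ebase_unit.
have wE : w = c *: row 0 S.
  rewrite -{1}(mulmx_ebase w) rank_rV w0 (mx11_scalar (col_ebase w)) mul_scalar_mx.
  rewrite -scalemxAl; congr (_ *: _); apply/rowP => j.
  rewrite !mxE (bigD1 0) //= !mxE /= mul1r big1 ?addr0 // => i i0.
  by rewrite !mxE eq_sym -(inj_eq val_inj) /= in i0 *; rewrite (negPf i0) mul0r.
have c0 : c != 0 by apply: contraNneq w0 => c0; rewrite wE c0 scale0r.
pose F g : 'M[K]_(1 + m) := S *m rho g *m invmx S.
have Fur g : G g -> ursubmx (F g) = 0.
  move=> /wG[a]; rewrite wE -scalemxAl scalerA mulrC -scalerA => /(scalerI c0) Sa.
  apply/matrixP => i j; rewrite ord1 ![in LHS]mxE.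
  have -> : lshift m (0 : 'I_1) = 0 by apply: val_inj.
  transitivity (row 0 (F g) 0 (rshift 1 j)); first by rewrite [RHS]mxE /F mxE.
  rewrite /F row_mul [row 0 (S *m _)]row_mul Sa -scalemxAl -row_mul mulmxV //.
  by rewrite !mxE mulr0.
have F1 : F 1%:M = 1%:M by rewrite /F r1 mulmx1 mulmxV.
have FM x y : G x -> G y -> F (x *m y) = F x *m F y.
  by move=> Gx Gy; rewrite /F rM // !mulmxA mulmxKV.
have [|T2 T2u T2G] := IH (fun g => drsubmx (F g)).
  split.
  - move=> i j; under eq_fun do rewrite !mxE.
    suff : regmx F by move=> rF; have := rF (rshift 1 i) (rshift 1 j);
      under eq_fun do rewrite mxE.
    by apply: regmxM; [apply: regmxM; [exact: regmx_cst|]|exact: regmx_cst].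
  - by rewrite F1 scalar_mx_block block_mxKdr.
  - move=> x y Gx Gy; rewrite FM // -{1}[F x]submxK -{1}[F y]submxK.
    by rewrite mulmx_block block_mxKdr Fur // mulmx0 add0r.
pose E (A : 'M[K]_m) : 'M[K]_(1 + m) := block_mx 1%:M 0 0 A.
have EM A B : E A *m E B = E (A *m B).
  by rewrite /E mulmx_block !mulmx0 !mul0mx !addr0 !add0r mulmx1.
have E1 : E 1%:M = 1%:M by rewrite /E -scalar_mx_block.
have EV : E (invmx T2) *m E T2 = 1%:M by rewrite EM mulVmx.
have [_ Eu] := mulmx1_unit EV.
exists (E T2 *m S) => [|g Gg]; first by rewrite unitmx_mul Eu Su.
have TS : E T2 *m S *m (invmx S *m E (invmx T2)) = 1%:M.
  by rewrite !mulmxA mulmxK // EM mulmxV.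
have TSu : E T2 *m S \in unitmx by rewrite unitmx_mul Eu Su.
have -> : invmx (E T2 *m S) = invmx S *m E (invmx T2).
  by apply: (can_inj (mulKmx TSu)); rewrite mulmxV.
have -> : E T2 *m S *m rho g *m (invmx S *m E (invmx T2)) =
    E T2 *m F g *m E (invmx T2) by rewrite /F !mulmxA.
rewrite /E -[F g]submxK Fur // !mulmx_block.
rewrite !mulmx0 !mul0mx !addr0 !add0r !mul0mx (@is_trig_block_mx _ 1 m 1 m) // eqxx
  mx11_is_trig.
by rewrite /= T2G.
Qed.

(** * Filtrations by block degree *)

(** By Cayley-Hamilton the inverse is a polynomial in [x]; the constant coefficient [c] to divide by
    is the determinant up to sign. *)
Lemma subalgebra_invmx (K : fieldType) n (S : set 'M[K]_n) x :
  S 1%:M -> (forall a y z, S y -> S z -> S (a *: y + z)) ->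
  (forall y z, S y -> S z -> S (y *m z)) ->
  x \in unitmx -> S x -> S (invmx x).
Proof.
case: n S x => [|n] S x S1 SL SM xu Sx;
  first by rewrite [invmx x]flatmx0 -[0](flatmx0 1%:M).
have S0 : S 0 by rewrite -[0](addNr 1%:M) -scaleN1r; exact: SL.
have Sp (p : {poly K}) : S (horner_mx x p).
  elim/poly_ind: p => [|p c Sp]; first by rewrite rmorph0.
  rewrite rmorphD rmorphM /= horner_mx_X horner_mx_C -scalemx1 addrC.
  by apply: SL => //; exact: SM.
have [q [c qc]] : exists q c, char_poly x = q * 'X + c%:P.
  elim/poly_ind: (char_poly x) => [|q c _]; last by exists q, c.
  by exists 0, 0; rewrite mul0r add0r.
have c0 : c != 0.
  have := char_poly_det x; rewrite qc coefD coefMX add0r coefC /= => ->.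
  by rewrite mulf_neq0 ?signr_eq0 // -unitfE -unitmxE.
have := Cayley_Hamilton x; rewrite qc rmorphD rmorphM /= horner_mx_X horner_mx_C.
move=> /eqP; rewrite addr_eq0 => /eqP qx.
suff -> : invmx x = (- c^-1) *: horner_mx x q + 0 by exact: SL.
apply: (can_inj (mulmxK xu)); rewrite mulVmx // addr0 -scalemxAl.
by rewrite [_ *m x]qx scalerN scaleNr opprK scale_scalar_mx mulVf.
Qed.

Section Conjugation.
Context (K : fieldType) (n : nat) (T : 'M[K]_n).
Hypothesis Tu : T \in unitmx.

Lemma mxconj1 : mxconj T 1%:M = 1%:M.
Proof. by rewrite /mxconj mulmx1 mulmxV. Qed.

Lemma mxconjM x y : mxconj T (x *m y) = mxconj T x *m mxconj T y.
Proof. by rewrite /mxconj !mulmxA mulmxKV. Qed.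

Lemma mxconjD x y : mxconj T (x + y) = mxconj T x + mxconj T y.
Proof. by rewrite /mxconj mulmxDr mulmxDl. Qed.

Lemma mxconjZ a x : mxconj T (a *: x) = a *: mxconj T x.
Proof. by rewrite /mxconj -scalemxAr -scalemxAl. Qed.

Lemma mxconjB x y : mxconj T (x - y) = mxconj T x - mxconj T y.
Proof. by rewrite /mxconj mulmxBr mulmxBl. Qed.

Lemma mxconj0 : mxconj T 0 = 0.
Proof. by rewrite /mxconj mulmx0 mul0mx. Qed.

Lemma mxconjK : cancel (mxconj T) (mxconj (invmx T)).
Proof. by move=> x; rewrite /mxconj invmxK !mulmxA mulVmx // mul1mx mulmxKV. Qed.

Lemma mxconjVK : cancel (mxconj (invmx T)) (mxconj T).
Proof. by move=> x; rewrite /mxconj invmxK !mulmxA mulmxV // mul1mx mulmxK. Qed.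

Lemma det_mxconj x : \det (mxconj T x) = \det x.
Proof.
by rewrite /mxconj !det_mulmx mulrAC -det_mulmx mulmxV // det1 mul1r.
Qed.

Lemma mxconj_unit x : (mxconj T x \in unitmx) = (x \in unitmx).
Proof. by rewrite !unitmxE det_mxconj. Qed.

Lemma mxconjV x : x \in unitmx -> mxconj T (invmx x) = invmx (mxconj T x).
Proof.
move=> xu; have cu : mxconj T x \in unitmx by rewrite mxconj_unit.
by apply: (can_inj (mulmxK cu)); rewrite -mxconjM !mulVmx // mxconj1.
Qed.

End Conjugation.

Lemma mxconj_mul (K : fieldType) n (S T x : 'M[K]_n) :
  S \in unitmx -> T \in unitmx -> mxconj S (mxconj T x) = mxconj (S *m T) x.
Proof.
move=> Su Tu; rewrite /mxconj; have STu : S *m T \in unitmx by rewrite unitmx_mul Su.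
suff -> : invmx (S *m T) = invmx T *m invmx S by rewrite !mulmxA.
by apply: (can_inj (mulKmx STu)); rewrite mulmxV // !mulmxA mulmxK // mulmxV.
Qed.

Lemma regmx_conj (K : fieldType) n m (T : 'M[K]_m) (F : 'M[K]_n -> 'M[K]_m) :
  regmx F -> regmx (fun x => mxconj T (F x)).
Proof.
by move=> rF; apply: regmxM; [apply: regmxM => //|]; exact: regmx_cst.
Qed.

Section Filtration.
Context (K : numClosedFieldType) (n : nat) (T : 'M[K]_n) (b : 'I_n -> nat).
Hypothesis Tu : T \in unitmx.

(* In the basis given by the rows of [T], graded by [b]: the matrices lowering
   the degree by at least [k]. For [k = 0] this is a parabolic subalgebra and
   for [k = 1] its nilradical. *)
Definition filt k : set 'M[K]_n :=
  [set x | forall i j, (b i < b j + k)%N -> mxconj T x i j = 0].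

Lemma filt_lin k a x y : filt k x -> filt k y -> filt k (a *: x + y).
Proof.
move=> xk yk i j ij.
by rewrite mxconjD mxconjZ 2!mxE xk // yk // mulr0 addr0.
Qed.

Lemma filt0 k : filt k 0.
Proof. by move=> i j _; rewrite mxconj0 mxE. Qed.

Lemma filtD k x y : filt k x -> filt k y -> filt k (x + y).
Proof. by move=> xk yk; rewrite -[x]scale1r; exact: filt_lin. Qed.

Lemma filtZ k a x : filt k x -> filt k (a *: x).
Proof. by move=> xk; rewrite -[_ *: _]addr0; apply: filt_lin => //; exact: filt0. Qed.

Lemma filtN k x : filt k x -> filt k (- x).
Proof. by move=> xk; rewrite -scaleN1r; exact: filtZ. Qed.

Lemma filtB k x y : filt k x -> filt k y -> filt k (x - y).
Proof. by move=> xk yk; apply: filtD => //; exact: filtN. Qed.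

Lemma filt1 : filt 0 1%:M.
Proof.
move=> i j; rewrite mxconj1 // addn0 => ij.
by rewrite mxE; case: eqP ij => // ->; rewrite ltnn.
Qed.

Lemma filtM k l x y : filt k x -> filt l y -> filt (k + l) (x *m y).
Proof.
move=> xk yl i j ij; rewrite mxconjM // mxE big1 // => h _.
have [ih|hi] := ltnP (b i) (b h + k); first by rewrite xk // mul0r.
by rewrite yl ?mulr0 //; lia.
Qed.

Lemma filt_sub k l : (k <= l)%N -> filt l `<=` filt k.
Proof. by move=> kl x xl i j ij; apply: xl; rewrite (leq_trans ij) // leq_add2l. Qed.

Lemma filtMl k x y : filt 0 x -> filt k y -> filt k (x *m y).
Proof. by move=> x0 yk; have := filtM x0 yk. Qed.

Lemma filtMr k x y : filt k x -> filt 0 y -> filt k (x *m y).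
Proof. by move=> xk y0; have := filtM xk y0; rewrite addn0. Qed.

Lemma filtV x : x \in unitmx -> filt 0 x -> filt 0 (invmx x).
Proof.
move=> xu x0; apply: (subalgebra_invmx (S := filt 0)) => //; first exact: filt1.
  by move=> a y z; exact: filt_lin.
by move=> y z; exact: filtMl.
Qed.

Lemma filt_nil k x : (forall i, (b i < k)%N) -> filt k x -> x = 0.
Proof.
move=> bk xk; rewrite -[x](mxconjK Tu); suff -> : mxconj T x = 0 by rewrite mxconj0.
by apply/matrixP => i j; rewrite xk ?mxE // (leq_trans (bk i)) // leq_addl.
Qed.

(** Subtracting 1 lets one formula cover the parabolic group ([k = 0]), its unipotent radical
    ([k = 1]) and the deeper terms used for solvability. *)
Definition filt_group k : set 'M[K]_n := [set g | SL g /\ filt k (g - 1%:M)].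

Lemma filt_group0 : filt_group 0 = [set g | SL g /\ filt 0 g].
Proof.
apply/seteqP; split=> g [dg g0]; split=> //.
  by rewrite -[g](subrK 1%:M); apply: filtD => //; exact: filt1.
by apply: filtB => //; exact: filt1.
Qed.

Lemma filt_group_sub0 k g : filt_group k g -> filt 0 g.
Proof.
move=> [_ /(filt_sub (leq0n k)) g0].
by rewrite -[g](subrK 1%:M); apply: filtD => //; exact: filt1.
Qed.

Lemma filt_subgroup k : subgroup (filt_group k).
Proof.
have SL1 : SL (1%:M : 'M[K]_n) by rewrite /SL /= det1.
split.
- by move=> g [].
- by split=> //; rewrite subrr; exact: filt0.
- move=> g h Hg Hh; have [dg gk] := Hg; have [dh hk] := Hh.
  split; first by rewrite /SL /= det_mulmx dg dh mulr1.
  have -> : g *m h - 1%:M = (g - 1%:M) *m h + (h - 1%:M).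
    by rewrite mulmxBl mul1mx addrA subrK.
  by apply: filtD => //; apply: filtMr => //; exact: filt_group_sub0 Hh.
- move=> g Hg; have [dg gk] := Hg; have gu := SL_unit dg.
  split; first by rewrite /SL /= det_inv dg invr1.
  have -> : invmx g - 1%:M = - ((g - 1%:M) *m invmx g).
    by rewrite mulmxBl mulmxV // mul1mx opprB.
  by apply/filtN/filtMr => //; apply: filtV => //; exact: filt_group_sub0 Hg.
Qed.

Lemma zclosed_filt_group k : zclosed (filt_group k).
Proof.
apply: (@zclosedI _ _ (@SL K n) [set g | filt k (g - 1%:M)]); first exact: zclosed_SL.
suff -> : [set g | filt k (g - 1%:M)] = [set g | forall ij : {ij | (b ij.1 < b ij.2 +
  k)%N},
    mxconj T (g - 1%:M) (sval ij).1 (sval ij).2 = 0].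
  apply: zclosed_bigcap => ij.
  apply: zclosed_zero; apply: (regmx_conj T (F := fun g => g - 1%:M)).
  by apply: regmxD; [exact: regmx_id|exact: regmx_cst].
apply/seteqP; split=> g gk; first by case=> -[i j] /= ij; exact: gk.
by move=> i j ij; exact: (gk (exist _ (i, j) ij)).
Qed.

End Filtration.

Section EvalMx.
Context (K : numFieldType).

Lemma evalmxM m n p (A : 'M[{poly K}]_(m, n)) (B : 'M_(n, p)) t :
  evalmx (A *m B) t = evalmx A t *m evalmx B t.
Proof. exact: (map_mxM (horner_eval t)). Qed.

Lemma evalmxD m n (A B : 'M[{poly K}]_(m, n)) t :
  evalmx (A + B) t = evalmx A t + evalmx B t.
Proof. exact: (map_mxD (horner_eval t)). Qed.

Lemma evalmxZ m n (p : {poly K}) (A : 'M[{poly K}]_(m, n)) t :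
  evalmx (p *: A) t = p.[t] *: evalmx A t.
Proof. exact: (map_mxZ (horner_eval t)). Qed.

Lemma evalmxC m n (A : 'M[K]_(m, n)) t : evalmx (map_mx polyC A) t = A.
Proof. by apply/matrixP => i j; rewrite !mxE hornerC. Qed.

Lemma det_evalmx n (A : 'M[{poly K}]_n) t : \det (evalmx A t) = (\det A).[t].
Proof. exact: (det_map_mx (horner_eval t)). Qed.

End EvalMx.

Section FiltrationConnected.
Context (K : numClosedFieldType) (n : nat) (T : 'M[K]_n).
Hypothesis Tu : T \in unitmx.

Lemma det_filt1 (b : 'I_n -> nat) k g :
  {homo b : i j / (i <= j)%N} -> (0 < k)%N -> filt T b k (g - 1%:M) -> \det g = 1.
Proof.
move=> bS k0 gk; rewrite -(det_mxconj Tu).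
have gE i j : (b i < b j + k)%N -> mxconj T g i j = (i == j)%:R.
  by move=> /gk; rewrite mxconjB mxconj1 // !mxE => /eqP; rewrite subr_eq0 => /eqP.
rewrite det_trig.
  by rewrite big1 // => i _; rewrite gE ?eqxx // -[X in (X < _)%N]addn0 ltn_add2l.
apply/is_trig_mxP => i j ij; rewrite gE.
  by rewrite -val_eqE /= (ltn_eqF ij).
by rewrite (leq_ltn_trans (bS i j (ltnW ij))) // -[X in (X < _)%N]addn0 ltn_add2l.
Qed.

Lemma filt_group_connected (b : 'I_n -> nat) k :
  {homo b : i j / (i <= j)%N} -> (0 < k)%N -> zconnected (filt_group T b k).
Proof.
move=> bS k0; have [_ H1 _ _] := filt_subgroup b Tu k.
apply: zconnected_curves => // g [dg gk].
have N1 t : (1 : {poly K}).[t] = 1 by rewrite hornerC.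
exists (map_mx polyC 1%:M + 'X *: map_mx polyC (g - 1%:M)), 1, 0, 1.
have NE t : evalmx (map_mx polyC 1%:M + 'X *: map_mx polyC (g - 1%:M)) t =
    1%:M + t *: (g - 1%:M) by rewrite evalmxD evalmxZ !evalmxC hornerX.
split; rewrite ?N1 ?oner_eq0 ?invr1 ?scale1r ?NE ?scale0r ?addr0 //; last first.
  by rewrite scale1r addrC subrK.
move=> r _; rewrite N1 invr1 scale1r NE.
have Fr : filt T b k (1%:M + r *: (g - 1%:M) - 1%:M).
  by rewrite addrAC subrr add0r; exact: filtZ.
by split=> //; exact: det_filt1 Fr.
Qed.

Lemma derived_filt_group (b : 'I_n -> nat) k :
  derived_subgroup (filt_group T b k.+1) `<=` filt_group T b k.+2.
Proof.
apply: (smallest_sub (C := @subgroup K n)); first exact: filt_subgroup.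
move=> _ [x Hx [y Hy <-]].
have [_ _ HM HV] := filt_subgroup b Tu k.+1.
split; first by have [] : filt_group T b k.+1 (mxconj x y *m invmx y);
  [apply: (HM) => //; [apply: (HM) => //; [exact: HM|exact: HV]|exact: HV]|].
have [dx xk] := Hx; have [dy yk] := Hy.
have xu := SL_unit dx; have yu := SL_unit dy.
have x0 := filt_group_sub0 Tu Hx; have y0 := filt_group_sub0 Tu Hy.
(* The commutator minus 1 is the bracket of [x - 1] and [y - 1] times an invertible factor of degree
   0, and the degrees of [x - 1] and [y - 1] add up in the bracket. *)
have -> : mxconj x y *m invmx y - 1%:M =
    ((x - 1%:M) *m (y - 1%:M) - (y - 1%:M) *m (x - 1%:M)) *m (invmx x *m invmx y).
  have -> : (x - 1%:M) *m (y - 1%:M) - (y - 1%:M) *m (x - 1%:M) = x *m y - y *m x.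
    rewrite !mulmxBl !mulmxBr !mulmx1 !mul1mx.
    by apply/matrixP => i j; rewrite !mxE; ring.
  by rewrite mulmxBl /mxconj !mulmxA mulmxK // mulmxV.
apply: filtMr => //; last by apply: filtMl => //; exact: filtV.
have kk : (k.+2 <= k.+1 + k.+1)%N by lia.
by apply: filtB; apply: (filt_sub kk); exact: filtM.
Qed.

Lemma derived_triangular :
  derived_subgroup (filt_group T (@nat_of_ord n) 0) `<=` filt_group T (@nat_of_ord n) 1.
Proof.
set b := @nat_of_ord n.
apply: (smallest_sub (C := @subgroup K n)); first exact: filt_subgroup.
move=> _ [x Hx [y Hy <-]].
have [_ _ HM HV] := filt_subgroup b Tu 0.
split; first by have [] : filt_group T b 0 (mxconj x y *m invmx y);
  [apply: (HM) => //; [apply: (HM) => //; [exact: HM|exact: HV]|exact: HV]|].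
have [dx xk] := Hx; have [dy yk] := Hy.
have xu := SL_unit dx; have yu := SL_unit dy.
have x0 := filt_group_sub0 Tu Hx; have y0 := filt_group_sub0 Tu Hy.
have -> : mxconj x y *m invmx y - 1%:M = (x *m y - y *m x) *m (invmx x *m invmx y).
  by rewrite mulmxBl /mxconj !mulmxA mulmxK // mulmxV.
apply: filtMr => //; last by apply: filtMl => //; exact: filtV.
(* Above the diagonal triangularity suffices. On the diagonal the entries of triangular matrices
   simply multiply, so [x *m y] and [y *m x] cancel there. *)
move=> i j; rewrite addn1 ltnS leq_eqVlt => /orP[/eqP/val_inj <-|ij]; last first.
  by apply: (filtB (filtMl Tu x0 y0) (filtMl Tu y0 x0)); rewrite addn0.
have dM (u v : 'M[K]_n) : filt T b 0 u -> filt T b 0 v ->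
    mxconj T (u *m v) i i = mxconj T u i i * mxconj T v i i.
  move=> u0 v0; rewrite mxconjM // mxE (bigD1 i) //= big1 ?addr0 // => h hi.
  have [ih|ih] := ltnP i h; first by rewrite u0 ?mul0r // addn0.
  by rewrite v0 ?mulr0 // addn0 ltn_neqAle ih andbT.
have sE (u v : 'M[K]_n) : (u - v) i i = u i i - v i i by rewrite !mxE.
by rewrite mxconjB sE !dM // mulrC subrr.
Qed.

Lemma derived_mono (G H : set 'M[K]_n) :
  subgroup H -> G `<=` H -> derived_subgroup G `<=` derived_subgroup H.
Proof.
move=> sH GH; apply: (smallest_sub (C := @subgroup K n)).
  exact: derived_subgroupP.
by move=> _ [x /GH Hx [y /GH Hy <-]]; exact: derived_commutator.
Qed.

Lemma triangular_solvable : solvable_group (filt_group T (@nat_of_ord n) 0).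
Proof.
set b := @nat_of_ord n.
have H k : subgroup (iter k (@derived_subgroup K n) (filt_group T b 0)) /\
    iter k (@derived_subgroup K n) (filt_group T b 0) `<=` filt_group T b k.
  elim: k => [|k [sD Dk]]; first by split=> //; exact: filt_subgroup.
  split; first exact: derived_subgroupP.
  apply: subset_trans (derived_mono (filt_subgroup b Tu k) Dk) _.
  by case: k {sD Dk} => [|k]; [exact: derived_triangular|exact: derived_filt_group].
exists n; have [[_ D1 _ _] Dn] := H n.
apply/seteqP; split=> [g /Dn [_ gn]|_ -> //].
have /eqP := filt_nil Tu (k := n) (fun i => ltn_ord i) gn.
by rewrite subr_eq0 => /eqP.
Qed.

End FiltrationConnected.

(** * Borel subgroups as triangular groups *)

Section Borel.
Context (K : numClosedFieldType) (n : nat).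
Hypothesis n0 : (0 < n)%N.

Lemma triangular_connected (T : 'M[K]_n) : T \in unitmx ->
  zconnected (filt_group T (@nat_of_ord n) 0).
Proof.
move=> Tu; have [_ H1 _ _] := filt_subgroup (@nat_of_ord n) Tu 0.
apply: zconnected_curves => // g Hg; have [dg _] := Hg.
have g0 := filt_group_sub0 Tu Hg.
pose i0 := Ordinal n0; pose g' := mxconj T g.
pose A : 'M[{poly K}]_n := map_mx polyC 1%:M + 'X *: map_mx polyC (g' - 1%:M).
have AE t : evalmx A t = 1%:M + t *: (g' - 1%:M).
  by rewrite evalmxD evalmxZ !evalmxC hornerX.
pose d := \det A; have dE t : d.[t] = \det (evalmx A t) by rewrite det_evalmx.
(* Divided by [d], this is the diagonal matrix with [1/d] at [i0] and 1 elsewhere: it restores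
   determinant 1 along the segment [A] from 1 to [g'] and preserves triangularity. *)
pose D : 'M[{poly K}]_n := diag_mx (\row_j (if j == i0 then 1 else d)).
have DE t : d.[t] != 0 -> (d.[t])^-1 *: evalmx D t =
    diag_mx (\row_j (if j == i0 then (d.[t])^-1 else 1)).
  move=> dt; apply/matrixP => i j; rewrite !mxE hornerMn.
  by case: ifP => _; rewrite ?hornerC mulrnAr ?mulr1 ?mulVf.
pose N := map_mx polyC (invmx T) *m (D *m A) *m map_mx polyC T.
have NE t : d.[t] != 0 -> (d.[t])^-1 *: evalmx N t = mxconj (invmx T)
    (diag_mx (\row_j (if j == i0 then (d.[t])^-1 else 1)) *m evalmx A t).
  move=> dt; rewrite /mxconj invmxK -DE // !evalmxM !evalmxC.
  by rewrite -!scalemxAl -scalemxAr -scalemxAl.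
have D1 : diag_mx (\row_j (if j == i0 then 1^-1 else 1)) = 1%:M :> 'M[K]_n.
  by apply/matrixP => i j; rewrite !mxE; case: ifP; rewrite ?invr1.
have A0 : evalmx A 0 = 1%:M by rewrite AE scale0r addr0.
have A1 : evalmx A 1 = g' by rewrite AE scale1r addrC subrK.
have d0 : d.[0] = 1 by rewrite dE A0 det1.
have d1 : d.[1] = 1 by rewrite dE A1 det_mxconj.
have Tu' : invmx T \in unitmx by rewrite unitmx_inv.
exists N, d, 0, 1; split; last 4 first.
- by rewrite d0 oner_eq0.
- by rewrite d1 oner_eq0.
- by rewrite NE d0 ?oner_eq0 // D1 A0 mul1mx mxconj1.
- by rewrite NE d1 ?oner_eq0 // D1 A1 mul1mx mxconjK.
move=> r dr; rewrite filt_group0 // NE //; split.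
  rewrite /SL /= det_mxconj // det_mulmx -dE det_diag (bigD1 i0) //= big1.
    by rewrite mxE eqxx mulr1 mulVf.
  by move=> i ii0; rewrite mxE (negPf ii0).
move=> i j; rewrite mxconjVK // addn0 => ij.
rewrite mul_diag_mx mxE AE.
suff -> : (1%:M + r *: (g' - 1%:M)) i j = 0 by rewrite mulr0.
have ij0 : g' i j = 0 by apply: g0; rewrite addn0.
clearbody g'; rewrite !mxE ij0.
by rewrite -(inj_eq val_inj) /= (ltn_eqF ij) subrr mulr0 addr0.
Qed.

(** Lie-Kolchin puts [B] inside a triangular group, which is itself closed, connected and solvable;
    maximality of [B] gives equality. *)
Lemma borel_triangular (B : set 'M[K]_n) : borel B ->
  exists2 T : 'M[K]_n, T \in unitmx & B = filt_group T (@nat_of_ord n) 0.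
Proof.
move=> [[sB cB] coB [k Bk] Bmax].
have idr : regular_rep B (@id 'M[K]_n) by split=> //; exact: regmx_id.
have [T Tu TB] := solvable_triangular sB coB Bk idr.
exists T => //; apply/esym/Bmax.
- by split; [exact: filt_subgroup|exact: zclosed_filt_group].
- exact: triangular_connected.
- exact: triangular_solvable.
- have [BS _ _ _] := sB; move=> g Bg; rewrite filt_group0 //; split; first exact: BS.
  by move=> i j; rewrite addn0; exact/is_trig_mxP/TB.
Qed.

End Borel.

(** * Subgroups containing the triangular matrices *)

Section Span.
Context (K : numClosedFieldType) (n : nat).

Definition mx_linear (S : set 'M[K]_n) : Prop :=
  S 0 /\ forall a x y, S x -> S y -> S (a *: x + y).

Lemma mx_linearZ (S : set 'M[K]_n) a x : mx_linear S -> S x -> S (a *: x).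
Proof. by move=> [S0 SL] Sx; rewrite -[_ *: _]addr0; exact: SL. Qed.

Lemma mx_linearD (S : set 'M[K]_n) x y : mx_linear S -> S x -> S y -> S (x + y).
Proof. by move=> [S0 SL] Sx Sy; rewrite -[x]scale1r; exact: SL. Qed.

Lemma mx_linearB (S : set 'M[K]_n) x y : mx_linear S -> S x -> S y -> S (x - y).
Proof.
by move=> lS Sx Sy; apply: mx_linearD => //; rewrite -scaleN1r; exact: mx_linearZ.
Qed.

Lemma SL_scale (x : 'M[K]_n) : (0 < n)%N -> x \in unitmx ->
  exists2 c, c != 0 & SL (c *: x).
Proof.
move=> n0 xu; have x0 : \det x != 0 by rewrite -unitfE -unitmxE.
pose r := n.-root (\det x); have rn : r ^+ n = \det x by exact: rootCK.
have r0 : r != 0.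
  by apply: contraNneq x0 => r0; rewrite -rn r0 expr0n -leqn0 leqNgt n0.
exists r^-1; first by rewrite invr_eq0.
by rewrite /SL /= detZ exprVn rn mulVf.
Qed.

Lemma unit_shift (x : 'M[K]_n) : exists c, x - c%:M \in unitmx.
Proof.
have [c] : exists c, (char_poly x).[c] != 0.
  by apply: poly_nonroot; rewrite monic_neq0 // char_poly_monic.
move=> cx; exists c; rewrite unitmxE unitfE; apply: contra cx => dx.
rewrite -[_ == 0]/(root _ c) -eigenvalue_root_char; apply/eigenvalueP.
have /negP : ~~ row_free (x - c%:M) by rewrite row_free_unit unitmxE unitfE dx.
rewrite -kermx_eq0 => /negP/rowV0Pn[v vk v0]; exists v => //.
by move/sub_kermxP: vk; rewrite mulmxBr mul_mx_scalar => /eqP; rewrite subr_eq0 => /eqP.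
Qed.

(** A generic scalar shift makes [x] invertible and a scaling then brings it into [SL], so a
    subspace containing 1 is spanned by its elements in [SL]. This is the passage from groups to
    matrix algebras. *)
Lemma linear_SL_sub (V S : set 'M[K]_n) : (0 < n)%N ->
  mx_linear V -> mx_linear S -> V 1%:M -> (forall g, V g -> SL g -> S g) -> V `<=` S.
Proof.
move=> n0 lV lS V1 VS x Vx; have [c cu] := unit_shift x.
have [d d0 dx] := SL_scale n0 cu.
have S1 : S 1%:M by apply: VS => //; rewrite /SL /= det1.
have Vy : V (d *: (x - c%:M)).
  have Vc : V c%:M by rewrite -scalemx1; exact: mx_linearZ.
  by apply: mx_linearZ => //; exact: mx_linearB.
rewrite -[x](subrK c%:M); apply: mx_linearD => //; last by rewrite -scalemx1;
  exact: mx_linearZ.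
by rewrite -[_ - _](scalerK d0); apply: mx_linearZ => //; exact: (VS _ Vy).
Qed.

Definition mx_span (P : set 'M[K]_n) : set 'M[K]_n :=
  [set x | forall S, mx_linear S -> P `<=` S -> S x].

Lemma mx_span_linear P : mx_linear (mx_span P).
Proof.
split=> [S [S0 _] _ //|a x y Px Py S lS PS]; have [_ SL] := lS.
by apply: SL; [exact: Px|exact: Py].
Qed.

Lemma sub_mx_span (P : set 'M[K]_n) : P `<=` mx_span P.
Proof. by move=> x Px S _; exact. Qed.

Lemma mx_span_mul (P : set 'M[K]_n) x y :
  (forall u v, P u -> P v -> P (u *m v)) ->
  mx_span P x -> mx_span P y -> mx_span P (x *m y).
Proof.
move=> PM Px Py; have [sP0 sPL] := mx_span_linear P.
apply: (Px [set u | mx_span P (u *m y)]).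
  split=> [|a u v] /=; first by rewrite mul0mx.
  by move=> Pu Pv; rewrite mulmxDl -scalemxAl; exact: sPL.
move=> u Pu /=; apply: (Py [set v | mx_span P (u *m v)]).
  split=> [|a v w] /=; first by rewrite mulmx0.
  by move=> Pv Pw; rewrite mulmxDr -scalemxAr; exact: sPL.
by move=> v Pv /=; apply: sub_mx_span; exact: PM.
Qed.

End Span.

Lemma mul_delta_mx_mid (R : comPzRingType) m n p q (x : 'M[R]_(m, n))
    (i : 'I_p) k l (j : 'I_q) :
  delta_mx i k *m x *m delta_mx l j = x k l *: delta_mx i j.
Proof.
apply/matrixP => a c; rewrite !mxE (bigD1 l) //= big1 => [|h hl]; last first.
  by rewrite !mxE (negPf hl) /= mulr0.
rewrite !mxE (bigD1 k) //= big1 => [|h hk]; last first.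
  by rewrite !mxE (negPf hk) andbF mul0r.
by rewrite !mxE !eqxx andbT /= !addr0 mulrAC -natrM mulnb mulrC.
Qed.

Section AboveTriangular.
Context (K : numClosedFieldType) (n : nat) (P : set 'M[K]_n).
Hypothesis n0 : (0 < n)%N.
Hypothesis sP : subgroup P.
Hypothesis trigP : forall g, SL g -> is_trig_mx g -> P g.

(* [mx_span P] is a bimodule over the diagonal matrices, so it is spanned by
   matrix units; [b] is the resulting block function. *)
Let J i j := `[< mx_span P (delta_mx i j) >].
Let b i := #|finset (J i)|.

Let spanM x y : mx_span P x -> mx_span P y -> mx_span P (x *m y).
Proof. by have [_ _ PM _] := sP; exact: mx_span_mul. Qed.

Let trig_span x : is_trig_mx x -> mx_span P x.
Proof.
apply: (linear_SL_sub n0 (V := [set x | is_trig_mx x])).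
- split=> [|a y z /is_trig_mxP yt /is_trig_mxP zt]; first exact: mx0_is_trig.
  by apply/is_trig_mxP => i j ij; rewrite !mxE yt // zt // mulr0 addr0.
- exact: mx_span_linear.
- exact: scalar_mx_is_trig.
- by move=> g gt Sg; apply: sub_mx_span; exact: trigP.
Qed.

Let J_le (i j : 'I_n) : (j <= i)%N -> J i j.
Proof.
move=> ji; apply/asboolP; apply: trig_span; apply/is_trig_mxP => k l kl; rewrite mxE.
by case: eqP => //= ki; case: eqP => //= lj; subst; rewrite ltnNge ji in kl.
Qed.

Let J_trans i j k : J i j -> J j k -> J i k.
Proof.
move=> /asboolP ij /asboolP jk; apply/asboolP.
by rewrite -(mul_delta_mx j); exact: spanM.
Qed.

(** [J] is a preorder in which any two indices are comparable, so the number of indices related to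
    [i] determines the position of [i]. *)
Let JE i j : J i j = (b j <= b i)%N.
Proof.
have Jb k l : J k l -> (b l <= b k)%N.
  by move=> kl; apply/subset_leq_card/fintype.subsetP => m; rewrite !finset.in_set;
    exact: (J_trans kl).
apply/idP/idP => [|ji]; first exact: Jb.
have [/J_le //|/ltnW/J_le ij] := leqP j i.
have : finset (J i) = finset (J j).
  apply/eqP; rewrite eqEcard ji andbT; apply/fintype.subsetP => m; rewrite !finset.in_set.
  exact: (J_trans ij).
by move=> /setP/(_ j); rewrite !finset.in_set => ->; exact: J_le.
Qed.

Let bS : {homo b : i j / (i <= j)%N}.
Proof. by move=> i j ij; rewrite -JE; exact: J_le. Qed.


Let P_entry x i j : P x -> (b i < b j)%N -> x i j = 0.
Proof.
move=> Px ij; apply/eqP; apply: contraTT ij => xij; rewrite -leqNgt -JE.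
apply/asboolP; have <- : (x i j)^-1 *: (delta_mx i i *m x *m delta_mx j j) = delta_mx i j.
  by rewrite mul_delta_mx_mid scalerA mulVf // scale1r.
have dP k : mx_span P (delta_mx k k).
  apply: trig_span; apply/is_trig_mxP => l m lm; rewrite mxE.
  by case: eqP lm => //= ->; case: eqP => //= ->; rewrite ltnn.
apply: (mx_linearZ _ (mx_span_linear P)).
by apply: spanM => //; apply: spanM => //; exact: sub_mx_span.
Qed.

Section Block.
Variable p : 'I_n.

Let lower (y : 'rV[K]_n) := forall j, (b p < b j)%N -> y 0 j = 0.
Let lower' (y : 'rV[K]_n) := forall j, (b p <= b j)%N -> y 0 j = 0.
Let upper (psi : 'cV[K]_n) := forall i, (b i < b p)%N -> psi i 0 = 0.

(* The [P]-stable subspace [W] contains all [y] in [lower'] and the first basis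
   vector of the block of [p]; as the block is irreducible, it contains all of
   [lower]. *)
Let W (y : 'rV[K]_n) := lower y /\
  forall psi, upper psi -> y *m psi = 0 -> P (1%:M + psi *m y).

Let transvection_mul (y z : 'rV[K]_n) (psi : 'cV[K]_n) : y *m psi = 0 ->
  (1%:M + psi *m y) *m (1%:M + psi *m z) = 1%:M + psi *m (y + z).
Proof.
move=> yp; rewrite mulmxDl !mulmxDr !mulmx1 !mul1mx.
by rewrite mulmxA -(mulmxA psi) yp mulmx0 mul0mx addr0 -addrA [_ + psi *m y]addrC.
Qed.

Let unitriangular_transvection (y : 'rV[K]_n) (psi : 'cV[K]_n) :
  (forall i j : 'I_n, (i <= j)%N -> psi i 0 * y 0 j = 0) -> P (1%:M + psi *m y).
Proof.
move=> py; have pE i j : (psi *m y) i j = psi i 0 * y 0 j by rewrite mxE big_ord1.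
have trig : is_trig_mx (1%:M + psi *m y).
  apply/is_trig_mxP => i j ij; rewrite mxE pE py ?(ltnW ij) // addr0 mxE.
  by rewrite -val_eqE /= (ltn_eqF ij).
apply: trigP => //; rewrite /SL /= det_trig // big1 // => i _.
by rewrite mxE pE py // addr0 mxE eqxx.
Qed.

Let W_lower' y f : W y -> lower' f -> W (y + f).
Proof.
have [_ _ PM _] := sP; move=> [yl yP] fl; split=> [j pj|psi pu yfp].
  by rewrite mxE yl // fl ?addr0 // ltnW.
have fp : f *m psi = 0.
  apply/matrixP => i j; rewrite !ord1 !mxE big1 // => k _.
  by have [kp|pk] := ltnP (b k) (b p); [rewrite pu // mulr0|rewrite fl // mul0r].
have yp : y *m psi = 0 by move: yfp; rewrite mulmxDl fp addr0.
rewrite -transvection_mul //; apply: PM; first exact: yP.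
apply: unitriangular_transvection => i j ij.
have [ip|pi] := ltnP (b i) (b p); first by rewrite pu // mul0r.
by rewrite fl ?mulr0 // (leq_trans pi) // bS.
Qed.

Let WZ c y : W y -> W (c *: y).
Proof.
have [_ P1 _ _] := sP; move=> [yl yP]; split=> [j pj|psi pu cyp].
  by rewrite mxE yl ?mulr0.
have [->|c0] := eqVneq c 0; first by rewrite scale0r mulmx0 addr0.
rewrite -scalemxAr; have -> : c *: (psi *m y) = (c *: psi) *m y by rewrite scalemxAl.
apply: yP => [i ip|]; first by rewrite mxE pu ?mulr0.
by rewrite -scalemxAr scalemxAl.
Qed.

Let W_stable g y : P g -> W y -> W (y *m g).
Proof.
have [PS _ PM PV] := sP; move=> Pg [yl yP]; have gu := SL_unit (PS _ Pg).
split=> [j pj|psi pu ygp].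
  rewrite mxE big1 // => k _; have [pk|kp] := ltnP (b p) (b k).
    by rewrite yl ?mul0r.
  by rewrite (P_entry Pg) ?mulr0 // (leq_ltn_trans kp).
have -> : 1%:M + psi *m (y *m g) = invmx g *m (1%:M + (g *m psi) *m y) *m g.
  by rewrite mulmxDr mulmxDl mulmx1 mulVmx // !mulmxA mulVmx // mul1mx.
apply: (PM) => //; apply: (PM); first exact: PV.
apply: yP; last by rewrite mulmxA.
move=> i ip; rewrite mxE big1 // => k _; have [kp|pk] := ltnP (b k) (b p).
  by rewrite pu ?mulr0.
by rewrite (P_entry Pg) ?mul0r // (leq_trans ip).
Qed.

(** If [y] and [w] are independent on the block of [p], some [phi] has [y *m phi = 0] and
    [w *m phi = 1], so [y + w] is the image of [w] under the transvection [1 + phi y] of [P].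
    Otherwise [w] is a multiple of [y] up to an element of [lower']. *)
Let WD y w : W y -> W w -> W (y + w).
Proof.
have [_ _ PM _] := sP.
move=> Wy Ww; have [yl yP] := Wy; have [wl wP] := Ww.
have [[k kp yk]|yl'] := pselect (exists2 k, b k = b p & y 0 k != 0); last first.
  rewrite addrC; apply: W_lower' => // j; rewrite leq_eqVlt => /orP[/eqP pj|];
    last exact: yl.
  by apply/eqP; apply: contrapT => /negP yj; apply: yl'; exists j.
have [[i ip yw]|yw] := pselect (exists2 i, b i = b p & w 0 i * y 0 k - y 0 i * w 0 k !=
  0).
  pose d := w 0 i * y 0 k - y 0 i * w 0 k.
  pose phi : 'cV[K]_n := d^-1 *: (y 0 k *: delta_mx i 0 - y 0 i *: delta_mx k 0).
  have vE (v : 'rV_n) : v *m phi = (d^-1 * (v 0 i * y 0 k - y 0 i * v 0 k))%:M.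
    rewrite /phi -scalemxAr mulmxBr -!scalemxAr -!colE.
    by apply/matrixP => a c; rewrite !ord1 !mxE eqxx mulr1n [y 0 k * _]mulrC.
  have pu : upper phi.
    move=> j jp; rewrite !mxE !andbT; have [ji|ji] := eqVneq j i.
      by rewrite ji ip ltnn in jp.
    have [jk|jk] := eqVneq j k; first by rewrite jk kp ltnn in jp.
    by rewrite !mulr0 subrr mulr0.
  have -> : y + w = w *m (1%:M + phi *m y).
    by rewrite mulmxDr mulmx1 mulmxA vE -/d mulVf // mul1mx addrC.
  by apply: W_stable => //; apply: yP => //; rewrite vE subrr mulr0 raddf0.
pose c := w 0 k / y 0 k.
have -> : y + w = (1 + c) *: y + (w - c *: y).
  by rewrite scalerDl scale1r addrACA subrr addr0.
apply: W_lower'; first exact: WZ.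
move=> j; rewrite leq_eqVlt => /orP[/eqP pj|pj];
  last by rewrite !mxE yl // wl // mulr0 subr0.
apply: contrapT => /eqP wj; apply: yw; exists j => //.
apply: contra wj; rewrite !mxE /c => /eqP wj; rewrite mulrAC subr_eq0.
by rewrite -(inj_eq (mulIf yk)) divfK // -subr_eq0 [w 0 k * _]mulrC wj.
Qed.

Let W_full y : lower y -> W y.
Proof.
have [_ P1 _ _] := sP; move=> yl.
have W0 : W 0.
  by split=> [j _|psi _ _]; rewrite ?mxE // mulmx0 addr0.
have [j0 pj0 j0min] : exists2 j0 : 'I_n, b j0 = b p & forall j : 'I_n, b j = b p -> (j0
  <= j)%N.
  have [j0 /eqP] := @arg_minnP _ p (fun j => b j == b p) val (eqxx _).
  by move=> jp jm; exists j0 => // j /eqP /jm.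
(* As [j0] is the first index of its block, [upper psi] together with [psi j0 0 = 0] leaves only
   rows strictly below [j0], so the transvection is unitriangular. *)
have We0 : W (delta_mx 0 j0).
  split=> [j pj|psi pu]; first by rewrite mxE eqxx; case: eqP pj => // ->;
    rewrite pj0 ltnn.
  rewrite -rowE => /matrixP/(_ 0 0); rewrite !mxE => p0.
  apply: unitriangular_transvection => i j ij; rewrite mxE eqxx /=.
  have [jj|jj] := eqVneq j j0; last by rewrite mulr0.
  subst j; have [->|ij0] := eqVneq i j0; first by rewrite p0 mul0r.
  rewrite pu ?mul0r // -pj0 ltn_neqAle bS // andbT.
  apply: contra ij0; rewrite pj0 => /eqP/j0min ji.
  by apply/eqP/val_inj/eqP; rewrite eqn_leq ij ji.
(* [delta_mx j0 j] lies in the span of [P], and that span preserves [W] because [W] is a [P]-stable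
   subspace. *)
have We j : (b j <= b p)%N -> W (delta_mx 0 j).
  move=> jp; have /asboolP : J j0 j by rewrite JE pj0.
  move=> /(_ [set x | W (delta_mx 0 j0 *m x)])/=; rewrite mul_delta_mx; apply.
    split=> [|a u v /= Wu Wv]; first by rewrite /= mulmx0.
    by rewrite /= mulmxDr -scalemxAr; apply: WD => //; exact: WZ.
  by move=> g Pg /=; exact: W_stable.
rewrite (row_sum_delta y); elim/big_ind: _ => // j _.
have [pj|jp] := ltnP (b p) (b j); first by rewrite yl // scale0r.
by apply: WZ; exact: We.
Qed.

Lemma block_transvection (y : 'rV[K]_n) (psi : 'cV[K]_n) :
  (forall j, (b p < b j)%N -> y 0 j = 0) -> (forall i, (b i < b p)%N -> psi i 0 = 0) ->
  y *m psi = 0 -> P (1%:M + psi *m y).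
Proof. by move=> /W_full[_ yP]; exact: yP. Qed.

End Block.

(* Right multiplication by transvections makes [g] triangular, row by row. *)
Let P_full g : SL g -> (forall i j, (b i < b j)%N -> g i j = 0) -> P g.
Proof.
have [PS _ PM PV] := sP.
suff Q m h : (m <= n)%N -> SL h -> (forall i j, (b i < b j)%N -> h i j = 0) ->
    (forall i j : 'I_n, (i < n - m)%N -> (i < j)%N -> h i j = 0) -> P h.
  by move=> Sg gb; apply: (Q n) => // i j; rewrite subnn.
elim: m h => [|m IH] h mn Sh hb ht.
  apply: trigP => //; apply/is_trig_mxP => i j; apply: ht.
  by rewrite subn0 ltn_ord.
have pn : (n - m.+1 < n)%N by lia.
pose p := Ordinal pn; pose v := row p h.
have [[q pq vq]|vt] := pselect (exists2 q : 'I_n, (p < q)%N & v 0 q != 0); last first.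
  apply: IH => // [|i j]; first exact: ltnW.
  have -> : (n - m = (n - m.+1).+1)%N by lia.
  rewrite ltnS leq_eqVlt => /orP[/eqP ip|im] ij; last exact: ht.
  apply/eqP; apply: contrapT => /negP hij; apply: vt; exists j; first by rewrite /= -ip.
  by rewrite mxE (_ : p = i) //; apply: val_inj.
have pqb : b q = b p.
  apply/eqP; rewrite eqn_leq [X in _ && X]bS ?(ltnW pq) // andbT leqNgt.
  by apply: contra vq => /hb pq0; rewrite mxE pq0.
(* [psi] is chosen so that [v *m psi = 1] and [y *m psi = 0]; the transvection then sends the row
   [v] to [v + y], the basis vector [delta_mx 0 p]. *)
pose y : 'rV[K]_n := delta_mx 0 p - v.
pose psi : 'cV[K]_n := delta_mx p 0 + ((1 - v 0 p) / v 0 q) *: delta_mx q 0.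
have uE (u : 'rV_n) : u *m psi = (u 0 p + (1 - v 0 p) / v 0 q * u 0 q)%:M.
  rewrite mulmxDr -scalemxAr -!colE.
  by apply/matrixP => a c; rewrite !ord1 !mxE eqxx mulr1n.
have vp : v *m psi = 1%:M by rewrite uE divfK // addrC subrK.
have yp : y *m psi = 0.
  have dp : (delta_mx 0 p : 'rV[K]_n) 0 p = 1 by rewrite mxE !eqxx.
  have dq : (delta_mx 0 p : 'rV[K]_n) 0 q = 0.
    by rewrite mxE eqxx -val_eqE /= (gtn_eqF pq).
  by rewrite mulmxBl vp uE dp dq mulr0 addr0 subrr.
have Pt : P (1%:M + psi *m y).
  apply: (@block_transvection p) => // [j pj|i ip].
    have jp : (j == p) = false by apply: contraTF pj => /eqP ->; rewrite ltnn.
    by rewrite !mxE hb // jp andbF subr0.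
  rewrite !mxE !andbT; have [ii|_] := eqVneq i p; first by rewrite ii ltnn in ip.
  have [ii|_] := eqVneq i q; first by rewrite ii pqb ltnn in ip.
  by rewrite mulr0 addr0.
have St := PS _ Pt; have tu := SL_unit St.
suff Pht : P (h *m (1%:M + psi *m y)).
  by rewrite -[h](mulmxK tu); apply: PM => //; exact: PV.
have rowE' i : row i (h *m (1%:M + psi *m y)) = row i h + row i h *m psi *m y.
  by rewrite row_mul mulmxDr mulmx1 mulmxA.
apply: IH; first exact: ltnW.
- by rewrite /SL /= det_mulmx Sh St mulr1.
- move=> i j ij; rewrite mxE big1 // => k _.
  have [ik|ki] := ltnP (b i) (b k); first by rewrite hb ?mul0r.
  by rewrite (P_entry Pt) ?mulr0 // (leq_ltn_trans ki).
have -> : (n - m = (n - m.+1).+1)%N by lia.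
move=> i j; rewrite ltnS leq_eqVlt => /orP[/eqP ip|im] ij.
  have -> : i = p by apply: val_inj.
  have /rowP/(_ j) := rowE' p; rewrite mxE => ->.
  rewrite -/v vp mul1mx addrC subrK mxE eqxx /=.
  by case: eqP ij => // ->; rewrite /= -ip ltnn.
(* The rows already treated vanish at [p] and [q], where [psi] is supported, so they do not
   change. *)
have /rowP/(_ j) := rowE' i; rewrite mxE => ->.
have hp : row i h 0 p = 0 by rewrite mxE ht.
have hq : row i h 0 q = 0 by rewrite mxE ht // (ltn_trans im).
by rewrite uE hp hq mulr0 addr0 raddf0 mul0mx addr0 mxE ht.
Qed.

Lemma above_triangular : exists2 b : 'I_n -> nat,
  {homo b : i j / (i <= j)%N} &
  P = [set g | SL g /\ forall i j, (b i < b j)%N -> g i j = 0].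
Proof.
exists b => //; have [PS _ _ _] := sP.
by apply/seteqP; split=> [g Pg|g [Sg gb]]; [split; [exact: PS|move=> i j;
  exact: P_entry]|exact: P_full].
Qed.

End AboveTriangular.

(** * Unipotent radicals *)

Section TracePowers.
Context (K : numClosedFieldType).

Lemma mxtrace_idempotent n (E : 'M[K]_n) : E *m E = E -> \tr E = (\rank E)%:R.
Proof.
move=> EE; rewrite -{1}(mulmx_base E) mxtrace_mulC.
suff -> : row_base E *m col_base E = 1%:M by rewrite mxtrace1.
apply: (row_free_inj (row_base_free E)); rewrite /= mul1mx.
have /row_fullP[D DC] : row_full (col_base E) by exact: col_base_full.
have DE : D *m E = row_base E.
  transitivity (D *m (col_base E *m row_base E)); first by rewrite mulmx_base.
  by rewrite mulmxA DC mul1mx.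
by rewrite -mulmxA mulmx_base -{1}DE -mulmxA EE.
Qed.

Lemma eigenvector_horner n (y : 'M[K]_n.+1) (w : 'rV_n.+1) a (p : {poly K}) :
  w *m y = a *: w -> w *m horner_mx y p = p.[a] *: w.
Proof.
move=> wy; elim/poly_ind: p => [|p c IH]; first by rewrite rmorph0 mulmx0 horner0 scale0r.
rewrite rmorphD rmorphM /= horner_mx_X horner_mx_C mulmxDr -mulmxE mulmxA IH.
by rewrite -scalemxAl wy scalerA mul_mx_scalar hornerMXaddC scalerDl.
Qed.

(* If [1] were an eigenvalue of [y], the projector on the generalized eigenspaces
   of the nonzero eigenvalues would be a polynomial in [y] without constant
   term, hence of trace zero, whereas its trace is its rank. *)
Lemma mxtrace_powers0 n (y : 'M[K]_n) :
  (forall k, \tr (y ^+ k.+1) = 0) -> 1%:M - y \in unitmx.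
Proof.
case: n y => [|n] y ty; first by rewrite [1%:M - y]flatmx0 -[0](flatmx0 1%:M) unitmx1.
apply: contraT => y1.
have [w wy w0] : exists2 w : 'rV_n.+1, w *m y = 1 *: w & w != 0.
  have : ~~ row_free (1%:M - y) by rewrite row_free_unit.
  rewrite -kermx_eq0 => /rowV0Pn[v vk v0]; exists v => //.
  move/sub_kermxP: vk; rewrite mulmxBr mulmx1 => /eqP.
  by rewrite subr_eq0 scale1r => /eqP.
have [m [q q0 chiE]] := multiplicity_XsubC (char_poly y) 0.
rewrite monic_neq0 ?char_poly_monic //= subr0 in q0 chiE.
(* The exponent [m.+1] instead of [m] keeps [phi] free of a constant term even when 0 is not an
   eigenvalue. *)
have cq : coprimep q ('X ^+ m.+1).
  have := coprimep_XsubC q 0; rewrite polyC0 subr0 q0 => cX.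
  by rewrite coprimep_expr.
have /Bezout_eq1_coprimepP[[u v] /= uv] := cq.
pose phi := v * 'X^(m.+1); pose E := horner_mx y phi.
have phi1 : phi.[1] = 1.
  have : root (char_poly y) 1 by rewrite -eigenvalue_root_char; apply/eigenvalueP;
    exists w.
  rewrite chiE rootM rootE /root !hornerXn expr1n oner_eq0 orbF => /eqP q1.
  have := congr1 (fun p => p.[1]) uv.
  by rewrite hornerD hornerM q1 mulr0 add0r hornerC.
have EE : E *m E = E.
  apply/eqP; rewrite mulmxE -rmorphM -subr_eq0 -rmorphB /=.
  have -> : phi * phi - phi = - (v * u * 'X) * char_poly y.
    have p1 : phi - 1 = - (u * q) by rewrite -uv opprD addrCA subrr addr0.
    rewrite -[X in _ - X]mulr1 -mulrBr p1 chiE /phi exprS; ring.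
  by rewrite rmorphM /= Cayley_Hamilton mulr0.
have tr_hor (p : {poly K}) k : \tr (y ^+ k.+1 *m horner_mx y p) = 0.
  elim/poly_ind: p k => [|p c IH] k; first by rewrite rmorph0 mulmx0 mxtrace0.
  rewrite rmorphD rmorphM /= horner_mx_X horner_mx_C mulmxDr mxtraceD.
  rewrite mul_mx_scalar mxtraceZ ty mulr0 addr0 -[_ * y]/(_ *m y).
  rewrite mulmxA mxtrace_mulC mulmxA -[y *m y ^+ k.+1]/(y * y ^+ k.+1) -exprS.
  exact: IH.
have tE : \tr E = 0.
  rewrite /E /phi mulrC rmorphM /= rmorphXn /= horner_mx_X; exact: tr_hor.
have /eqP : (\rank E)%:R = 0 :> K by rewrite -mxtrace_idempotent.
rewrite pnatr_eq0 mxrank_eq0 => /eqP E0.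
have := eigenvector_horner phi wy; rewrite phi1 scale1r -/E E0 mulmx0 => /eqP.
by rewrite eq_sym (negPf w0).
Qed.

End TracePowers.

(** * Kolchin's theorem on unipotent groups *)

Section Kolchin.
Context (K : numClosedFieldType) (n : nat).

Lemma unipotent_trace (u : 'M[K]_n) : unipotent_mx u -> \tr u = n%:R.
Proof.
move=> [k uk]; rewrite -[u](subrK 1%:M) mxtraceD mxtrace1.
move: uk; set x := u - 1%:M => xk; suff -> : \tr x = 0 by rewrite add0r.
case: n x xk => [|m] x xk; first by rewrite /mxtrace big_ord0.
have [s sE] := closed_field_poly_normal (char_poly x).
rewrite (monicP (char_poly_monic x)) scale1r in sE.
have s0 a : a \in s -> a = 0.
  move=> sa; have : root (char_poly x) a by rewrite sE root_prod_XsubC.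
  rewrite -eigenvalue_root_char => /eigenvalueP[v vx v0].
  have : v *m horner_mx x 'X^k = a ^+ k *: v.
    by rewrite (eigenvector_horner _ vx) hornerXn.
  rewrite rmorphXn /= horner_mx_X xk mulmx0 => /esym/eqP.
  by rewrite scaler_eq0 (negPf v0) orbF expf_eq0 => /andP[_ /eqP].
have := char_poly_trace x (ltn0Sn m); rewrite sE.
have -> : \prod_(z <- s) ('X - z%:P) = 'X^(size s) :> {poly K}.
  elim: s s0 {sE} => [|a s IH] s0; first by rewrite big_nil expr0.
  rewrite big_cons IH => [|b bs]; last by apply: s0; rewrite inE bs orbT.
  by rewrite (s0 a) ?inE ?eqxx // subr0 exprS.
have sz : size s = m.+1.
  by have := congr1 (fun p : {poly K} => size p) sE;
    rewrite size_char_poly size_prod_XsubC => -[].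
rewrite coefXn sz eqn_leq /= ltnn => /esym/eqP.
by rewrite andbF oppr_eq0 => /eqP.
Qed.

Variable U : set 'M[K]_n.
Hypothesis U1 : U 1%:M.
Hypothesis UM : forall u v, U u -> U v -> U (u *m v).
Hypothesis Uu : U `<=` @unipotent_mx K n.

(** All elements of [U] have the same trace [n], in particular [u *m v] and [v]; the rest is
    linearity. *)
Lemma unipotent_span_trace u s : U u -> mx_span U s -> \tr ((u - 1%:M) *m s) = 0.
Proof.
move=> Hu Us; apply: (Us [set s | \tr ((u - 1%:M) *m s) = 0]).
  split=> [|a x y /= tx ty]; rewrite /= ?mulmx0 ?mxtrace0 //.
  by rewrite mulmxDr mxtraceD -scalemxAr mxtraceZ tx ty mulr0 addr0.
move=> v Hv /=; rewrite mulmxBl mul1mx raddfB /=.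
by rewrite !unipotent_trace ?subrr //; apply: Uu => //; exact: UM.
Qed.

(* In a minimal stable [W], if [w (u - 1)] is not in [X] then it generates [W]
   modulo [X], so [w = w y] modulo [X] with [y = (u - 1) s]; but all powers of
   [y] have trace zero. *)
Lemma unipotent_fixed_layer (X Y : 'M[K]_n) :
  (forall u, U u -> stablemx X u) -> (forall u, U u -> stablemx Y u) ->
  (X <= Y)%MS -> ~~ (Y <= X)%MS ->
  exists w : 'rV[K]_n, [/\ (w <= Y)%MS, ~~ (w <= X)%MS &
    forall u, U u -> (w *m (u - 1%:M) <= X)%MS].
Proof.
move=> UX UY XY YX.
have [W [XW WX WY UW Wmin]] := minimal_stable UY XY YX.
have [w wW wX] : exists2 w : 'rV_n, (w <= W)%MS & ~~ (w <= X)%MS.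
  apply: contrapT => H; move/negP: WX; apply; apply/rV_subP => w wW.
  by apply: contrapT => wX; apply: H; exists w => //; apply/negP.
exists w; split=> //; first exact: submx_trans WY.
move=> u Hu; apply: contraT => wuX.
have [sU0 sUL] := mx_span_linear U.
have spanU (Z : 'M_n) s : (forall u, U u -> stablemx Z u) -> mx_span U s -> stablemx Z s.
  move=> UZ Us; apply: (Us [set s | stablemx Z s]) => //.
  split=> [|a x y /= Zx Zy]; first by rewrite /= mulmx0 sub0mx.
  by rewrite /= mulmxDr -scalemxAr addmx_sub // scalemx_sub.
pose S (v : 'rV_n) := exists s (x : 'rV_n), [/\ mx_span U s, (x <= X)%MS &
  v = w *m (u - 1%:M) *m s + x].
have [W' SW'] : exists W' : 'M[K]_n, forall v, S v <-> (v <= W')%MS.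
  apply: linear_setP; split=> [|a v v' [s [x [Us xX ->]]] [s' [x' [Us' xX' ->]]]].
    by exists 0, 0; rewrite mulmx0 addr0 sub0mx; split.
  exists (a *: s + s'), (a *: x + x'); split; first exact: sUL.
    by rewrite addmx_sub // scalemx_sub.
  by rewrite [_ *m (a *: s + s')]mulmxDr -scalemxAr scalerDr addrACA.
have us : mx_span U (u - 1%:M).
  apply: (mx_linearB (mx_span_linear U)); exact: sub_mx_span.
have : (W <= W')%MS.
  apply: Wmin.
  - move=> g Hg; apply/rV_subP => _ /submxP[z ->]; rewrite mulmxA.
    have /SW'[s [x [Us xX ->]]] := submxMl z W'.
    apply/SW'; exists (s *m g), (x *m g); split.
    + by apply: (mx_span_mul UM) => //; exact: sub_mx_span.
    + by rewrite (submx_trans _ (UX g Hg)) // submxMr.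
    + by rewrite mulmxDl mulmxA.
  - apply/rV_subP => x xX; apply/SW'; exists 0, x; split=> //.
    by rewrite mulmx0 add0r.
  - apply: contra wuX => W'X; apply: submx_trans W'X; apply/SW'.
    exists 1%:M, 0; split; [exact: sub_mx_span|exact: sub0mx|].
    by rewrite mulmx1 addr0.
  - apply/rV_subP => _ /SW'[s [x [Us xX ->]]].
    apply: addmx_sub; last exact: submx_trans XW.
    rewrite -mulmxA (submx_trans (submxMr _ wW)) //; apply: spanU => //.
    exact: (mx_span_mul UM).
move=> /(submx_trans wW)/SW'[s [x [Us xX wE]]].
pose y := (u - 1%:M) *m s.
have yU : mx_span U y by exact: (mx_span_mul UM).
have tr_y k : \tr (y ^+ k.+1) = 0.
  have yk : mx_span U (y ^+ k).
    elim: k => [|k IH]; first by rewrite expr0; exact: sub_mx_span.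
    by rewrite exprS; exact: (mx_span_mul UM).
  rewrite exprS -[y * _]/(y *m _) /y -mulmxA; apply: unipotent_span_trace => //.
  exact: (mx_span_mul UM).
have yu := mxtrace_powers0 tr_y.
have wx : w *m (1%:M - y) = x.
  by rewrite mulmxBr mulmx1 /y mulmxA {1}wE addrC addKr.
have Xy : stablemx X (invmx (1%:M - y)).
  apply: (subalgebra_invmx (S := [set a | stablemx X a])) => //=.
  - by rewrite mulmx1.
  - by move=> a y' z Xy Xz; rewrite mulmxDr -scalemxAr addmx_sub // scalemx_sub.
  - by move=> a c; exact: stablemxM.
  - by apply: spanU => //; apply: (mx_linearB (mx_span_linear U)) => //;
    exact: sub_mx_span.
by rewrite -(mulmxK yu w) wx (submx_trans (submxMr _ xX)) // in wX.
Qed.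

End Kolchin.

(** * Parabolic subgroups and their radicals in block form *)

Section ParabolicStructure.
Context (K : numClosedFieldType) (n : nat).
Hypothesis n0 : (0 < n)%N.

Lemma parabolic_filt (P : set 'M[K]_n) : parabolic P ->
  exists T (b : 'I_n -> nat), [/\ T \in unitmx, {homo b : i j / (i <= j)%N} &
    P = filt_group T b 0].
Proof.
move=> [[sP _] [B /(borel_triangular n0)[T Tu ->] BP]]; have [PS P1 PM PV] := sP.
have Tu' : invmx T \in unitmx by rewrite unitmx_inv.
pose P' := [set g | P (mxconj (invmx T) g)].
have sP' : subgroup P'.
  split; rewrite /P' /=.
  - by move=> g /PS; rewrite /SL /= det_mxconj.
  - by rewrite mxconj1.
  - by move=> x y Px Py; rewrite mxconjM //; exact: PM.
  - move=> x Px; rewrite mxconjV //; first exact: PV.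
    by rewrite -(mxconj_unit Tu'); apply: SL_unit; exact: PS.
have tP' g : SL g -> is_trig_mx g -> P' g.
  move=> Sg /is_trig_mxP gt; apply: BP; rewrite filt_group0 //; split.
    by rewrite /SL /= det_mxconj.
  by move=> i j; rewrite addn0 mxconjVK // => /gt.
have [b bS P'E] := above_triangular n0 sP' tP'.
exists T, b; split=> //; rewrite filt_group0 //; apply/seteqP; split=> g.
  move=> Pg; have : P' (mxconj T g) by rewrite /P' /= mxconjK.
  rewrite P'E => -[_ gb]; split; first exact: PS.
  by move=> i j; rewrite addn0; exact: gb.
move=> [Sg gb]; rewrite -[g](mxconjK Tu); suff : P' (mxconj T g) by [].
rewrite P'E; split; first by rewrite /SL /= det_mxconj.
by move=> i j ij; apply: gb; rewrite addn0.
Qed.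

Lemma submx_diag (S : pred 'I_n) (v : 'rV[K]_n) :
  (v <= diag_mx (\row_j (S j)%:R))%MS <-> forall j, ~~ S j -> v 0 j = 0.
Proof.
split=> [/submxP[w ->] j Sj|vS].
  by rewrite mul_mx_diag !mxE (negPf Sj) mulr0.
apply/submxP; exists v; apply/rowP => j; rewrite mul_mx_diag !mxE.
by have [_|/vS ->] := boolP (S j); rewrite ?mulr1 ?mul0r.
Qed.

(** Kolchin's theorem gives one vector [w] of the layer [Y] over [X] fixed by [U] modulo [X]. By
    normality the vectors fixed in this sense are stable under the whole block algebra [A], and a
    matrix unit of [A] carries [w] to the basis vector of [p]. *)
Lemma normal_unipotent_block (b : 'I_n -> nat) (U : set 'M[K]_n) :
  U 1%:M -> (forall u v, U u -> U v -> U (u *m v)) -> U `<=` @unipotent_mx K n ->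
  (forall u, U u -> forall i j, (b i < b j)%N -> u i j = 0) ->
  (forall g u, SL g -> (forall i j, (b i < b j)%N -> g i j = 0) -> U u ->
    U (g *m u *m invmx g)) ->
  forall u, U u -> forall i j, (b i <= b j)%N -> (u - 1%:M) i j = 0.
Proof.
move=> U1 UM Uu Ub Un u Hu p j pj.
pose X : 'M[K]_n := diag_mx (\row_j (b j < b p)%:R).
pose Y : 'M[K]_n := diag_mx (\row_j (b j <= b p)%:R).
have XE (v : 'rV_n) : (v <= X)%MS <-> forall j, (b p <= b j)%N -> v 0 j = 0.
  have [vX vX'] := submx_diag (fun j => b j < b p)%N v.
  split=> [/vX{}vX k pk|{}vX]; first by apply: vX; rewrite -leqNgt.
  by apply: vX' => k pk; apply: vX; rewrite leqNgt.
have YE (v : 'rV_n) : (v <= Y)%MS <-> forall j, (b p < b j)%N -> v 0 j = 0.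
  have [vY vY'] := submx_diag (fun j => b j <= b p)%N v.
  split=> [/vY{}vY k pk|{}vY]; first by apply: vY; rewrite -ltnNge.
  by apply: vY' => k pk; apply: vY; rewrite ltnNge.
pose A := [set a : 'M[K]_n | forall i j, (b i < b j)%N -> a i j = 0].
have AX a (v : 'rV_n) : A a -> (v <= X)%MS -> (v *m a <= X)%MS.
  move=> Aa /XE vX; apply/XE => k pk; rewrite mxE big1 // => h _.
  have [ph|hp] := leqP (b p) (b h); first by rewrite vX ?mul0r.
  by rewrite Aa ?mulr0 // (leq_trans hp).
have AY a (v : 'rV_n) : A a -> (v <= Y)%MS -> (v *m a <= Y)%MS.
  move=> Aa /YE vY; apply/YE => k pk; rewrite mxE big1 // => h _.
  have [ph|hp] := ltnP (b p) (b h); first by rewrite vY ?mul0r.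
  by rewrite Aa ?mulr0 // (leq_ltn_trans hp).
have [|||| w [wY wX wU]] := @unipotent_fixed_layer _ _ U U1 UM Uu X Y.
- by move=> g /Ub Ag; apply/rV_subP => _ /submxP[z ->]; rewrite mulmxA;
  apply: AX => //; exact: submxMl.
- by move=> g /Ub Ag; apply/rV_subP => _ /submxP[z ->]; rewrite mulmxA;
  apply: AY => //; exact: submxMl.
- by apply/rV_subP => v /XE vX; apply/YE => k pk; apply: vX; exact: ltnW.
- apply/negP => /rV_subP/(_ (delta_mx 0 p)).
  have dY : ((delta_mx 0 p : 'rV[K]_n) <= Y)%MS.
    by apply/YE => k pk; rewrite mxE eqxx; case: eqP pk => // ->; rewrite ltnn.
  by move=> /(_ dY)/XE/(_ p (leqnn _))/eqP; rewrite mxE !eqxx oner_eq0.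
pose F (y : 'rV_n) := forall u, U u -> (y *m (u - 1%:M) <= X)%MS.
have FSL g y : A g -> SL g -> F y -> F (y *m g).
  move=> Ag Sg Fy v Hv; have gu := SL_unit Sg.
  have -> : y *m g *m (v - 1%:M) = y *m (g *m v *m invmx g - 1%:M) *m g.
    rewrite -!(mulmxA y); congr (y *m _).
    by rewrite mulmxBl mulmxKV // mulmxBr mulmx1 mul1mx.
  by apply: AX => //; apply: Fy; exact: Un.
have FA a : A a -> forall y, F y -> F (y *m a).
  move: a; apply: (linear_SL_sub n0 (V := A) (S := [set a | forall y, F y -> F (y *m
    a)])).
  - split=> [i k _|a x y Ax Ay i k ik]; rewrite !mxE //.
    by rewrite Ax // Ay // mulr0 addr0.
  - split=> [y _ v _|a x y /= Fx Fy z Fz v Hv]; first by rewrite mulmx0 mul0mx sub0mx.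
    rewrite [_ *m (a *: x + y)]mulmxDr -scalemxAr mulmxDl -scalemxAl addmx_sub
      ?scalemx_sub //.
      exact: Fx.
    exact: Fy.
  - by move=> i k ik; rewrite mxE; case: eqP ik => // ->; rewrite ltnn.
  - by move=> g Ag Sg y; exact: FSL.
have [k pk wk] : exists2 k, (b p <= b k)%N & w 0 k != 0.
  apply: contrapT => H; move/negP: wX; apply; apply/XE => k pk.
  by apply/eqP; apply: contrapT => /negP wk; apply: H; exists k.
have Fp : F (w *m ((w 0 k)^-1 *: delta_mx k p)).
  apply: FA => // i l il; rewrite !mxE.
  by case: eqP => [ik|_]; case: eqP => [lp|_]; rewrite ?mulr0 //; subst;
    rewrite ltnNge pk in il.
have wp : w *m ((w 0 k)^-1 *: delta_mx k p) = delta_mx 0 p.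
  rewrite -scalemxAr; have -> : w *m delta_mx k p = w 0 k *: delta_mx 0 p.
    apply/rowP => l; rewrite !mxE (bigD1 k) //= big1 => [|h hk].
      by rewrite !mxE eqxx addr0.
    by rewrite !mxE (negPf hk) mulr0.
  by rewrite scalerA mulVf // scale1r.
have := Fp u Hu; rewrite wp -rowE => /XE/(_ j pj).
by rewrite mxE.
Qed.

Lemma filt_unipotent (T : 'M[K]_n) (b : 'I_n -> nat) u :
  T \in unitmx -> filt T b 1 (u - 1%:M) -> unipotent_mx u.
Proof.
move=> Tu u1; pose k := (\max_i b i).+1; exists k.
apply: (filt_nil (b := b) Tu (k := k)) => [i|]; first by rewrite ltnS leq_bigmax.
elim: k => [|k IH]; first by rewrite expr0; exact: filt1.
by rewrite exprS -addn1 addnC; exact: filtM.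
Qed.

(** One inclusion is maximality, as [filt_group T b 1] is itself normal, connected and unipotent;
    the other is the triviality of [U] on the diagonal blocks. *)
Lemma unipotent_radical_filt (T : 'M[K]_n) (b : 'I_n -> nat) (U : set 'M[K]_n) :
  T \in unitmx -> {homo b : i j / (i <= j)%N} ->
  unipotent_radical (filt_group T b 0) U -> U = filt_group T b 1.
Proof.
move=> Tu bS [[[[US U1 UM UV] _] cU UP Un Uu] Umax].
have Tu' : invmx T \in unitmx by rewrite unitmx_inv.
apply/seteqP; split=> [u Hu|]; last first.
  apply: Umax; split.
  - by split; [exact: filt_subgroup|exact: zclosed_filt_group].
  - exact: filt_group_connected.
  - move=> u [Su u1]; split=> //; exact: (filt_sub (leq0n 1)).
  - move=> g u Hg [Su u1]; have [Sg _] := Hg; have g0 := filt_group_sub0 Tu Hg.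
    have gu := SL_unit Sg.
    split; first by rewrite /SL /= det_mxconj.
    have -> : mxconj g u - 1%:M = g *m (u - 1%:M) *m invmx g.
      by rewrite mulmxBr mulmxBl mulmx1 mulmxV.
    by apply: filtMr => //; [exact: filtMl|exact: filtV].
  - by move=> u [_ /(filt_unipotent Tu)].
split; first exact: US.
pose U' := [set u | U (mxconj (invmx T) u)].
have UU' v : U v -> U' (mxconj T v) by move=> Hv; rewrite /U' /= mxconjK.
move=> i j; rewrite addn1 ltnS mxconjB mxconj1 // => ij.
apply: (@normal_unipotent_block b U') ij; last exact: UU'.
- by rewrite /U' /= mxconj1.
- by move=> v w Hv Hw; rewrite /U' /= mxconjM //; exact: UM.
- move=> v /Uu[k vk]; exists k; rewrite -[v](mxconjVK Tu) -(mxconj1 Tu) -mxconjB.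
  have mX m (x : 'M[K]_n) : mxconj T x ^+ m = mxconj T (x ^+ m).
    elim: m => [|m IH]; first by rewrite !expr0; exact/esym/mxconj1.
    by rewrite !exprS IH; exact/esym/mxconjM.
  by rewrite mX vk mxconj0.
- move=> v /UP Pv p q pq; have := filt_group_sub0 Tu Pv.
  by move=> /(_ p q); rewrite addn0 mxconjVK //; exact.
- move=> g v Sg gb Hv; rewrite /U' /= !mxconjM // mxconjV //; last exact: SL_unit.
  apply: (Un _ _ _ Hv); rewrite filt_group0 //; split; first by rewrite /SL /= det_mxconj.
  by move=> p q; rewrite addn0 mxconjVK //; exact: gb.
Qed.

End ParabolicStructure.

(** * Lie algebras *)

Section LieAlgebra.
Context (K : numClosedFieldType) (n : nat).

Lemma mpoly_closed (R : comNzRingType) (k : nat) (Q : {mpoly R[k]} -> Prop) :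
  (forall c, Q c%:MP) -> (forall i, Q 'X_i) ->
  (forall p q, Q p -> Q q -> Q (p + q)) ->
  (forall p q, Q p -> Q q -> Q (p * q)) -> forall p, Q p.
Proof.
move=> QC QX QD QM p; rewrite (mpolyE p).
have Q0 : Q 0 by rewrite -mpolyC0; exact: QC.
have Q1 : Q 1 by rewrite -mpolyC1; exact: QC.
elim: (msupp p) => [|m s IH]; first by rewrite big_nil.
rewrite big_cons; apply: (QD _ _ _ IH); rewrite -mul_mpolyC; apply: (QM _ _ (QC _)).
rewrite mpolyXE_id.
elim: (index_enum _) => [|i t IHt]; first by rewrite big_nil.
rewrite big_cons; apply: (QM _ _ _ IHt).
elim: (m i) => [|e IHe]; first by rewrite expr0.
by rewrite exprS; apply: (QM _ _ (QX i)).
Qed.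

(** Reduces the sum in the definition of [lie_algebra] to a derivative in one variable, along the
    line through [x] in the direction [X]. *)
Lemma line_derivative (p : {mpoly K[n * n]}) (x X : 'M[K]_n) :
  exists f : {poly K}, (forall t, f.[t] = mxeval p (x + t *: X)) /\
    f^`().[0] = \sum_k mxeval p^`M(k) x * mxvec X 0 k.
Proof.
move: p; apply: mpoly_closed.
- move=> c; exists c%:P; split=> [t|]; first by rewrite hornerC /mxeval mevalC.
  by rewrite derivC hornerC big1 // => k _; rewrite mderivC /mxeval meval0 mul0r.
- move=> i; exists ((mxvec x 0 i)%:P + (mxvec X 0 i) *: 'X); split=> [t|].
    rewrite hornerD hornerC hornerZ hornerX /mxeval mevalXU.
    by case/mxvec_indexP: i => i j; rewrite !mxvecE !mxE mulrC.
  rewrite derivD derivC add0r derivZ derivX hornerZ hornerC mulr1.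
  rewrite (bigD1 i) //= big1 => [|k ki].
    rewrite mderivX mnm1E eqxx scale1r addr0.
    have -> : (U_(i) - U_(i))%MM = 0%MM by apply/mnmP => j; rewrite mnmBE subnn mnm0E.
    by rewrite mpolyX0 /mxeval meval1 mul1r.
  by rewrite mderivX mnm1E eq_sym (negPf ki) scale0r /mxeval meval0 mul0r.
- move=> p q [f [fE f']] [g [gE g']]; exists (f + g); split=> [t|].
    by rewrite hornerD fE gE /mxeval mevalD.
  rewrite derivD hornerD f' g' -big_split /=; apply: eq_bigr => k _.
  by rewrite mderivD /mxeval mevalD mulrDl.
- move=> p q [f [fE f']] [g [gE g']]; exists (f * g); split=> [t|].
    by rewrite hornerM fE gE /mxeval mevalM.
  rewrite derivM hornerD !hornerM f' g' fE gE scale0r addr0.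
  rewrite mulr_suml mulr_sumr -big_split /=; apply: eq_bigr => k _.
  by rewrite mderivM /mxeval mevalD !mevalM mulrDl -!mulrA [mxvec X 0 k * _]mulrC.
Qed.

Lemma line_derivative_eq (p : {mpoly K[n * n]}) (x X : 'M[K]_n) a :
  (forall t, mxeval p (x + t *: X) = t * a) ->
  \sum_k mxeval p^`M(k) x * mxvec X 0 k = a.
Proof.
move=> pa; have [f [fE <-]] := line_derivative p x X.
suff -> : f = a *: 'X by rewrite derivZ derivX hornerZ hornerC mulr1.
apply/eqP; rewrite -subr_eq0; apply/eqP.
apply: (@poly_generic_eq0 K _ 1); first exact: oner_neq0.
by move=> t _; rewrite hornerD hornerN hornerZ hornerX fE pa mulrC subrr.
Qed.

(** For [k > 0] the determinant condition is automatic, so the group is the affine space 1 +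
    [filt T b k]. Its lines through 1 give one inclusion, its linear equations the other. *)
Lemma lie_algebra_filt (T : 'M[K]_n) (b : 'I_n -> nat) k :
  T \in unitmx -> {homo b : i j / (i <= j)%N} -> (0 < k)%N ->
  lie_algebra (filt_group T b k) = filt T b k.
Proof.
move=> Tu bS k0; apply/seteqP; split=> [X XL i j ij|X Xk p pH].
  have [p pE] : regular (fun x => mxconj T (x - 1%:M) i j).
    apply: (regmx_conj T (F := fun g => g - 1%:M)).
    by apply: regmxD; [exact: regmx_id|exact: regmx_cst].
  rewrite -(@line_derivative_eq p 1%:M X (mxconj T X i j)); first apply: XL.
    by move=> x [_ xk]; rewrite -pE xk.
  by move=> t; rewrite -pE addrAC subrr add0r mxconjZ mxE.
apply: line_derivative_eq => t; rewrite mulr0; apply: pH.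
have Fr : filt T b k (1%:M + t *: X - 1%:M).
  by rewrite addrAC subrr add0r; exact: filtZ.
by split=> //; exact: (det_filt1 Tu bS k0 Fr).
Qed.

End LieAlgebra.

(** * Intertwiners and Levi factors *)

Section Intertwiners.
Context (K : fieldType) (n : nat).

(** Encoding the intertwiners as a kernel turns statements about their dimension into rank
    inequalities: the larger the rank, the smaller the space. *)
Definition intertwine (a b : 'M[K]_n) : 'M[K]_(n * n) := lin_mulmxr a - lin_mulmx b.

Lemma mul_intertwine (x a b : 'M[K]_n) :
  mxvec x *m intertwine a b = mxvec (x *m a - b *m x).
Proof. by rewrite mulmxBr /lin_mulmxr /lin_mulmx !mul_vec_lin /= raddfB. Qed.

Lemma intertwineP (x a b : 'M[K]_n) :
  mxvec x *m intertwine a b = 0 <-> x *m a = b *m x.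
Proof.
rewrite mul_intertwine; split=> [/eqP|->]; last by rewrite subrr raddf0.
by rewrite mxvec_eq0 subr_eq0 => /eqP.
Qed.

Lemma rank_intertwine_conj (a b g h : 'M[K]_n) : g \in unitmx -> h \in unitmx ->
  (\rank (intertwine (mxconj g a) (mxconj h b)) <= \rank (intertwine a b))%N.
Proof.
move=> gu hu.
have -> : intertwine (mxconj g a) (mxconj h b) = lin_mulmx (invmx h) *m lin_mulmxr g *m
    intertwine a b *m (lin_mulmx h *m lin_mulmxr (invmx g)).
  apply/row_matrixP => i; rewrite !rowE; set e := 'e_i.
  rewrite -[e]vec_mxK !mulmxA !mul_intertwine /lin_mulmxr /lin_mulmx !mul_vec_lin /=
    !mul_intertwine.
  rewrite !mul_vec_lin /=; congr mxvec; rewrite /mxconj !mulmxBr !mulmxBl !mulmxA.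
  by rewrite mulmxV // mul1mx -!mulmxA !mulmxV ?mulmx1.
by rewrite (leq_trans (mxrankM_maxl _ _)) // mxrankM_maxr.
Qed.

Lemma rank_intertwine_scale (a b : 'M[K]_n) t :
  (\rank (intertwine (t *: a) (t *: b)) <= \rank (intertwine a b))%N.
Proof.
suff -> : intertwine (t *: a) (t *: b) = t *: intertwine a b.
  exact: mxrank_scale.
apply/row_matrixP => i; rewrite !rowE; set e := 'e_i.
rewrite -[e]vec_mxK -scalemxAr !mul_intertwine -linearZ /= scalerBr.
by rewrite -scalemxAr -scalemxAl.
Qed.

End Intertwiners.

Section Levi.
Context (K : numClosedFieldType) (n : nat).

Lemma mx_linear_surj (S : set 'M[K]_n) (F : 'M[K]_(n * n)) : mx_linear S ->
  (forall x, S x -> S (vec_mx (mxvec x *m F))) ->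
  (forall x, S x -> mxvec x *m F = 0 -> x = 0) ->
  forall y, S y -> exists2 x, S x & mxvec x *m F = mxvec y.
Proof.
move=> [S0 SL] SF Sinj y Sy.
have [W SW] : exists W : 'M[K]_(n * n), forall v, S (vec_mx v) <-> (v <= W)%MS.
  apply: (linear_setP (S := fun v => S (vec_mx v))); split; first by rewrite raddf0.
  by move=> a u v Su Sv; rewrite linearP; exact: SL.
have WF : (W *m F <= W)%MS.
  apply/rV_subP => _ /submxP[z ->]; rewrite mulmxA; apply/SW.
  by rewrite -[z *m W]vec_mxK; apply: SF; apply/SW; exact: submxMl.
have rWF : \rank (W *m F) = \rank W.
  apply/mxrank_injP; rewrite -submx0; apply/rV_subP => v.
  rewrite sub_capmx => /andP[/SW vW /sub_kermxP vF].
  by rewrite -[v]vec_mxK (Sinj _ vW) ?raddf0 ?sub0mx // vec_mxK.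
have WWF : (W <= W *m F)%MS by rewrite -(geq_leqif (mxrank_leqif_sup WF)) rWF.
have /submxP[z yz] : (mxvec y <= W *m F)%MS.
  by apply: submx_trans WWF; apply/SW; rewrite mxvecK.
exists (vec_mx (z *m W)); first by apply/SW; exact: submxMl.
by rewrite vec_mxK -mulmxA -yz.
Qed.

Variables (T : 'M[K]_n) (b : 'I_n -> nat).
Hypothesis Tu : T \in unitmx.
Hypothesis bS : {homo b : i j / (i <= j)%N}.

Lemma filt_linear k : mx_linear (filt T b k).
Proof. by split; [exact: filt0|move=> a x y; exact: filt_lin]. Qed.

Lemma filt1_unit x : filt T b 1 x -> 1%:M + x \in unitmx.
Proof.
move=> x1; have : filt T b 1 (1%:M + x - 1%:M) by rewrite addrAC subrr add0r.
by move=> /(det_filt1 Tu bS (ltnSn 0)) d1; rewrite unitmxE d1 unitr1.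
Qed.

(* The map [x |-> x z - (z + e) x] of the nilradical agrees with [- ad z] up to
   terms of higher degree, so it is injective, hence surjective. *)
Lemma filt1_conj z e : filt T b 0 z ->
  (forall x, filt T b 1 x -> x *m z = z *m x -> x = 0) -> filt T b 1 e ->
  exists2 x, filt T b 1 x & (1%:M + x) *m z = (z + e) *m (1%:M + x).
Proof.
move=> z0 zinj e1.
have fF k y c : filt T b 0 y -> filt T b 0 c -> forall x, filt T b k x ->
    filt T b k (vec_mx (mxvec x *m intertwine y c)).
  move=> y0 c0 x xk; rewrite mul_intertwine mxvecK.
  by apply: filtB; [exact: filtMr|exact: filtMl].
have ze : filt T b 0 (z + e) by apply: filtD => //; exact: (filt_sub (leq0n 1)).
have inj x : filt T b 1 x -> x *m z = (z + e) *m x -> x = 0.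
  (* If [x] has degree at least [k.+1], then [x' z - z x' = e x] has a solution of degree [k.+2];
     [x - x'] commutes with [z], so it vanishes and [x] has degree [k.+2] too. *)
  move=> x1 xz; have xk k : filt T b k.+1 x.
    elim: k => [//|k IH].
    have ex : filt T b k.+2 (e *m x) by rewrite -add1n; exact: filtM.
    have [x' x'k] := mx_linear_surj (filt_linear k.+2) (@fF k.+2 z z z0 z0)
      (fun y yk yz => zinj y (@filt_sub _ _ T b 1 k.+2 isT y yk) ((intertwineP _ _ _).1
        yz)) ex.
    rewrite mul_intertwine => /(can_inj mxvecK) x'z.
    suff -> : x = x' by [].
    apply/eqP; rewrite -subr_eq0; apply/eqP/zinj.
      by apply: filtB => //; exact: (@filt_sub _ _ T b 1 k.+2 isT).
    apply/eqP; rewrite mulmxBl mulmxBr -subr_eq0 xz mulmxDl.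
    by rewrite -x'z; apply/eqP/matrixP => i j; rewrite !mxE; ring.
  apply: (filt_nil (b := b) Tu (k := (\max_i b i).+1)) => // i.
  by rewrite ltnS leq_bigmax.
have [x x1] := mx_linear_surj (filt_linear 1) (@fF 1%N z (z + e) z0 ze)
  (fun y y1 yz => inj y y1 ((intertwineP _ _ _).1 yz)) e1.
rewrite mul_intertwine => /(can_inj mxvecK) xz; exists x => //.
rewrite mulmxDl mul1mx mulmxDr mulmx1.
by move/eqP: xz; rewrite subr_eq => /eqP ->; rewrite addrA.
Qed.


(** The last two conditions concern the centralizer of [z] in the full matrix algebra, because the
    deformation solves linear equations and only afterwards returns to [SL]. *)
Definition levi_center (L : set 'M[K]_n) (z : 'M[K]_n) : Prop :=
  [/\ L z, L = [set g | SL g /\ g *m z = z *m g],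
    forall x, x *m z = z *m x -> filt T b 0 x
  & forall x, filt T b 1 x -> x *m z = z *m x -> x = 0].

(* Take [s] diagonal, scalar on each block with distinct scalars, and write
   [s = z u] with [z] in [L] and [u] in the unipotent radical. Then [z] is
   conjugate to [s], and it is central in [L] because [s] is central modulo the
   nilradical. *)
Lemma levi_factor_center L : (0 < n)%N ->
  levi_factor (filt_group T b 0) (filt_group T b 1) L ->
  exists2 z, levi_center L z &
    exists S (d : 'I_n -> K), [/\ S \in unitmx,
      mxconj S z = diag_mx (\row_i d i) & forall i j, (d i == d j) = (b i == b j)].
Proof.
move=> n0 [[[LS L1 LM LV] _] LU LI1].
have U1 : filt_group T b 1 1%:M by have [] := filt_subgroup b Tu 1.
have LP g : L g -> filt_group T b 0 g.
  by move=> Lg; rewrite -LU; exists g => //; exists 1%:M; rewrite ?mulmx1.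
have Tu' : invmx T \in unitmx by rewrite unitmx_inv.
(* The entries [(b i).+1] separate the blocks, and the successor makes them nonzero, so that [D] can
   be scaled into [SL]. *)
pose D : 'M[K]_n := diag_mx (\row_i (b i).+1%:R).
have Du : D \in unitmx.
  rewrite unitmxE det_diag unitfE; apply/prodf_neq0 => i _.
  by rewrite mxE pnatr_eq0.
have [c c0 Sc] := SL_scale n0 Du.
pose d i := c * (b i).+1%:R.
have dE i j : (d i == d j) = (b i == b j).
  by rewrite (inj_eq (mulfI c0)) eqr_nat eqSS.
have cD : c *: D = diag_mx (\row_i d i).
  by apply/matrixP => i j; rewrite !mxE mulrnAr.
pose s := mxconj (invmx T) (diag_mx (\row_i d i)).
have Ts : mxconj T s = diag_mx (\row_i d i) by rewrite mxconjVK.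
have Ss : SL s by rewrite /SL /= det_mxconj // -cD.
clearbody s.
have comE x i j : mxconj T (x *m s - s *m x) i j = mxconj T x i j * (d j - d i).
  rewrite mxconjB !mxconjM // Ts mul_mx_diag mul_diag_mx.
  move: (mxconj T x) => y; rewrite !mxE; ring.
have com_filt x : filt T b 0 x -> filt T b 1 (x *m s - s *m x).
  move=> x0 i j; rewrite addn1 ltnS leq_eqVlt => /orP[|ij].
    by rewrite -dE => /eqP ij; rewrite comE ij subrr mulr0.
  by rewrite comE x0 ?mul0r // addn0.
have com0 x i j : x *m s = s *m x -> b i != b j -> mxconj T x i j = 0.
  move=> xs; rewrite -dE => ij; have := comE x i j.
  rewrite xs subrr mxconj0 mxE => /esym/eqP; rewrite mulf_eq0 subr_eq0 [d j == _]eq_sym.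
  by rewrite (negPf ij) orbF => /eqP.
have s0 : filt T b 0 s.
  by move=> i j; rewrite addn0 Ts !mxE; case: eqP => // ->; rewrite ltnn.
have sP : filt_group T b 0 s.
  by rewrite filt_group0.
have [z Lz [u [Su u1] zu]] : [set l *m u | l in L & u in filt_group T b 1] s by rewrite
  LU.
have uu := SL_unit Su.
have z0 := filt_group_sub0 Tu (LP _ Lz).
have e1 : filt T b 1 (z - s).
  have -> : z - s = - (z *m (u - 1%:M)) by rewrite mulmxBr mulmx1 zu opprB.
  by apply/filtN/filtMl.
have sinj x : filt T b 1 x -> x *m s = s *m x -> x = 0.
  move=> x1 xs; rewrite -[x](mxconjK Tu); suff -> : mxconj T x = 0 by rewrite mxconj0.
  apply/matrixP => i j; rewrite [RHS]mxE; have [ij|ij] := eqVneq (b i) (b j).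
    by rewrite x1 // ij addn1.
  exact: com0.
have [x x1] := filt1_conj s0 sinj e1; rewrite addrCA subrr addr0.
set v := 1%:M + x => vs; have vu : v \in unitmx by exact: filt1_unit.
have v0 : filt T b 0 v.
  by apply: filtD; [exact: filt1|exact: (filt_sub (leq0n 1))].
have vV0 := filtV Tu vu v0.
have zE : z = v *m s *m invmx v by rewrite vs mulmxK.
have comz y : y *m z = z *m y -> (invmx v *m y *m v) *m s = s *m (invmx v *m y *m v).
  move=> yz; have vz : invmx v *m z = s *m invmx v by rewrite zE !mulmxA mulVmx // mul1mx.
  by rewrite -!mulmxA vs [y *m _]mulmxA yz !mulmxA vz.
have vyv k y : filt T b k (invmx v *m y *m v) -> filt T b k y.
  have {2}-> : y = v *m (invmx v *m y *m v) *m invmx v by rewrite !mulmxA mulmxK //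
    mulmxV // mul1mx.
  by move=> yk; apply: filtMr => //; exact: filtMl.
have Cz0 y : y *m z = z *m y -> filt T b 0 y.
  move=> /comz yz; apply: (vyv 0%N) => i j; rewrite addn0 => ij.
  by apply: com0 => //; rewrite (ltn_eqF ij).
have Cz1 y : filt T b 1 y -> y *m z = z *m y -> y = 0.
  move=> y1 /comz/sinj yz; have : invmx v *m y *m v = 0.
    by apply: yz; apply: filtMr => //; exact: filtMl.
  move=> /(congr1 (fun w => v *m w *m invmx v)).
  by rewrite !mulmxA mulmxK // mulmxV // mul1mx mulmx0 mul0mx.
exists z; last first.
  exists (T *m invmx v), d; have vu' : invmx v \in unitmx by rewrite unitmx_inv.
  split=> //; first by rewrite unitmx_mul Tu.
  have vz : mxconj (invmx v) z = s.
    by rewrite /mxconj invmxK zE !mulmxA mulVmx // mul1mx mulmxKV.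
  by rewrite -mxconj_mul // vz Ts.
have zu' := SL_unit (LS _ Lz).
have LC g : L g -> g *m z = z *m g.
  move=> Lg; have g0 := filt_group_sub0 Tu (LP _ Lg); have gu := SL_unit (LS _ Lg).
  pose c' := g *m z *m invmx g *m invmx z.
  have Lc : L c' by apply: (LM); [apply: (LM); [exact: LM|exact: LV]|exact: LV].
  have c1 : filt T b 1 (c' - 1%:M).
    have -> : c' - 1%:M = (g *m z - z *m g) *m invmx g *m invmx z.
      by rewrite 2!mulmxBl -/c' mulmxK // mulmxV.
    have -> : g *m z - z *m g = (g *m s - s *m g) + (g *m (z - s) - (z - s) *m g).
      by rewrite mulmxBr mulmxBl; apply/matrixP => i j; rewrite !mxE; ring.
    apply: filtMr => //; last exact: filtV.
    apply: filtMr => //; last exact: filtV.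
    by apply: filtD; [exact: com_filt|apply: filtB; [exact: filtMl|exact: filtMr]].
  have : (L `&` filt_group T b 1) c' by split=> //; split=> //; exact: LS.
  rewrite LI1 => /= cE; have := congr1 (fun w => w *m z *m g) cE.
  by rewrite /c' mulmxKV // mulmxKV // mul1mx.
split=> //; apply/seteqP; split=> [g Lg|g [Sg gz]]; first by split; [exact: LS|exact: LC].
have : filt_group T b 0 g by rewrite filt_group0 //; split=> //; exact: Cz0.
rewrite -LU => -[l Ll [w [Sw w1] lw]].
suff w0 : w - 1%:M = 0.
  by move/eqP: w0; rewrite subr_eq0 => /eqP w0; rewrite -lw w0 mulmx1.
apply: Cz1 => //; rewrite mulmxBl mulmxBr mulmx1 mul1mx; congr (_ - _).
have lu := SL_unit (LS _ Ll); apply: (can_inj (mulKmx lu)).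
by rewrite mulmxA lw gz -lw !mulmxA (LC l Ll).
Qed.

(** This is where the Levi factor being common to both parabolics enters. The centralizer algebra of
    [z] is spanned by its elements in [SL], all in [L]; and if [x] in the nilradical commutes with
    [z], then [1 + x] lies in both [L] and the radical. *)
Lemma levi_center_transfer L z : (0 < n)%N ->
  levi_factor (filt_group T b 0) (filt_group T b 1) L ->
  L z -> L = [set g | SL g /\ g *m z = z *m g] -> levi_center L z.
Proof.
move=> n0 [[[LS L1 LM LV] _] LU LI1] Lz LE; split=> //.
  have U1 : filt_group T b 1 1%:M by have [] := filt_subgroup b Tu 1.
  have LP g : L g -> filt T b 0 g.
    move=> Lg; suff : filt_group T b 0 g by exact: filt_group_sub0.
    by rewrite -LU; exists g => //; exists 1%:M; rewrite ?mulmx1.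
  apply: (linear_SL_sub n0 (V := [set x | x *m z = z *m x])).
  - split=> [|a x y /= xz yz]; first by rewrite /= mul0mx mulmx0.
    by rewrite /= mulmxDl mulmxDr -scalemxAl -scalemxAr xz yz.
  - exact: filt_linear.
  - by rewrite /= mul1mx mulmx1.
  - by move=> g gz Sg; apply: LP; rewrite LE.
move=> x x1 xz; have S1 : filt T b 1 (1%:M + x - 1%:M) by rewrite addrAC subrr add0r.
have Sx : SL (1%:M + x) by exact: (det_filt1 Tu bS (ltnSn 0) S1).
have : (L `&` filt_group T b 1) (1%:M + x).
  by split=> //; rewrite LE /=; split=> //; rewrite mulmxDl mulmxDr mul1mx mulmx1 xz.
rewrite LI1 => /= /(congr1 (fun w => w - 1%:M)).
by rewrite addrAC !subrr add0r.
Qed.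

End Levi.

(** * Centralizers of Richardson elements *)

Section RankSemicontinuity.
Context (K : numClosedFieldType) (n : nat).

(** [A] and [B] are one-sided inverses of the factors in a rank factorization of [F x]. The
    determinant of [A *m F y *m B] is 1 at [y = x] and vanishes wherever [F y] has smaller rank than
    [F x]. *)
Lemma zclosure_rank (S : set 'M[K]_n) p q (F : 'M[K]_n -> 'M[K]_(p, q)) r x :
  regmx F -> (forall y, S y -> (\rank (F y) <= r)%N) -> zclosure S x ->
  (\rank (F x) <= r)%N.
Proof.
move=> rF Sr Sx; rewrite leqNgt; apply/negP => rx.
have /row_fullP[A AC] : row_full (col_base (F x)) by exact: col_base_full.
have /row_freeP[B RB] : row_free (row_base (F x)) by exact: row_base_free.
suff : \det (A *m F x *m B) = 0.
  have -> : A *m F x = row_base (F x).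
    transitivity (A *m (col_base (F x) *m row_base (F x))); first by rewrite mulmx_base.
    by rewrite mulmxA AC mul1mx.
  by rewrite RB det1 => /eqP; rewrite oner_eq0.
apply: (zclosure_zero (f := fun y => \det (A *m F y *m B)) _ _ Sx).
  by apply: regular_det; apply: regmxM; [apply: regmxM => //|]; exact: regmx_cst.
move=> y /Sr yr; apply/eqP; apply: contraTT rx => dy.
have : row_free (A *m F y *m B) by rewrite row_free_unit unitmxE unitfE.
rewrite /row_free => /eqP rE; rewrite -leqNgt -[X in (X <= _)%N]rE.
by rewrite (leq_trans (mxrankM_maxl _ _)) // (leq_trans (mxrankM_maxr _ _)).
Qed.

Lemma regmx_intertwine : regmx (fun x : 'M[K]_n => intertwine x x).
Proof.
move=> i j; have -> : (fun x : 'M[K]_n => intertwine x x i j) =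
    (fun x => ((mxvec (vec_mx 'e_i *m x - x *m vec_mx 'e_i)) 0 j)).
  by apply/funext => x; rewrite -mul_intertwine vec_mxK -rowE [RHS]mxE.
case/mxvec_indexP: j => k l; under eq_fun do rewrite mxvecE.
suff : regmx (fun x : 'M[K]_n => vec_mx 'e_i *m x - x *m vec_mx 'e_i) by apply.
apply: regmxD; first by apply: regmxM; [exact: regmx_cst|exact: regmx_id].
by apply: regmxN; apply: regmxM; [exact: regmx_id|exact: regmx_cst].
Qed.

End RankSemicontinuity.

(** * An explicit nilpotent with small centralizer *)

Section RegularNilpotent.
Context (K : numClosedFieldType) (n : nat) (b : 'I_n -> nat).
Hypothesis bS : {homo b : i j / (i <= j)%N}.

Definition select (D : rel 'I_n) : 'M[K]_(n * n) :=
  diag_mx (mxvec (\matrix_(i, j) (D i j)%:R)).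

Lemma mul_select (D : rel 'I_n) (x : 'M[K]_n) :
  mxvec x *m select D = mxvec (\matrix_(i, j) if D i j then x i j else 0).
Proof.
apply/rowP => k; rewrite mul_mx_diag mxE; case/mxvec_indexP: k => i j.
by rewrite !mxvecE !mxE; case: (D i j); rewrite ?mulr1 ?mulr0.
Qed.

Lemma rank_select (D : rel 'I_n) : \rank (select D) = (\sum_i \sum_j D i j)%N.
Proof.
apply/eqP; rewrite -(eqr_nat K) -mxtrace_idempotent; last first.
  apply/row_matrixP => i; rewrite !rowE mulmxA -['e_i]vec_mxK !mul_select.
  by congr mxvec; apply/matrixP => k l; rewrite !mxE; case: (D k l).
rewrite mxtrace_diag (reindex _ (curry_mxvec_bij _ _)) /= natr_sum.
under [X in _ == X]eq_bigr => i _ do rewrite natr_sum.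
rewrite pair_bigA /=; apply/eqP/eq_bigr => -[i j] _ /=.
by rewrite mxvecE mxE.
Qed.

(* [c i] is the position of [i] inside its block, and [N] sends every position to
   the same position in the previous block that is large enough. *)
Let c (i : 'I_n) : nat := \sum_(j < n) ((j < i)%N && (b j == b i)).

Let cov (i j : 'I_n) :=
  [&& (j < i)%N, c j == c i & [forall k : 'I_n, ((j < k)%N && (k < i)%N) ==> (c k != c
    i)]].

Let c_lt (i j : 'I_n) : (j < i)%N -> b j = b i -> (c j < c i)%N.
Proof.
move=> ji bij; rewrite /c (bigD1 j) //= [X in (_ < X)%N](bigD1 j) //=.
rewrite ltnn ji bij eqxx /= add0n add1n ltnS; apply: leq_sum => k _.
by case: (ltnP k j) => //= kj; rewrite (ltn_trans kj ji).
Qed.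

Let cov_b i j : cov i j -> (b j < b i)%N.
Proof.
move=> /and3P[ji /eqP cji _]; rewrite ltn_neqAle bS ?(ltnW ji) // andbT.
by apply/negP => /eqP/(c_lt ji); rewrite cji ltnn.
Qed.

Let cov_fun i j k : cov i j -> cov i k -> j = k.
Proof.
move=> /and3P[ji /eqP cji /forallP jm] /and3P[ki /eqP cki /forallP km].
apply/val_inj; case: (ltngtP j k) => // [jk|kj].
  by have := jm k; rewrite jk ki cki eqxx.
by have := km j; rewrite kj ji cji eqxx.
Qed.

Let cov_inj i j k : cov j i -> cov k i -> j = k.
Proof.
move=> /and3P[ij /eqP cij /forallP jm] /and3P[ik /eqP cik /forallP km].
apply/val_inj; case: (ltngtP j k) => // [jk|kj].
  by have := km j; rewrite ij jk -cij -cik eqxx.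
by have := jm k; rewrite ik kj -cij -cik eqxx.
Qed.

Let cov_pred (i j : 'I_n) : (j < i)%N -> c j = c i -> exists k, cov i k.
Proof.
move=> ji cji.
have [k /andP[ki /eqP ck] km] := @arg_maxnP _ j (fun k : 'I_n => (k < i)%N && (c k == c
  i)) val
  (introT andP (conj ji (introT eqP cji))).
exists k; apply/and3P; split=> //; first by rewrite ck.
apply/forallP => l; apply/implyP => /andP[kl li]; apply/negP => cl.
by have := km l; rewrite li cl /= leqNgt kl => /(_ isT).
Qed.

Let cov_succ (i j : 'I_n) : (j < i)%N -> c j = c i -> exists k, cov k j.
Proof.
move=> ji cji.
have [k /andP[ki /eqP ck] km] := @arg_minnP _ i (fun k : 'I_n => (j < k)%N && (c k == c
  j)) val
  (introT andP (conj ji (introT eqP (esym cji)))).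
exists k; apply/and3P; split=> //; first by rewrite ck.
apply/forallP => l; apply/implyP => /andP[kl li]; apply/negP => cl.
by have := km l; rewrite kl (eqP cl) ck eqxx /= leqNgt li => /(_ isT).
Qed.

Let N : 'M[K]_n := \matrix_(i, j) (cov i j)%:R.

Let mul_N_succ (x : 'M[K]_n) i j k : cov k j -> (x *m N) i j = x i k.
Proof.
move=> kj; rewrite mxE (bigD1 k) //= big1 ?addr0 ?mxE ?kj ?mulr1 // => h hk.
by rewrite mxE; case: (boolP (cov h j)) => [/(cov_inj kj) kh|_];
  [rewrite kh eqxx in hk|rewrite mulr0].
Qed.

Let mul_N_last (x : 'M[K]_n) i j : (forall k, ~~ cov k j) -> (x *m N) i j = 0.
Proof. by move=> kj; rewrite mxE big1 // => h _; rewrite mxE (negPf (kj h)) mulr0. Qed.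

Let N_mul_pred (x : 'M[K]_n) i j k : cov i k -> (N *m x) i j = x k j.
Proof.
move=> ik; rewrite mxE (bigD1 k) //= big1 ?addr0 ?mxE ?ik ?mul1r // => h hk.
by rewrite mxE; case: (boolP (cov i h)) => [/(cov_fun ik) kh|_];
  [rewrite kh eqxx in hk|rewrite mul0r].
Qed.

Let N_mul_first (x : 'M[K]_n) i j : (forall k, ~~ cov i k) -> (N *m x) i j = 0.
Proof. by move=> ki; rewrite mxE big1 // => h _; rewrite mxE (negPf (ki h)) mul0r. Qed.

(** The ends of the chains of [cov]; each chain collects the indices with one value of [c] and is a
    Jordan string of [N]. *)
Let last (i : 'I_n) := [forall k : 'I_n, (i < k)%N ==> (c k != c i)].
Let first (i : 'I_n) := [forall k : 'I_n, (k < i)%N ==> (c k != c i)].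

Let D1 i j := last i && (c i <= c j)%N.
Let D2 i j := first j && (c j < c i)%N.

(* The entries of an element of the centralizer of [N] are constant or zero
   along the diagonals of [cov], so those in [D1] and [D2] determine it. *)
Let centralizer_determined (x : 'M[K]_n) : x *m N = N *m x ->
  (forall i j, D1 i j || D2 i j -> x i j = 0) -> x = 0.
Proof.
move=> xN xD.
have up m : forall i j : 'I_n, (n - i <= m)%N -> (c i <= c j)%N -> x i j = 0.
  elim: m => [|m IH] i j im cij; first by have := ltn_ord i; lia.
  have [li|/forallPn[k]] := boolP (last i); first by apply: xD; rewrite /D1 li cij.
  rewrite negb_imply negbK => /andP[ik /eqP ck].
  have [i' ii'] := cov_succ ik (esym ck); have /and3P[li' /eqP ci' _] := ii'.
  rewrite -(N_mul_pred x j ii') -xN.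
  have [[j' jj']|nj] := pselect (exists j', cov j' j); last first.
    by apply: mul_N_last => k'; apply/negP => kj; apply: nj; exists k'.
  have /and3P[_ /eqP cj' _] := jj'.
  rewrite (mul_N_succ x i' jj'); apply: IH; last by rewrite -ci' -cj'.
  by have := ltn_ord i'; lia.
have down m : forall i j : 'I_n, (j <= m)%N -> (c j < c i)%N -> x i j = 0.
  elim: m => [|m IH] i j jm cij.
    apply: xD; rewrite /D2 cij andbT; apply/orP; right; apply/forallP => k.
    by apply/implyP; lia.
  have [fj|/forallPn[k]] := boolP (first j); first by apply: xD; rewrite /D2 fj cij orbT.
  rewrite negb_imply negbK => /andP[kj /eqP ck].
  have [j' jj'] := cov_pred kj ck; have /and3P[lj' /eqP cj' _] := jj'.
  rewrite -(mul_N_succ x i jj') xN.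
  have [[i' ii']|ni] := pselect (exists i', cov i i'); last first.
    by apply: N_mul_first => k'; apply/negP => ik; apply: ni; exists k'.
  have /and3P[_ /eqP ci' _] := ii'.
  rewrite (N_mul_pred x j' ii'); apply: IH; last by rewrite ci' cj'.
  lia.
apply/matrixP => i j; rewrite mxE; have [cij|cij] := leqP (c i) (c j).
  exact: (up n i j (leq_subr _ _)).
exact: (down j i j).
Qed.

Let count_inj (P : pred 'I_n) m : {in P &, injective c} ->
  (forall i, P i -> (c i < m)%N) -> (\sum_i P i <= m)%N.
Proof.
move=> Pinj Pm; have -> : (\sum_i P i)%N = #|P|.
  by rewrite -sum1_card [RHS]big_mkcond; apply: eq_bigr => i _; rewrite unfold_in;
    case: (P i).
case: m Pm => [|m] Pm.
  by rewrite leqn0; apply/eqP/eq_card0 => i; apply/negP => /Pm.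
rewrite -[m.+1]card_ord -(@card_in_image _ _ (fun i => inord (c i) : 'I_m.+1) P).
  exact: max_card.
move=> i j Pi Pj /(congr1 val); rewrite /= !inordK; first exact: Pinj.
- exact: Pm.
- exact: Pm.
Qed.

(** Distinct [last] (or [first]) indices have distinct [c], so column [j] meets [D1] at most
    [c j + 1] times and row [i] meets [D2] at most [c i] times. Summed up, these bounds count the
    pairs in a common block, ordered one way and the other. *)
Let count_D : (\sum_i \sum_j (D1 i j || D2 i j) <= \sum_i \sum_j (b i == b j))%N.
Proof.
have D1_le j : (\sum_i D1 i j <= \sum_(k < n) ((k <= j) && (b k == b j)))%N.
  have -> : (\sum_(k < n) ((k <= j) && (b k == b j)) = (c j).+1)%N.
    rewrite (bigD1 j) //= leqnn eqxx /= add1n /c [in RHS](bigD1 j) //= ltnn add0n.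
    congr _.+1; apply: eq_bigr => k kj; rewrite leq_eqVlt -(inj_eq val_inj) /= in kj *.
    by rewrite (negPf kj).
  apply: count_inj => [i k /andP[/forallP li _] /andP[/forallP lk _] cik|i /andP[_]];
    last by [].
  apply/val_inj; case: (ltngtP i k) => // [ik|ki].
    by have := li k; rewrite ik cik eqxx.
  by have := lk i; rewrite ki cik eqxx.
have D2_le i : (\sum_j D2 i j <= c i)%N.
  apply: count_inj => [j k /andP[/forallP fj _] /andP[/forallP fk _] cjk|j /andP[_]];
    last by [].
  apply/val_inj; case: (ltngtP j k) => // [jk|kj].
    by have := fk j; rewrite jk cjk eqxx.
  by have := fj k; rewrite kj cjk eqxx.
apply: (@leq_trans (\sum_i \sum_j D1 i j + \sum_i \sum_j D2 i j)%N).
  rewrite -big_split; apply: leq_sum => i _ /=; rewrite -big_split.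
  by apply: leq_sum => j _ /=; case: (D1 i j); case: (D2 i j).
rewrite exchange_big /=.
apply: (@leq_trans (\sum_(j < n) \sum_(k < n) ((k <= j) && (b k == b j)) + \sum_i c i)%N).
  by apply: leq_add; apply: leq_sum.
rewrite exchange_big /= /c -big_split; apply: leq_sum => i _ /=; rewrite -big_split.
apply: leq_sum => j _ /=; rewrite [b j == b i]eq_sym.
by case: leqP; case: eqP.
Qed.

(** The centralizer of [N] embeds into the entries in [D1] or [D2], which are no more numerous than
    the entries of the diagonal blocks; the latter span the centralizer of the diagonal matrix of
    [d]. *)
Lemma exists_regular_nilpotent (d : 'I_n -> K) :
  (forall i j, (d i == d j) = (b i == b j)) ->
  exists2 N : 'M[K]_n, (forall i j, (b i <= b j)%N -> N i j = 0) &
    (\rank (intertwine (diag_mx (\row_i d i)) (diag_mx (\row_i d i))) <=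
     \rank (intertwine N N))%N.
Proof.
move=> db; exists N => [i j|].
  by rewrite mxE leqNgt; case: (boolP (cov i j)) => // /cov_b ->.
set A := intertwine N N; set B := intertwine _ _.
suff : (\rank (kermx A) <= \rank (kermx B))%N.
  by rewrite !mxrank_ker; have := rank_leq_col A; have := rank_leq_col B; lia.
apply: (@leq_trans (\rank (select (fun i j => D1 i j || D2 i j)))).
  have <- : \rank (kermx A *m select (fun i j => D1 i j || D2 i j)) = \rank (kermx A).
    apply/mxrank_injP; rewrite -submx0; apply/rV_subP => v.
    rewrite sub_capmx => /andP[/sub_kermxP vA /sub_kermxP vS].
    rewrite -[v]vec_mxK; suff -> : vec_mx v = 0 by rewrite raddf0 sub0mx.
    rewrite -[v]vec_mxK mul_select in vA vS.
    apply: centralizer_determined; first exact/intertwineP.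
    move=> i j Dij; move/eqP: vS; rewrite mxvec_eq0 => /eqP/matrixP/(_ i j).
    by rewrite !mxE Dij.
  exact: mxrankM_maxr.
rewrite rank_select (leq_trans count_D) // -(rank_select (fun i j => b i == b j)).
apply/mxrankS/rV_subP => _ /submxP[v ->]; apply/sub_kermxP.
rewrite -[v]vec_mxK mul_select; apply/intertwineP/matrixP => i j.
rewrite mul_mx_diag mul_diag_mx !mxE -db; case: eqP => [->|]; first by rewrite mulrC.
by rewrite mul0r mulr0.
Qed.

End RegularNilpotent.

(** * Lifting centralizers along a pencil *)

Section Lifting.
Context (K : numClosedFieldType).

Lemma evalmx_adj n (A : 'M[{poly K}]_n) t : evalmx (\adj A) t = \adj (evalmx A t).
Proof. exact: (map_mx_adj (horner_eval t)). Qed.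

(* With [M] a pseudo-inverse of [A0], the matrix [D t = 1 + t A1 M] satisfies
   [D t *m (A0 *m M) = (A0 + t A1) *m M], so [v0 *m D t ^-1] is killed by
   [A0 + t A1]; multiplying by [\det (D t)] makes it polynomial in [t]. *)
Lemma lift_kernel p q (A0 A1 : 'M[K]_(p, q)) (v0 : 'rV[K]_p) :
  (forall t, (\rank (A0 + t *: A1)%R <= \rank A0)%N) -> v0 *m A0 = 0 ->
  exists v : 'rV[{poly K}]_p, evalmx v 0 = v0 /\
    forall t, evalmx v t *m (A0 + t *: A1) = 0.
Proof.
move=> rA v0A.
have /row_fullP[P PC] : row_full (col_base A0) by exact: col_base_full.
have /row_freeP[Q RQ] : row_free (row_base A0) by exact: row_base_free.
pose M := Q *m P.
have PA : P *m A0 = row_base A0.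
  transitivity (P *m (col_base A0 *m row_base A0)); first by rewrite mulmx_base.
  by rewrite mulmxA PC mul1mx.
have MAM : M *m A0 *m M = M by rewrite /M -(mulmxA Q) PA mulmxA -(mulmxA Q) RQ mulmx1.
have AMA : A0 *m M *m A0 = A0.
  rewrite /M -!mulmxA PA.
  transitivity (col_base A0 *m row_base A0 *m (Q *m row_base A0)).
    by rewrite mulmx_base.
  by rewrite -mulmxA (mulmxA _ Q) RQ mul1mx mulmx_base.
have rE : \rank (A0 *m M) = \rank A0.
  by apply/eqP; rewrite eqn_leq mxrankM_maxl -{1}AMA mxrankM_maxl.
pose D : 'M[{poly K}]_p := map_mx polyC 1%:M + 'X *: map_mx polyC (A1 *m M).
have DE t : evalmx D t = 1%:M + t *: (A1 *m M).
  by rewrite evalmxD evalmxZ !evalmxC hornerX.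
pose v := map_mx polyC v0 *m \adj D.
have vE t : evalmx v t = v0 *m \adj (evalmx D t) by rewrite evalmxM evalmxC evalmx_adj.
exists v; split; first by rewrite vE DE scale0r addr0 adj1 mulmx1.
have det0 : (\det D).[0] = 1 by rewrite -det_evalmx DE scale0r addr0 det1.
have gen t : (\det D).[t] != 0 -> evalmx v t *m (A0 + t *: A1) = 0.
  move=> dt; set A := A0 + t *: A1; have Du : evalmx D t \in unitmx.
    by rewrite unitmxE unitfE det_evalmx.
  have DAM : evalmx D t *m (A0 *m M) = A *m M.
    rewrite DE /A mulmxDl mulmxDl mul1mx -!scalemxAl; congr (_ + _ *: _).
    by rewrite -mulmxA (mulmxA M) MAM.
  have vAM : evalmx v t *m A *m M = 0.
    rewrite -mulmxA -DAM mulmxA vE -(mulmxA v0) mul_adj_mx mul_mx_scalar -scalemxAl.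
    by rewrite mulmxA v0A mul0mx scaler0.
  (* Here the rank hypothesis enters: multiplication by [M] loses no rank on [A], so [v A M = 0]
     forces [v A = 0]. *)
  have rAM : \rank (A *m M) = \rank A.
    apply/eqP; rewrite eqn_leq mxrankM_maxl -DAM /=.
    suff -> : \rank (evalmx D t *m (A0 *m M)) = \rank (A0 *m M) by rewrite rE;
      exact: (rA t).
    by rewrite eqmxMfull // row_full_unit.
  move/mxrank_injP : rAM => AM0; apply/eqP; rewrite -submx0 -(eqP AM0) sub_capmx.
  by rewrite submxMl; apply/sub_kermxP.
move=> t; pose w : 'rV[{poly K}]_q := v *m (map_mx polyC A0 + 'X *: map_mx polyC A1).
have wE s : evalmx w s = evalmx v s *m (A0 + s *: A1).
  by rewrite evalmxM evalmxD evalmxZ !evalmxC hornerX.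
rewrite -wE; apply/matrixP => i j; rewrite mxE [RHS]mxE.
suff -> : w i j = 0 by rewrite horner0.
apply: (@poly_generic_eq0 K _ (\det D)); first by apply: contra_eq_neq det0 => ->;
  rewrite horner0 eq_sym oner_neq0.
by move=> s ds; have /matrixP/(_ i j) := gen s ds; rewrite -wE mxE [RHS]mxE.
Qed.

Lemma lift_intertwiner n (z e e' k0 : 'M[K]_n) :
  (forall t, (\rank (intertwine (t *: z + e)%R (t *: z + e')%R) <=
              \rank (intertwine e e'))%N) ->
  k0 *m e = e' *m k0 ->
  exists k : 'M[{poly K}]_n, evalmx k 0 = k0 /\
    forall t, evalmx k t *m (t *: z + e) = (t *: z + e') *m evalmx k t.
Proof.
move=> rA k0e.
have iE t : intertwine (t *: z + e) (t *: z + e') = intertwine e e' + t *: intertwine z z.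
  apply/row_matrixP => i; rewrite !rowE -['e_i]vec_mxK [RHS]mulmxDr -scalemxAr
    !mul_intertwine.
  rewrite -linearZ -linearD /=; congr mxvec;
    rewrite mulmxDr mulmxDl -scalemxAr -scalemxAl.
  by apply/matrixP => k l; rewrite !mxE; ring.
have [|v [v0 vt]] := @lift_kernel _ _ (intertwine e e') (intertwine z z) (mxvec k0) _
    ((intertwineP _ _ _).2 k0e).
  by move=> t; rewrite -iE.
have vE t : evalmx (vec_mx v) t = vec_mx (evalmx v t) by exact: map_vec_mx.
exists (vec_mx v); split; first by rewrite vE v0 mxvecK.
by move=> t; rewrite vE; apply/intertwineP; rewrite vec_mxK iE.
Qed.

(* Modulo [c ^+ n - d] the polynomial [Q] has degree less than [n] in [c], and for
   a generic [t] it has [n] distinct roots. *)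
Lemma root_unity_curve (n : nat) (d g : {poly K}) (Q : {poly {poly K}}) :
  (0 < n)%N -> d != 0 -> g != 0 ->
  (forall t c, g.[t] != 0 -> c ^+ n = d.[t] -> (map_poly (horner_eval t) Q).[c] = 0) ->
  forall t c, c ^+ n = d.[t] -> (map_poly (horner_eval t) Q).[c] = 0.
Proof.
move=> n0 d0 g0 Qgen.
pose M : {poly {poly K}} := 'X^n - d%:P.
have Mm : M \is monic by exact: monicXnsubC.
have sM : size M = n.+1 by exact: size_XnsubC.
have QE : Q = Pdiv.Ring.rdivp Q M * M + Pdiv.Ring.rmodp Q M by exact:
  Pdiv.RingMonic.rdivp_eq.
set S := Pdiv.Ring.rmodp Q M in QE.
have Mt t : map_poly (horner_eval t) M = 'X^n - d.[t]%:P.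
  by rewrite rmorphB /= map_polyXn map_polyC.
suff S0 : S = 0.
  move=> t c cn; rewrite QE S0 addr0 rmorphM /= Mt !hornerE cn subrr mulr0.
  by [].
have St t : (g * d).[t] != 0 -> map_poly (horner_eval t) S = 0.
  rewrite hornerM mulf_eq0 negb_or => /andP[gt dt].
  set a := d.[t] in dt; have [r rE] := closed_field_poly_normal ('X^n - a%:P : {poly K}).
  rewrite (monicP (monicXnsubC _ n0)) scale1r in rE.
  have rs : size r = n.
    by have := congr1 (fun p : {poly K} => size p) rE;
      rewrite size_XnsubC // size_prod_XsubC => -[].
  have ru : uniq r.
    rewrite -separable_prod_XsubC -rE separable_poly.unlock.
    apply/Bezout_eq1_coprimepP; exists (- a^-1%:P, (a^-1 / n%:R)%:P * 'X) => /=.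
    rewrite derivB derivC subr0 derivXn.
    have nn : (n%:R : K) != 0 by rewrite pnatr_eq0 -lt0n.
    have Xn : 'X * ('X^(n.-1) *+ n) = n%:R *: 'X^n :> {poly K}.
      by rewrite mulrnAr -exprS prednK // scaler_nat.
    rewrite -mulrA Xn mul_polyC scalerA divfK // mulNr mul_polyC scalerBr addrC.
    rewrite opprB addrCA subrr addr0 -mul_polyC -polyCM mulVf //.
  apply: contraTeq isT => S0.
  have : (size r < size (map_poly (horner_eval t) S))%N.
    apply: max_poly_roots => //; apply/allP => c cr.
    have cn : c ^+ n = d.[t].
      have : root ('X^n - a%:P) c by rewrite rE root_prod_XsubC.
      by rewrite rootE !hornerE subr_eq0 => /eqP.
    have := Qgen t c gt cn; rewrite QE rmorphD rmorphM /= Mt hornerD hornerM.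
    rewrite hornerD hornerN hornerXn hornerC cn subrr mulr0 add0r.
    by move=> Sc; apply/rootP.
  rewrite rs ltnNge (leq_trans (size_poly _ _)) //.
  by rewrite -ltnS -sM Pdiv.Ring.ltn_rmodpN0 // monic_neq0.
apply/polyP => i; rewrite coef0.
apply: (@poly_generic_eq0 K _ (g * d)); first by rewrite mulf_neq0.
move=> t /St /(congr1 (fun p : {poly K} => p`_i)).
by rewrite coef_map coef0.
Qed.

End Lifting.

(** * Deformation of characters *)

Section Deformation.
Context (K : numClosedFieldType) (n : nat) (L : set 'M[K]_n) (z : 'M[K]_n).
Hypothesis n0 : (0 < n)%N.

Lemma commute_scale (t : K) (x : 'M[K]_n) : t != 0 ->
  x *m (t *: z) = (t *: z) *m x -> x *m z = z *m x.
Proof. by move=> t0; rewrite -scalemxAr -scalemxAl => /(scalerI t0). Qed.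

Lemma mxconj_commute (u y w : 'M[K]_n) : u \in unitmx ->
  y *m mxconj u w = mxconj u w *m y ->
  mxconj (invmx u) y *m w = w *m mxconj (invmx u) y.
Proof.
move=> uu yw; have uu' : invmx u \in unitmx by rewrite unitmx_inv.
by rewrite -{1}(mxconjK uu w) -{2}(mxconjK uu w) -!mxconjM // yw.
Qed.

Section OneParabolic.
Variables (T : 'M[K]_n) (b : 'I_n -> nat).
Hypothesis Tu : T \in unitmx.
Hypothesis bS : {homo b : i j / (i <= j)%N}.
Hypothesis Lz : levi_center T b L z.

Lemma deform_conj t e : t != 0 -> filt T b 1 e ->
  exists2 u, filt_group T b 1 u & t *: z + e = mxconj u (t *: z).
Proof.
move=> t0 e1; have [_ _ Cz0 Cz1] := Lz.
have z0 : filt T b 0 z by exact: Cz0.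
have [x x1 xz] : exists2 x, filt T b 1 x &
    (1%:M + x) *m (t *: z) = (t *: z + e) *m (1%:M + x).
  apply: filt1_conj => //; first exact: filtZ.
  by move=> x x1 /(commute_scale t0); exact: Cz1.
have xu : 1%:M + x \in unitmx by exact: (filt1_unit Tu bS).
exists (1%:M + x); last by rewrite /mxconj xz mulmxK.
have x1' : filt T b 1 (1%:M + x - 1%:M) by rewrite addrAC subrr add0r.
by split=> //; exact: (det_filt1 Tu bS (ltnSn 0) x1').
Qed.

Lemma unipotent_unit u : filt_group T b 1 u -> u \in unitmx.
Proof. by move=> [Su _]; exact: SL_unit. Qed.

Hypothesis LU : levi_factor (filt_group T b 0) (filt_group T b 1) L.

(** [L] meets the radical only in 1, so the decomposition is unique and [xget] has no choice. *)
Lemma levi_partE l u : L l -> filt_group T b 1 u ->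
  levi_part (filt_group T b 1) L (l *m u) = l.
Proof.
have [[[LS L1 LM LV] _] _ LI1] := LU; have [US U1 UM UV] := filt_subgroup b Tu 1.
move=> Ll Uu; apply: xget_unique; first by split=> //; exists u.
move=> l' [Ll' [u' Uu' lu]].
have lu' := SL_unit (LS _ Ll'); have uu := unipotent_unit Uu.
have : (L `&` filt_group T b 1) (invmx l' *m l).
  split; first by apply: LM => //; exact: LV.
  suff -> : invmx l' *m l = u' *m invmx u by apply: UM => //; exact: UV.
  by apply: (can_inj (mulmxK uu)); rewrite mulmxKV // -mulmxA lu mulKmx.
by rewrite LI1 => /= /(congr1 (mulmx l')); rewrite mulKVmx // mulmx1.
Qed.

(** Taking the Levi part is the restriction of a linear map: [l u = l + l (u - 1)] with [l] in the
    centralizer algebra of [z] and [l (u - 1)] in the nilradical, and these two subspaces meet in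
    0. *)
Lemma extend_character_regular nu : algebraic_character L nu ->
  exists2 f, regular f & forall x, filt_group T b 0 x ->
    extend_character (filt_group T b 1) L nu x = f x.
Proof.
have [_ LE _ Cz1] := Lz; have [[[LS _ _ _] _] LUP _] := LU.
move=> [[p pE] _ _].
have [N NE] : exists N : 'M[K]_(n * n), forall v, filt T b 1 (vec_mx v) <-> (v <= N)%MS.
  apply: (linear_setP (S := fun v => filt T b 1 (vec_mx v))).
  split; first by rewrite raddf0; exact: filt0.
  by move=> a u v u1 v1; rewrite linearP; exact: filt_lin.
pose C := kermx (intertwine z z).
have CN : (C :&: N)%MS = 0.
  apply/eqP; rewrite -submx0; apply/rV_subP => v;
    rewrite sub_capmx => /andP[/sub_kermxP vC /NE vN].
  rewrite -[v]vec_mxK; suff -> : vec_mx v = 0 by rewrite raddf0 sub0mx.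
  by apply: Cz1 => //; apply/intertwineP; rewrite vec_mxK.
pose F (x : 'M[K]_n) : 'M[K]_n := vec_mx (mxvec x *m proj_mx C N).
exists (fun x => mxeval p (F x)).
  apply: regular_comp; first by exists p.
  move=> i j; have [q qE] := @regmx_lin K n n n _ id (proj_mx C N) (@regmx_id K n) 0
    (mxvec_index i j).
  by exists q => x; rewrite -qE /F mxE.
move=> x; rewrite -LUP => -[l Ll [u Uu <-]].
rewrite /extend_character /= levi_partE // pE //; congr mxeval.
have := Ll; rewrite LE => -[Sl lz]; have [Su u1] := Uu.
have -> : l *m u = l + l *m (u - 1%:M) by rewrite mulmxBr mulmx1 addrCA subrr addr0.
rewrite /F raddfD /= mulmxDl proj_mx_id //; last first.
  by apply/sub_kermxP/intertwineP.
rewrite proj_mx_0 // ?addr0 ?mxvecK //; apply/NE; rewrite mxvecK.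
apply: filtMl => //.
have : filt_group T b 0 l by rewrite -LUP; exists l => //; exists 1%:M;
  rewrite ?mulmx1 //; have [] := filt_subgroup b Tu 1.
exact: filt_group_sub0.
Qed.

Lemma extend_character_conj nu l u : L l -> filt_group T b 1 u ->
  extend_character (filt_group T b 1) L nu (mxconj u l) = nu l.
Proof.
have [[[LS _ _ LV] _] LUP _] := LU; have [US U1 UM UV] := filt_subgroup b Tu 1.
move=> Ll Uu; have lu := SL_unit (LS _ Ll).
have LP g : L g -> filt_group T b 0 g.
  by move=> Lg; rewrite -LUP; exists g => //; exists 1%:M; rewrite ?mulmx1.
have l0 := filt_group_sub0 Tu (LP _ Ll).
have lV0 := filt_group_sub0 Tu (LP _ (LV _ Ll)).
have -> : mxconj u l = l *m (mxconj (invmx l) u *m invmx u).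
  by rewrite /mxconj invmxK !mulmxA mulmxV // mul1mx.
rewrite /extend_character /= levi_partE //; apply: UM; last exact: UV.
have [Su u1] := Uu; have lVu : invmx l \in unitmx by rewrite unitmx_inv.
split; first by rewrite /SL /= det_mxconj.
rewrite -(mxconj1 lVu) -mxconjB /mxconj invmxK.
by apply: filtMr => //; exact: filtMl.
Qed.

End OneParabolic.

Section TwoParabolics.
Variables (T1 T2 : 'M[K]_n) (b1 b2 : 'I_n -> nat).
Hypothesis T1u : T1 \in unitmx.
Hypothesis T2u : T2 \in unitmx.
Hypothesis b1S : {homo b1 : i j / (i <= j)%N}.
Hypothesis b2S : {homo b2 : i j / (i <= j)%N}.
Hypothesis Lz1 : levi_center T1 b1 L z.
Hypothesis Lz2 : levi_center T2 b2 L z.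
Variables (e1 e2 k0 : 'M[K]_n).
Hypothesis e11 : filt T1 b1 1 e1.
Hypothesis e21 : filt T2 b2 1 e2.
Hypothesis k0u : k0 \in unitmx.
Hypothesis ke : e2 = mxconj k0 e1.
Hypothesis rz : (\rank (intertwine z z) <= \rank (intertwine e1 e1))%N.

(** The conjugators [u] and [v] for the two parabolics may differ, since the rank of [intertwine] is
    insensitive to conjugating its two arguments independently. *)
Lemma rank_deformation t :
  (\rank (intertwine (t *: z + e1)%R (t *: z + e2)%R) <= \rank (intertwine e1 e2))%N.
Proof.
have [->|t0] := eqVneq t 0; first by rewrite scale0r !add0r.
have [u Uu ->] := deform_conj T1u b1S Lz1 t0 e11.
have [v Uv ->] := deform_conj T2u b2S Lz2 t0 e21.
apply: leq_trans (rank_intertwine_conj _ _ (unipotent_unit Uu) (unipotent_unit Uv)) _.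
apply: leq_trans (rank_intertwine_scale _ _ _) _; apply: leq_trans rz _.
have k0u' : invmx k0 \in unitmx by rewrite unitmx_inv.
have := rank_intertwine_conj e1 e2 (unitmx1 K n) k0u'.
by rewrite {1}ke mxconjK // /mxconj mul1mx invmx1 mulmx1.
Qed.

End TwoParabolics.

(** The inclusion of [G^e] in [P], for the whole centralizer algebra. It survives the limit because
    [filt T b 0] is cut out by linear equations. *)
Lemma centralizer_sub_parabolic (T : 'M[K]_n) (b : 'I_n -> nat) e g :
  T \in unitmx -> {homo b : i j / (i <= j)%N} -> levi_center T b L z ->
  filt T b 1 e -> (\rank (intertwine z z) <= \rank (intertwine e e))%N ->
  g *m e = e *m g -> filt T b 0 g.
Proof.
move=> Tu bS Lz e1 rz ge; have [_ _ Cz0 _] := Lz.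
have e1E : e = mxconj 1%:M e by rewrite /mxconj mul1mx invmx1 mulmx1.
have [k [kg kt]] := lift_intertwiner
  (rank_deformation Tu Tu bS bS Lz Lz e1 e1 (unitmx1 K n) e1E rz) ge.
have kt0 t : t != 0 -> filt T b 0 (evalmx k t).
  move=> t0; have := kt t; have [u Uu ->] := deform_conj Tu bS Lz t0 e1.
  have uu := unipotent_unit Uu; have u0 := filt_group_sub0 Tu Uu.
  move=> /(mxconj_commute uu)/(commute_scale t0)/Cz0 ku.
  rewrite -[evalmx k t](mxconjVK uu).
  by apply: filtMr => //; [exact: filtMl|exact: filtV].
move=> i j ij.
pose w := (map_mx polyC T *m k *m map_mx polyC (invmx T)) i j.
have wE t : w.[t] = mxconj T (evalmx k t) i j.
  transitivity (evalmx (map_mx polyC T *m k *m map_mx polyC (invmx T)) t i j).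
    by rewrite [RHS]mxE.
  by rewrite !evalmxM !evalmxC.
rewrite -kg -wE; suff -> : w = 0 by rewrite horner0.
apply: (@poly_generic_eq0 K _ 'X); first by rewrite polyX_eq0.
by move=> t; rewrite hornerX => /kt0 tk; rewrite wE tk.
Qed.

End Deformation.

Lemma mxconj_scale (K : fieldType) n (T x : 'M[K]_n) c :
  c != 0 -> T \in unitmx -> mxconj (c *: T) x = mxconj T x.
Proof.
move=> c0 Tu; rewrite /mxconj; have cTu : c *: T \in unitmx by rewrite unitmxZ ?unitfE.
have -> : invmx (c *: T) = c^-1 *: invmx T.
  apply: (can_inj (mulKmx cTu)); rewrite mulmxV //.
  by rewrite -scalemxAl -scalemxAr scalerA mulfV // scale1r mulmxV.
by rewrite -!scalemxAl -scalemxAr scalerA mulfV // scale1r.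
Qed.

Section CharacterDeformation.
Context (K : numClosedFieldType) (n : nat) (L : set 'M[K]_n) (z : 'M[K]_n).
Hypothesis n0 : (0 < n)%N.
Variables (T1 T2 : 'M[K]_n) (b1 b2 : 'I_n -> nat).
Hypothesis T1u : T1 \in unitmx.
Hypothesis T2u : T2 \in unitmx.
Hypothesis b1S : {homo b1 : i j / (i <= j)%N}.
Hypothesis b2S : {homo b2 : i j / (i <= j)%N}.
Hypothesis Lz1 : levi_center T1 b1 L z.
Hypothesis Lz2 : levi_center T2 b2 L z.
Variables (e1 e2 k0 : 'M[K]_n).
Hypothesis e11 : filt T1 b1 1 e1.
Hypothesis e21 : filt T2 b2 1 e2.
Hypothesis k0u : k0 \in unitmx.
Hypothesis ke : e2 = mxconj k0 e1.
Hypothesis rz : (\rank (intertwine z z) <= \rank (intertwine e1 e1))%N.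
Variables (nu f1 f2 : 'M[K]_n -> K).
Hypothesis nuM : forall x y, L x -> L y -> nu (x *m y) = nu x * nu y.
Hypothesis nu0 : forall x, L x -> nu x != 0.
Hypothesis rf1 : regular f1.
Hypothesis rf2 : regular f2.
Hypothesis f1E : forall l u, L l -> filt_group T1 b1 1 u -> f1 (mxconj u l) = nu l.
Hypothesis f2E : forall l u, L l -> filt_group T2 b2 1 u -> f2 (mxconj u l) = nu l.

(** Undoing the conjugations by [u] and [v] turns [x] into an element [l] of [L] and [k] into a
    matrix [w] commuting with [z]. A multiple [l'] of [w] lies in [L], and [nu], having commutative
    values, agrees on [l] and its conjugate by [l']. *)
Lemma deformed_character t k x : t != 0 -> k \in unitmx -> SL x ->
  k *m (t *: z + e1) = (t *: z + e2) *m k ->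
  x *m (t *: z + e1) = (t *: z + e1) *m x -> f2 (mxconj k x) = f1 x.
Proof.
move=> t0 ku Sx; have [_ LE _ _] := Lz1.
have [u Uu ->] := deform_conj T1u b1S Lz1 t0 e11.
have [v Uv ->] := deform_conj T2u b2S Lz2 t0 e21.
have uu := unipotent_unit Uu; have vu := unipotent_unit Uv.
have uu' : invmx u \in unitmx by rewrite unitmx_inv.
have vu' : invmx v \in unitmx by rewrite unitmx_inv.
move=> kz /(mxconj_commute uu)/(commute_scale t0).
set l := mxconj (invmx u) x => lz.
have Sl : SL l by rewrite /SL /= det_mxconj.
have xE : x = mxconj u l by rewrite mxconjVK.
clearbody l; have Ll : L l by rewrite LE.
pose w := invmx v *m k *m u.
have wu : w \in unitmx by rewrite !unitmx_mul vu' ku.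
have wz : w *m z = z *m w.
  apply: (commute_scale t0); rewrite /w.
  have ku' : k *m u *m (t *: z) = v *m (t *: z) *m (invmx v *m (k *m u)).
    have := congr1 (fun y => y *m u) kz.
    by rewrite /mxconj -!mulmxA mulVmx // mulmx1.
  by rewrite -!mulmxA (mulmxA k) ku' -!mulmxA mulKmx.
have [c c0 Sw] := SL_scale n0 wu.
set l' := c *: w in Sw.
have Ll' : L l'.
  by rewrite LE; split=> //; rewrite /l' -scalemxAl wz scalemxAr.
have l'u := SL_unit Sw.
have Lc : L (mxconj l' l).
  rewrite LE; split; first by rewrite /SL /= det_mxconj.
  have l'z : mxconj l' z = z.
    by have := Ll'; rewrite LE => -[_ l'z]; rewrite /mxconj l'z mulmxK.
  by rewrite -{1}l'z -mxconjM // lz mxconjM // l'z.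
have -> : mxconj k x = mxconj v (mxconj l' l).
  rewrite xE !mxconj_mul //; have vl : v *m l' = c *: (k *m u).
    by rewrite /l' -scalemxAr /w !mulmxA mulmxV // mul1mx.
  have ku0 : k *m u \in unitmx by rewrite unitmx_mul ku.
  by rewrite vl mxconj_scale.
rewrite xE f1E // f2E //; apply: (mulIf (nu0 Ll')).
rewrite -nuM // /mxconj mulmxKV //; rewrite nuM // mulrC //.
Qed.

(* The deformation [g t] of [g0] commutes with [t z + e1] but has determinant
   [d t]; the elements [g t / c] with [c ^+ n = d t] lie in [SL]. *)
Lemma limit_character g0 : SL g0 -> g0 *m e1 = e1 *m g0 ->
  f2 (mxconj k0 g0) = f1 g0.
Proof.
move=> Sg0 g0e.
have ke0 : k0 *m e1 = e2 *m k0 by rewrite ke /mxconj mulmxKV.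
have [k [k0E kt]] := lift_intertwiner
  (rank_deformation T1u T2u b1S b2S Lz1 Lz2 e11 e21 k0u ke rz) ke0.
have e1E : e1 = mxconj 1%:M e1 by rewrite /mxconj mul1mx invmx1 mulmx1.
have [g [g0E gt]] := lift_intertwiner
  (rank_deformation T1u T1u b1S b1S Lz1 Lz1 e11 e11 (unitmx1 K n) e1E rz) g0e.
pose d := \det g; pose kappa := \det k.
have d0 : d.[0] = 1 by rewrite -det_evalmx g0E.
have kappa0 : kappa.[0] != 0 by rewrite -det_evalmx k0E -unitfE -unitmxE.
have kappaE t : kappa.[t] = \det (evalmx k t) by rewrite det_evalmx.
pose ev (q : {poly {poly K}}) (x : K * K) := (map_poly (horner_eval x.1) q).[x.2].
pose Q (f : K * K -> K) := exists q, forall x, f x = ev q x.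
have evC (p : {poly K}) x : ev p%:P x = p.[x.1] by rewrite /ev map_polyC hornerC.
have evX x : ev 'X x = x.2 by rewrite /ev map_polyX hornerX.
have evD p q x : ev (p + q) x = ev p x + ev q x by rewrite /ev rmorphD hornerD.
have evM p q x : ev (p * q) x = ev p x * ev q x by rewrite /ev rmorphM hornerM.
have QC c : Q (fun=> c) by exists c%:P%:P => x; rewrite evC hornerC.
have QD f h : Q f -> Q h -> Q (fun x => f x + h x).
  by move=> [p pf] [q qh]; exists (p + q) => x; rewrite evD pf qh.
have QM f h : Q f -> Q h -> Q (fun x => f x * h x).
  by move=> [p pf] [q qh]; exists (p * q) => x; rewrite evM pf qh.
have Qp (p : {poly K}) : Q (fun x => p.[x.1]) by exists p%:P => x; rewrite evC.
(* [D] clears the denominators of [h1] and [h2]: the coordinate [c] from the scaling into [SL], and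
   [kappa] from the inverse of the lifted [k]. *)
pose D (x : K * K) := x.2 * kappa.[x.1].
have QDD : Q D by apply: QM; [exists 'X => x; rewrite evX|exact: Qp].
pose h1 (x : K * K) := x.2^-1 *: evalmx g x.1.
pose h2 (x : K * K) := mxconj (evalmx k x.1) (h1 x).
have D_neq0 x : D x != 0 -> x.2 != 0 /\ kappa.[x.1] != 0.
  by rewrite mulf_eq0 negb_or => /andP.
have k_unit x : D x != 0 -> evalmx k x.1 \in unitmx.
  by move=> /D_neq0[_ kx]; rewrite unitmxE unitfE -kappaE.
have h1Q i j : exists2 f, Q f & forall x, D x != 0 -> h1 x i j = f x / D x.
  exists (fun x => (g i j * kappa).[x.1]); first exact: Qp.
  by move=> x /D_neq0[x2 kx]; rewrite !mxE hornerM -mulf_div divff // mulr1 mulrC.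
have h2Q i j : exists2 f, Q f & forall x, D x != 0 -> h2 x i j = f x / D x.
  exists (fun x => ((k *m g *m \adj k) i j).[x.1]); first exact: Qp.
  move=> x Dx; have [x2 kx] := D_neq0 x Dx.
  have -> : ((k *m g *m \adj k) i j).[x.1] = evalmx (k *m g *m \adj k) x.1 i j by
    rewrite [RHS]mxE.
  have ZE a (A : 'M[K]_n) : (a *: A) i j = a * A i j by rewrite mxE.
  rewrite !evalmxM evalmx_adj /h2 /h1 mxconjZ ZE /mxconj /invmx k_unit // -kappaE.
  by rewrite -scalemxAr ZE /D invfM mulrA mulrC.
have [p1 p1E] := rf1; have [p2 p2E] := rf2.
have [q1 Qq1 [N1 q1E]] := mxeval_fraction p1 QC QD QM QDD h1Q.
have [q2 Qq2 [N2 q2E]] := mxeval_fraction p2 QC QD QM QDD h2Q.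
have QX N : Q (fun x => D x ^+ N).
  elim: N => [|N IH]; first by under eq_fun do rewrite expr0.
  by under eq_fun do rewrite exprS; exact: QM.
have [W WE] : Q (fun x => q1 x * D x ^+ N2 + (-1) * (q2 x * D x ^+ N1)).
  by apply: QD; [exact: QM|apply: (QM _ _ (QC _)); exact: QM].
have Weq x : D x != 0 -> (ev W x == 0) = (f1 (h1 x) == f2 (h2 x)).
  move=> Dx; rewrite -WE p1E p2E q1E // q2E // mulN1r subr_eq0.
  by rewrite -eqr_div ?expf_neq0.
have dn0 : d != 0 by apply: contra_eq_neq d0 => ->; rewrite horner0 eq_sym oner_neq0.
(* The factor ['X] excludes [t = 0], to which [deformed_character] does not apply; the others keep
   the lifts invertible. *)
have gn0 : 'X * (d * kappa) != 0.
  rewrite !mulf_neq0 ?polyX_eq0 //.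
  by apply: contraNneq kappa0 => ->; rewrite horner0.
have gen t c : ('X * (d * kappa)).[t] != 0 -> c ^+ n = d.[t] -> ev W (t, c) = 0.
  rewrite !hornerM hornerX !mulf_eq0 !negb_or => /and3P[t0 dt kt0] cn.
  have c0 : c != 0.
    by apply: contraNneq dt => c0; rewrite -cn c0 expr0n -leqn0 leqNgt n0.
  have Dx : D (t, c) != 0 by rewrite mulf_neq0.
  apply/eqP; rewrite Weq //; apply/eqP/esym; rewrite /h2 /=.
  apply: (deformed_character t0) => //.
  - exact: (k_unit _ Dx).
  - by rewrite /h1 /SL /= detZ det_evalmx -/d -cn exprVn mulVf // expf_neq0.
  - by rewrite /h1 /= -scalemxAl gt scalemxAr.
have := root_unity_curve n0 dn0 gn0 gen.
(* The point [(0, 1)] is on the curve because [g0] has determinant 1; there [h1] is [g0] and [h2]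
   its conjugate by [k0]. *)
move=> /(_ 0 1); rewrite d0 expr1n => /(_ erefl) W0.
have Dx : D (0, 1) != 0 by rewrite mulf_neq0 ?oner_neq0.
have /eqP := W0; rewrite -[_.[1]]/(ev W (0, 1)) Weq // => /eqP/esym.
by rewrite /h2 /h1 /= invr1 scale1r g0E k0E.
Qed.

End CharacterDeformation.

(** * Transport between Richardson elements *)

Section Transport.
Context (K : numClosedFieldType) (n : nat).

(** The rank for [(y, y)] is constant on [O] and [O] is dense in the nilradical, so semicontinuity
    bounds the rank at a conjugate of the explicit [N] by the one at [e1]; the rank at [N] already
    dominates that at [z]. *)
Lemma richardson_rank (O : set 'M[K]_n) (T : 'M[K]_n) (b : 'I_n -> nat) z e1 :
  T \in unitmx -> {homo b : i j / (i <= j)%N} ->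
  nilpotent_orbit O -> filt T b 1 `<=` zclosure (O `&` filt T b 1) -> O e1 ->
  (exists S (d : 'I_n -> K), [/\ S \in unitmx,
      mxconj S z = diag_mx (\row_i d i) & forall i j, (d i == d j) = (b i == b j)]) ->
  (\rank (intertwine z z) <= \rank (intertwine e1 e1))%N.
Proof.
move=> Tu bS [e [_ _ OE]] Od Oe1 [S [d [Su Sz db]]].
have [N N1 rN] := exists_regular_nilpotent bS db.
have Tu' : invmx T \in unitmx by rewrite unitmx_inv.
have Su' : invmx S \in unitmx by rewrite unitmx_inv.
have NT : filt T b 1 (mxconj (invmx T) N).
  by move=> i j; rewrite addn1 ltnS mxconjVK //; exact: N1.
apply: (@leq_trans (\rank (intertwine (mxconj (invmx T) N) (mxconj (invmx T) N))));
  last first.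
  apply: (zclosure_rank (@regmx_intertwine K n) _ (Od _ NT)) => y [Oy _].
  have [h hu ->] : exists2 h, h \in unitmx & y = mxconj h e1.
    move: Oe1 Oy; rewrite OE => -[g1 Sg1 <-] [g2 Sg2 <-].
    have g1u := SL_unit Sg1; have g2u := SL_unit Sg2.
    exists (g2 *m invmx g1); first by rewrite unitmx_mul g2u unitmx_inv.
    by rewrite -[in RHS]mxconj_mul ?mxconjK // unitmx_inv.
  exact: rank_intertwine_conj.
have := rank_intertwine_conj (mxconj (invmx T) N) (mxconj (invmx T) N) Tu Tu.
rewrite mxconjVK //; apply: leq_trans; apply: leq_trans rN.
have := rank_intertwine_conj (mxconj S z) (mxconj S z) Su' Su'.
by rewrite mxconjK // Sz.
Qed.

Lemma id_component_conj (k : 'M[K]_n) (A B : set 'M[K]_n) x : k \in unitmx ->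
  A 1%:M -> (forall y, A y -> B (mxconj k y)) ->
  id_component A x -> id_component B (mxconj k x).
Proof.
move=> ku A1 AB Ax.
have cC : zconnected (mxconj k @` id_component A).
  apply: zconnected_image; last exact: component_connected.
  exact: (regmx_conj k (@regmx_id K n)).
apply: (connected_component_max _ _ cC).
- by exists 1%:M; [exact: connected_component_refl|exact: mxconj1].
- by move=> _ [y /connected_component_sub Ay <-]; exact: AB.
- by exists x.
Qed.

Lemma stab_conj (k e x : 'M[K]_n) : k \in unitmx ->
  stab (@SL K n) e x -> stab (@SL K n) (mxconj k e) (mxconj k x).
Proof.
move=> ku [Sx xe]; have xu := SL_unit Sx.
have xe' : x *m e = e *m x by rewrite -{2}xe /mxconj mulmxKV.
split; first by rewrite /SL /= det_mxconj.
have kxu : mxconj k x \in unitmx by rewrite mxconj_unit.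
by rewrite {1}/mxconj -mxconjM // xe' mxconjM // mulmxK.
Qed.

Lemma stab1 (e : 'M[K]_n) : stab (@SL K n) e 1%:M.
Proof. by split; rewrite ?/SL /= ?det1 // /mxconj mul1mx invmx1 mulmx1. Qed.

Lemma conj_lcoset (k e y : 'M[K]_n) : k \in unitmx ->
  mxconj k @` lcoset y (id_component (stab (@SL K n) e)) =
  lcoset (mxconj k y) (id_component (stab (@SL K n) (mxconj k e))).
Proof.
move=> ku; have ku' : invmx k \in unitmx by rewrite unitmx_inv.
apply/seteqP; split=> [_ [_ [h hC <-] <-]|_ [h hC <-]].
  exists (mxconj k h); last by rewrite mxconjM.
  apply: id_component_conj hC => //; first exact: stab1.
  by move=> x; exact: stab_conj.
exists (y *m mxconj (invmx k) h); last by rewrite mxconjM // mxconjVK.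
exists (mxconj (invmx k) h) => //.
apply: id_component_conj hC => //; first exact: stab1.
by move=> x /(stab_conj ku'); rewrite mxconjK.
Qed.

End Transport.

Lemma levi_conj_parabolic (K : numClosedFieldType) n (T : 'M[K]_n)
    (b : 'I_n -> nat) L l u : T \in unitmx ->
  levi_factor (filt_group T b 0) (filt_group T b 1) L ->
  L l -> filt_group T b 1 u -> filt_group T b 0 (mxconj u l).
Proof.
move=> Tu [_ LUP _] Ll [Su u1].
have [_ _ PM PV] := filt_subgroup b Tu 0; have [_ U1 _ _] := filt_subgroup b Tu 1.
have Pu : filt_group T b 0 u by split=> //; exact: (filt_sub (leq0n 1)).
have Pl : filt_group T b 0 l by rewrite -LUP; exists l => //; exists 1%:M;
  rewrite ?mulmx1.
by apply: (PM) => //; [exact: PM|exact: PV].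
Qed.

Lemma richardson_lifts (K : numClosedFieldType) (n : nat) (n0 : (0 < n)%N)
    (O P1 U1 P2 U2 L1 : set 'M[K]_n)
    (nu : 'M[K]_n -> K) (chi : 'M[K]_n -> set 'M[K]_n -> K) :
  nilpotent_orbit O -> richardson O P1 U1 -> richardson O P2 U2 ->
  levi_factor P1 U1 L1 -> levi_factor P2 U2 L1 ->
  algebraic_character L1 nu -> component_character O chi ->
  lifts O P1 U1 (extend_character U1 L1 nu) chi ->
  lifts O P2 U2 (extend_character U2 L1 nu) chi.
Proof.
move=> nO [pP1 uU1 dO1] [pP2 uU2 dO2] LP1 LP2 nuL [_ _ chiC].
have [T1 [b1 [T1u b1S P1E]]] := parabolic_filt n0 pP1.
have [T2 [b2 [T2u b2S P2E]]] := parabolic_filt n0 pP2.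
rewrite {}P1E in uU1 LP1 *; rewrite {}P2E in uU2 LP2 *.
have U1E := unipotent_radical_filt n0 T1u b1S uU1.
have U2E := unipotent_radical_filt n0 T2u b2S uU2.
rewrite {}U1E {uU1} in dO1 LP1 *; rewrite {}U2E {uU2} in dO2 LP2 *.
rewrite /lifts !lie_algebra_filt // in dO1 dO2 *.
have [z Lz1 zS] := levi_factor_center T1u b1S n0 LP1.
have [Lz LE _ _] := Lz1.
have Lz2 := levi_center_transfer T2u b2S n0 LP2 Lz LE.
have [f1 rf1 f1E] := extend_character_regular T1u Lz1 LP1 nuL.
have [f2 rf2 f2E] := extend_character_regular T2u Lz2 LP2 nuL.
have [_ nuM nu0] := nuL.
move=> [e1 [[Oe1 e11] mu1 mu1chi]].
(* If the intersection were empty, the constant function 1 would vanish on it, hence at 0, which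
   lies in its closure. *)
have [e2 [Oe2 e21]] : (O `&` filt T2 b2 1) !=set0.
  apply: contrapT => OT0; suff /eqP : (1 : K) = 0 by rewrite oner_eq0.
  apply: (@zclosure_zero K n (O `&` filt T2 b2 1) (fun=> 1) 0).
  - exact: regular_cst.
  - by move=> y Oy; case: OT0; exists y.
  - by apply: dO2; exact: filt0.
have [k Sk ke] : exists2 k, SL k & e2 = mxconj k e1.
  have [e [_ _ OE]] := nO; move: Oe1 Oe2; rewrite OE => -[g1 Sg1 <-] [g2 Sg2 <-].
  have g1u := SL_unit Sg1; have g2u := SL_unit Sg2.
  exists (g2 *m invmx g1).
    by rewrite /SL /= det_mulmx det_inv Sg1 Sg2 invr1 mulr1.
  by rewrite -[in RHS]mxconj_mul ?mxconjK // unitmx_inv.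
have ku := SL_unit Sk; have ku' : invmx k \in unitmx by rewrite unitmx_inv.
have rz := richardson_rank T1u b1S nO dO1 Oe1 zS.
have stab_com (e g : 'M[K]_n) : stab (@SL K n) e g -> g *m e = e *m g.
  by move=> [/SL_unit gu ge]; rewrite -{2}ge /mxconj mulmxKV.
have stab_sub x : stab (@SL K n) e1 x -> stab (filt_group T1 b1 0) e1 x.
  move=> xs; have [Sx xe] := xs; split=> //; rewrite filt_group0 //; split=> //.
  exact: (centralizer_sub_parabolic T1u b1S Lz1 e11 rz (stab_com _ _ xs)).
have stab21 x : stab (filt_group T2 b2 0) e2 x -> stab (@SL K n) e1 (mxconj (invmx k) x).
  move=> [[Sx _] xe]; rewrite -[e1](mxconjK ku) -ke.
  by apply: stab_conj => //; split.
have main x : stab (filt_group T2 b2 0) e2 x ->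
    extend_character (filt_group T2 b2 1) L1 nu x =
    extend_character (filt_group T1 b1 1) L1 nu (mxconj (invmx k) x).
  move=> xs; have ys := stab21 x xs; have [yP _] := stab_sub _ ys.
  rewrite f1E // f2E; last by case: xs.
  rewrite -{1}[x](mxconjVK ku); have [Sy _] := ys.
  apply: (limit_character (L := L1) n0 T1u T2u b1S b2S Lz1 Lz2 e11 e21 ku ke rz nuM nu0
    rf1 rf2) => //.
  - move=> l u Ll Uu; rewrite -f1E; first exact: (extend_character_conj T1u LP1).
    exact: (levi_conj_parabolic T1u LP1).
  - move=> l u Ll Uu; rewrite -f2E; first exact: (extend_character_conj T2u LP2).
    exact: (levi_conj_parabolic T2u LP2).
  - exact: stab_com.
(* Conjugation by [invmx k] maps the stabilizer of [e2] into that of [e1], hence identity component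
   into identity component, where the first extension is 1. *)
exists e2; split=> // x xs.
  have xs2 := connected_component_sub xs.
  rewrite main //; apply: mu1.
  apply: id_component_conj xs => //.
    by split; [have [] := filt_subgroup b2 T2u 0|have [] := stab1 e2].
  by move=> y /stab21/stab_sub.
have ys := stab21 x xs.
rewrite main // mu1chi; last exact: stab_sub.
rewrite ke -[x in RHS](mxconjVK ku) -conj_lcoset // chiC //.
by exists (mxconj (invmx k) x).
Qed.

Theorem proposition6p5 (R : realType) (n : nat) (hn : (0 < n)%N)
    (O P1 U1 P2 U2 L1 : set 'M[R[i]]_n)
    (nu : 'M[R[i]]_n -> R[i]) (chi : 'M[R[i]]_n -> set 'M[R[i]]_n -> R[i]) :
  nilpotent_orbit O ->
  richardson O P1 U1 ->
  richardson O P2 U2 ->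
  levi_factor P1 U1 L1 ->
  levi_factor P2 U2 L1 ->
  algebraic_character L1 nu ->
  component_character O chi ->
  lifts O P1 U1 (extend_character U1 L1 nu) chi ->
  lifts O P2 U2 (extend_character U2 L1 nu) chi.
Proof. exact: richardson_lifts. Qed.
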